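(* Let $p$ be a prime with $p \equiv 1 \pmod 8$, let $b,c$ be positive integers with $p=b^{2}+c^{2}$, let $m\geq 2$ be an integer, and let $\mathcal Q$ be a finite directly regular $4$-polytope of type $\{\{4,4\}_{(m,0)},\{4,3\}\}$ such that $p(p^{2}-1)$ does not divide $|\Gamma(\mathcal{Q})|$. Then there exists a chiral $4$-polytope, whose automorphism group is isomorphic to $L_{2}(p)\times \Gamma^{+}(\mathcal{Q})$, of type $\{\{4,4\}_{(m,0)},\{4,3\}\}$ if $p\mid m$, and of type $\{\{4,4\}_{(mb,mc)},\{4,3\}\}$ if $p\nmid m$. Its facets are regular in the first case and chiral in the second case.
   Context: An abstract $n$-polytope is a ranked poset (ranks $-1,\dots,n$) with a least and a greatest face, all flags of size $n+2$, strongly flag-connected, and satisfying the diamond condition; $\Gamma(\mathcal P)$ is its automorphism group. $\mathcal P$ is regular if $\Gamma(\mathcal P)$ is flag-transitive, and chiral if $\Gamma(\mathcal P)$ has exactly two flag orbits with adjacent flags always in distinct orbits. For regular $\mathcal P$, $\Gamma(\mathcal P)$ is generated by involutions $\rho_0,\dots,\rho_{n-1}$; the rotation subgroup $\Gamma^+(\mathcal P)$ is generated by $\sigma_i=\rho_{i-1}\rho_i$, has index at most $2$, and $\mathcal P$ is directly regular if the index is $2$. A polytope is of type $\{\mathcal P_1,\mathcal P_2\}$ if its facets are isomorphic to $\mathcal P_1$ and its vertex-figures to $\mathcal P_2$. $\{4,3\}$ is the cube; $\{4,4\}_{(b,c)}$ is the toroidal map obtained from the square tessellation of the plane by factoring out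 the translation lattice generated by $(b,c)$ and $(-c,b)$; it is regular if $bc=0$ or $b=c$ and chiral otherwise. $L_2(p)=PSL_2(p)$. *)

(* Defs.v *)
From HB Require Import structures.
From mathcomp Require Import all_boot all_order all_algebra all_fingroup all_solvable.
From mathcomp Require Import generic_quotient zify boolp.
Set Implicit Arguments. Unset Strict Implicit. Unset Printing Implicit Defensive.
Import Order.TTheory GRing.Theory Num.Theory.
Local Open Scope order_scope.

(* Flags, adjacency and automorphisms only depend on the order. *)
Section FinitePosets.
Variables (d : Order.disp_t) (P : finPOrderType d).
Implicit Types Phi Psi : {set P}.

Definition chain : pred {set P} :=
  fun C => [forall x in C, forall y in C, x >=< y].

Definition flag : pred {set P} := fun Phi => maxset chain Phi.

Definition flags : {set {set P}} := [set Phi | flag Phi].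

Definition adjacent : rel {set P} := fun Phi Psi =>
  [&& flag Phi, flag Psi, #|Phi :\: Psi| == 1 & #|Psi :\: Phi| == 1]%N.

Definition strongly_flag_connected : Prop :=
  forall Phi Psi, flag Phi -> flag Psi ->
    connect [rel A B | [&& adjacent A B, Phi :&: Psi \subset A
                                       & Phi :&: Psi \subset B]] Phi Psi.

Definition Gamma : {set {perm P}} :=
  [set s : {perm P} | [forall x, forall y, (s x <= s y) == (x <= y)]].

Lemma GammaP (s : {perm P}) :
  reflect {mono s : x y / x <= y} (s \in Gamma).
Proof.
rewrite inE; apply: (iffP forallP) => [h x y | h x]; first exact/eqP/(forallP (h x)).
by apply/forallP=> y; rewrite h.
Qed.

Lemma group_set_Gamma : group_set Gamma.
Proof.
apply/group_setP; split=> [|s t /GammaP hs /GammaP ht]; apply/GammaP => x y.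
  by rewrite !perm1.
by rewrite !permM ht hs.
Qed.

Canonical Gamma_group := Group group_set_Gamma.

Definition regular : Prop := [transitive Gamma, on flags | 'P^*].

Definition chiral : Prop :=
  #|[set orbit 'P^* Gamma Phi | Phi in flags]| = 2%N /\
  (forall Phi Psi, adjacent Phi Psi -> Psi \notin orbit 'P^* Gamma Phi).

End FinitePosets.

Arguments Gamma {d} P.
Arguments regular {d} P.
Arguments chiral {d} P.

Definition poset_iso d1 d2 (P : porderType d1) (K : porderType d2) : Prop :=
  exists f : P -> K, bijective f /\ {mono f : x y / x <= y}.

Section Sections.
Variables (d : Order.disp_t) (P : finPOrderType d) (x y : P).

Record section (le_xy : x <= y) : Type :=
  Section { section_val : P; _ : x <= section_val <= y }.

Variable le_xy : x <= y.
Local Notation S := (section le_xy).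

HB.instance Definition _ := [isSub for @section_val le_xy].
HB.instance Definition _ := [Finite of S by <:].
HB.instance Definition _ := [SubChoice_isSubPOrder of S by <: with d].

Fact section_bot_subproof : x <= x <= y. Proof. by rewrite lexx. Qed.
Fact section_top_subproof : x <= y <= y. Proof. by rewrite lexx andbT. Qed.
Fact section_le0x (z : S) : (Sub x section_bot_subproof : S) <= z.
Proof. by rewrite -Order.le_val SubK; case/andP: (valP z). Qed.
Fact section_lex1 (z : S) : z <= (Sub y section_top_subproof : S).
Proof. by rewrite -Order.le_val SubK; case/andP: (valP z). Qed.

HB.instance Definition _ := Order.hasBottom.Build d S section_le0x.
HB.instance Definition _ := Order.hasTop.Build d S section_lex1.

End Sections.

(* Only finite polytopes are considered; a polytope with finite automorphism
   group and finitely many flag orbits is finite. *)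
Record polytope (n : nat) := Polytope {
  pdisp : Order.disp_t;
  face :> finTBPOrderType pdisp;
  rank : face -> int;
  rank_bot : rank \bot = (-1)%R;
  rank_top : rank \top = n;
  rank_lt : {homo rank : x y / x < y};
  card_flag : forall Phi : {set face}, flag Phi -> #|Phi| = n.+2;
  flag_connected : strongly_flag_connected face;
  diamond : forall x y : face, x < y -> rank y = (rank x + 2)%R ->
    #|[set z | x < z < y]| = 2%N
}.

Arguments rank {n p}.

Section Polytopes.
Variables (n : nat) (P : polytope n).
Implicit Types (F v : P) (Phi : {set P}) (i : nat).

Definition is_facet F : Prop := rank F = (n%:Z - 1)%R.
Definition facet F := section (le0x F).
Definition is_vertex v : Prop := rank v = 0%R.
Definition vertex_figure v := section (lex1 v).

Definition of_type d1 d2 (K1 : porderType d1) (K2 : porderType d2) : Prop :=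
  (forall F, is_facet F -> poset_iso (facet F) K1) /\
  (forall v, is_vertex v -> poset_iso (vertex_figure v) K2).

Definition i_adjacent i : rel {set P} := fun Phi Psi =>
  adjacent Phi Psi && [forall x in Phi :\: Psi, rank x == i%:Z%R].

(* If P is regular and i < n, there is exactly one automorphism taking the base flag Phi
   to its i-adjacent flag; the default value 1 is then never used. *)
Definition rho Phi i : {perm P} :=
  odflt 1%g [pick s in Gamma P | i_adjacent i Phi (s @: Phi)].

Definition sigma Phi i : {perm P} := (rho Phi i.-1 * rho Phi i)%g.

Definition Gamma_plus Phi : {set {perm P}} :=
  <<[set sigma Phi (val i) | i : 'I_n & (0 < val i)%N]>>%g.

Canonical Gamma_plus_group Phi := [group of Gamma_plus Phi].

Definition directly_regular Phi : Prop :=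
  regular P /\ #|Gamma P : Gamma_plus Phi|%g = 2%N.

End Polytopes.

(* Face lattice of the 3-cube: None is the empty face; Some f is the product
   over i < 3 of the factors {0}, {1} or [0,1] according to whether f i is
   Some false, Some true or None. *)
Definition cube_faces : Type :=
  option {ffun 'I_3 -> option bool}.

HB.instance Definition _ := Choice.on cube_faces.

Definition cube_le : rel cube_faces := fun F G =>
  match F, G with
  | None, _ => true
  | Some _, None => false
  | Some f, Some g => [forall i, (g i == None) || (g i == f i)]
  end.

Fact cube_le_refl : reflexive cube_le.
Proof. by case=> //= f; apply/forallP=> i; rewrite eqxx orbT. Qed.

Fact cube_le_anti : antisymmetric cube_le.
Proof.
move=> [f|] [g|] //= /andP[/forallP h1 /forallP h2]; congr Some.
apply/ffunP=> i; move: (h1 i) (h2 i).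
by case: (f i) => [a|]; case: (g i) => [b|] //= /eqP.
Qed.

Fact cube_le_trans : transitive cube_le.
Proof.
move=> [g|] [f|] [h|] //= /forallP h1 /forallP h2; apply/forallP=> i.
by move: (h1 i) (h2 i); case/orP=> /eqP ->; case/orP=> /eqP ->; rewrite eqxx ?orbT.
Qed.

HB.instance Definition _ :=
  Order.Le_isPOrder.Build (Order.Disp tt tt) cube_faces
    cube_le_refl cube_le_anti cube_le_trans.

(* The cell ((i, e), (j, f)) of the square tessellation with vertex set Z^2 is
   [i, i + e] x [j, j + f], where e and f are read as 0 or 1: a vertex, an edge
   or a square. *)
Definition cell : Type := ((int * bool) * (int * bool))%type.

Local Open Scope ring_scope.

Definition itv_sub (s t : int * bool) : bool :=
  (t.1 <= s.1) && (s.1 + s.2%:Z <= t.1 + t.2%:Z).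

Definition cell_le (u v : cell) : bool := itv_sub u.1 v.1 && itv_sub u.2 v.2.

Definition translate (t : int * int) (u : cell) : cell :=
  ((u.1.1 + t.1, u.1.2), (u.2.1 + t.2, u.2.2)).

(* The lattice generated by (b, c) and (- c, b). *)
Definition in_lattice (b c : nat) (t : int * int) : Prop :=
  exists k l : int, t = (k * b%:Z - l * c%:Z, k * c%:Z + l * b%:Z).

Definition cell_equiv (b c : nat) (u v : cell) : bool :=
  `[< exists2 t, in_lattice b c t & v = translate t u >].

Section Torus.
Variables b c : nat.

Lemma lattice0 : in_lattice b c (0, 0).
Proof. by exists 0, 0; rewrite !mul0r subrr. Qed.

Lemma latticeN t : in_lattice b c t -> in_lattice b c (- t.1, - t.2).
Proof. by case=> k [l ->]; exists (- k), (- l) => /=; congr pair; lia. Qed.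

Lemma latticeD t s :
  in_lattice b c t -> in_lattice b c s -> in_lattice b c (t.1 + s.1, t.2 + s.2).
Proof.
by move=> [k [l ->]] [k' [l' ->]]; exists (k + k'), (l + l') => /=;
  congr pair; lia.
Qed.

Lemma translate0 u : translate (0, 0) u = u.
Proof. by case: u => [[i e] [j f]]; rewrite /translate /= !addr0. Qed.

Lemma translateD t s u :
  translate t (translate s u) = translate (s.1 + t.1, s.2 + t.2) u.
Proof. by rewrite /translate /= !addrA. Qed.

Lemma cell_le_translate t u v :
  cell_le (translate t u) (translate t v) = cell_le u v.
Proof. by rewrite /cell_le /itv_sub /=; congr (_ && _); lia. Qed.

Fact cell_equiv_refl : reflexive (cell_equiv b c).
Proof. by move=> u; apply/asboolP; exists (0, 0); [exact: lattice0 | rewrite translate0]. Qed.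

Fact cell_equiv_sym : symmetric (cell_equiv b c).
Proof.
suff h u v : cell_equiv b c u v -> cell_equiv b c v u by move=> u v; apply/idP/idP; exact: h.
move=> /asboolP[t tL ->]; apply/asboolP; exists (- t.1, - t.2); first exact: latticeN.
by rewrite translateD /= !subrr translate0.
Qed.

Fact cell_equiv_trans : transitive (cell_equiv b c).
Proof.
move=> v u w /asboolP[t tL ->] /asboolP[s sL ->]; apply/asboolP.
by exists (t.1 + s.1, t.2 + s.2); [exact: latticeD | rewrite translateD].
Qed.

Canonical cell_equiv_rel :=
  EquivRel (cell_equiv b c) cell_equiv_refl cell_equiv_sym cell_equiv_trans.

Definition torus_cell : Type := {eq_quot cell_equiv b c}%qT.

HB.instance Definition _ := Choice.on torus_cell.
HB.instance Definition _ := EqQuotient.on torus_cell.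

Definition torus_cell_le (x y : torus_cell) : bool :=
  `[< exists u v : cell,
        [/\ x = \pi_torus_cell%qT u, y = \pi_torus_cell%qT v & cell_le u v] >].

Lemma cell_equivP (u v : cell) :
  \pi_torus_cell%qT u = \pi_torus_cell%qT v ->
  exists2 t, in_lattice b c t & v = translate t u.
Proof. by move=> /(@eqmodP _ cell_equiv_rel) /asboolP. Qed.

Fact torus_cell_le_refl : reflexive torus_cell_le.
Proof.
move=> x; apply/asboolP; exists (repr x), (repr x); rewrite reprK; split => //.
by rewrite /cell_le /itv_sub !lexx.
Qed.

Fact torus_cell_le_anti : antisymmetric torus_cell_le.
Proof.
move=> x y /andP[/asboolP[u [v [-> -> le_uv]]] /asboolP[v' [u' [ev eu le_vu]]]].
have [t _ ?] := cell_equivP ev; have [s _ ?] := cell_equivP eu; subst v' u'.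
congr (\pi_torus_cell%qT _); move: le_uv le_vu; rewrite /cell_le /itv_sub /=.
case: u {eu} => [[i e] [j f]]; case: v {ev} => [[i' e'] [j' f']] /=.
by move=> h1 h2; congr ((_, _), (_, _)); lia.
Qed.

Fact torus_cell_le_trans : transitive torus_cell_le.
Proof.
move=> y x z /asboolP[u [v [-> -> le_uv]]] /asboolP[v' [w [ev -> le_vw]]].
have [t tL ?] := cell_equivP ev; subst v'.
apply/asboolP; exists (translate t u), w; split=> //.
  by apply/(@eqmodP _ cell_equiv_rel)/asboolP; exists t.
have: cell_le (translate t u) (translate t v) by rewrite cell_le_translate.
by move: le_vw; rewrite /cell_le /itv_sub => h1 h2; lia.
Qed.

(* The map {4,4}_(b,c): None is the least face and Some None the greatest. *)
Definition torus_map : Type := option (option torus_cell).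

HB.instance Definition _ := Choice.on torus_map.

Definition torus_map_le : rel torus_map := fun F G =>
  match F, G with
  | None, _ | _, Some None => true
  | Some (Some x), Some (Some y) => torus_cell_le x y
  | _, _ => false
  end.

Fact torus_map_le_refl : reflexive torus_map_le.
Proof. by case=> [[x|]|] //=; exact: torus_cell_le_refl. Qed.

Fact torus_map_le_anti : antisymmetric torus_map_le.
Proof. by move=> [[x|]|] [[y|]|] //= /torus_cell_le_anti ->. Qed.

Fact torus_map_le_trans : transitive torus_map_le.
Proof. by move=> [[y|]|] [[x|]|] [[z|]|] //=; exact: torus_cell_le_trans. Qed.

HB.instance Definition _ :=
  Order.Le_isPOrder.Build (Order.Disp tt tt) torus_map
    torus_map_le_refl torus_map_le_anti torus_map_le_trans.

End Torus.

Section PSL2.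
Variable p : nat.

Definition SL2 : {set {'GL_2(p)}} := [set A | \det (GLval A) == 1].

Lemma group_set_SL2 : group_set SL2.
Proof.
apply/group_setP; split=> [|A B]; rewrite !inE; first by rewrite GL_1E det1.
by rewrite GL_MxE det_mulmx => /eqP-> /eqP->; rewrite mulr1.
Qed.

Canonical SL2_group := Group group_set_SL2.

Definition L2 := (SL2 / 'Z(SL2))%g.

Canonical L2_group := [group of L2].

End PSL2.

(* Main.v *)
Require Import Defs.
From HB Require Import structures.
From mathcomp Require Import all_boot all_order all_algebra all_fingroup all_solvable.
From mathcomp Require Import generic_quotient zify ring boolp.
From mathcomp Require finfield.
Set Implicit Arguments. Unset Strict Implicit. Unset Printing Implicit Defensive.
Import Order.TTheory GRing.Theory.
Local Open Scope nat_scope.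

(* PSL_2(p) is generated by the images modulo p of the rotations of the hyperbolic honeycomb
   {4,4,3}, that is of PGL_2(Z[i]) with i sent to a square root s of -1 such that b + s c = 0; the
   translations of a facet {4,4} acting trivially then form the lattice of (b, c).  The flags of
   the new polytope are the pairs (l, a) with l in L = L_2(p) and a a flag of Q, where i-adjacency
   multiplies l by the voltage tau_i or its inverse, according to the class of a under
   Gamma^+(Q).  As L is simple and |L| does not divide |Gamma^+(Q)|, Goursat's lemma makes this
   flag graph connected.  Voltages are trivial along closed walks in a vertex-figure (a cube), so
   the covering of Q is injective on vertex-figures and polytopality lifts from Q.  A facet is the
   torus map of the lattice of all (x, y) divisible by m with x + s y = 0 modulo p.  An
   automorphism exchanging the two flag classes would normalise L * Gamma^+(Q), hence by
   simplicity preserve the factor Gamma^+(Q) and so act on the quotient L; but the translation by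
   (b, c) is trivial in L while its mirror image is not. *)

(** * Maniplexes *)

(** Checking polytopality by the intersection property of subgroups would require computations
    inside $L_2(p)$. It is phrased instead as the axiom [adj_pip], on walks of flags: if for each
    level of [K] two flags are joined by a walk that keeps that level, then a single walk keeps all
    these levels. Since this speaks of the flag graph alone, it can be lifted along a covering.

    Only products of an even number of reflections of the honeycomb are Möbius maps, so a single
    reflection has no image in $L$. The voltage of an [i]-adjacency is therefore the image of
    $\rho_i\rho_0$ on one class and its inverse on the other, whence [tau 0 = 1].

    The quarter turn $w \mapsto -iw$ has determinant $-i$, so it lands in $PSL_2(p)$ once $s$ has a
    square root $z$, a primitive eighth root of unity modulo $p$; such a root exists because $p
    \equiv 1 \pmod 8$. The same $z$ gives short commutators in the proof of simplicity, and reduces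
    the relations of the cube to a finite computation in $\mathbb Z[\zeta_8]$.

    The order condition serves twice: it excludes $L$ as a quotient of $\Gamma^+(\mathcal Q)$ both
    for connectedness and for chirality. *)

Section Walks.
Variables (X : finType) (r : nat -> X -> X) (n : nat).
Implicit Types (J K : pred nat) (x y z : X).

(** The maps [r] are indexed by all naturals, so that indices can be computed with freely; only
    those below [n] give steps. *)
Definition step J : rel X := fun x y => [exists i : 'I_n, J i && (y == r i x)].
Definition conn J : rel X := connect (step J).

Lemma conn_refl J x : conn J x x.
Proof. exact: connect0. Qed.

Lemma conn_step J i x : i < n -> J i -> conn J x (r i x).
Proof.
move=> lt_in Ji; apply: connect1; apply/existsP.
by exists (Ordinal lt_in); rewrite /= Ji eqxx.
Qed.

Lemma conn_trans J : transitive (conn J).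
Proof. exact: connect_trans. Qed.

Lemma conn_inv J (R : X -> Prop) x y :
  R x -> (forall i z, i < n -> J i -> R z -> R (r i z)) -> conn J x y -> R y.
Proof.
move=> Rx IH /connectP[s]; elim: s x Rx => [|z s IHs] x Rx /=; first by move=> _ ->.
by case/andP=> /existsP[i /andP[Ji /eqP->]]; apply: IHs; apply: IH.
Qed.

Lemma conn_sub J K x y :
  (forall i, i < n -> J i -> K i) -> conn J x y -> conn K x y.
Proof.
move=> sJK; apply: (conn_inv (R := conn K x)); first exact: conn_refl.
by move=> i z lt_in Ji cxz; apply: conn_trans cxz _; apply: conn_step; rewrite ?sJK.
Qed.

Lemma conn_none J x y : (forall i, i < n -> J i = false) -> conn J x y -> y = x.
Proof. by move=> J0; apply: (conn_inv (R := fun y => y = x)) => // i z /J0->. Qed.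

Hypothesis rK : forall i, i < n -> involutive (r i).

Lemma conn_sym J : symmetric (conn J).
Proof.
suff sym x y : conn J x y -> conn J y x by move=> x y; apply/idP/idP; apply: sym.
apply: (conn_inv (R := (conn J)^~ x)); first exact: conn_refl.
move=> i z lt_in Ji; apply: conn_trans.
by rewrite -{2}[z](rK lt_in); apply: conn_step.
Qed.

Lemma conn_single J i x y :
  (forall j, j < n -> J j -> j = i) -> conn J x y -> y = x \/ y = r i x.
Proof.
move=> Ji; apply: (conn_inv (R := fun y => y = x \/ y = r i x)); first by left.
by move=> j z lt_jn /(Ji _ lt_jn) eq_ji [] ->; subst j; [right|left; rewrite rK].
Qed.

End Walks.

Section WalkMorphisms.
Variables (X Y : finType) (rX : nat -> X -> X) (rY : nat -> Y -> Y) (n : nat).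
Variables (f : X -> Y) (J : pred nat).
Hypothesis fr : forall i x, i < n -> J i -> f (rX i x) = rY i (f x).

Lemma conn_homo x y : conn rX n J x y -> conn rY n J (f x) (f y).
Proof.
apply: (conn_inv (R := fun y => conn rY n J (f x) (f y))); first exact: conn_refl.
by move=> i z lt_in Ji cxz; apply: conn_trans cxz _; rewrite fr //; apply: conn_step.
Qed.

Lemma conn_lift x y' : conn rY n J (f x) y' -> exists2 y, f y = y' & conn rX n J x y.
Proof.
apply: (conn_inv (R := fun y' => exists2 y, f y = y' & conn rX n J x y)).
  by exists x => //; apply: conn_refl.
move=> i _ lt_in Ji [z <- cxz]; exists (rX i z); first exact: fr.
by apply: conn_trans cxz _; apply: conn_step.
Qed.

End WalkMorphisms.

(** A [J1]-step taken after [J2]-steps slides in front of them: by commutation it carries the whole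
    [J2]-walk along. *)
Lemma conn_split (X : finType) (r : nat -> X -> X) n (J1 J2 : pred nat) x z :
    (forall i j y, i < n -> j < n -> J1 i -> J2 j -> r i (r j y) = r j (r i y)) ->
    conn r n (fun i => J1 i || J2 i) x z ->
  exists2 w, conn r n J1 x w & conn r n J2 w z.
Proof.
move=> comm.
apply: (conn_inv (R := fun z => exists2 w, conn r n J1 x w & conn r n J2 w z)).
  by exists x; apply: conn_refl.
move=> i y lt_in /orP[J1i | J2i] [w cxw cwy]; last first.
  by exists w => //; apply: conn_trans cwy _; apply: conn_step.
exists (r i w); first by apply: conn_trans cxw _; apply: conn_step.
by apply: conn_homo cwy => j t lt_jn J2j; apply: comm.
Qed.

(* Level [k] of a poset of rank [n] stands for rank [k - 1], so that the faces of level [k] are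
   the orbits under all [adj i] with [i.+1 != k], including the least and greatest faces
   at levels [0] and [n.+1]. *)
Record maniplex (n : nat) := Maniplex {
  mflag :> finType;
  adj : nat -> mflag -> mflag;
  adjK : forall i, i < n -> involutive (adj i);
  adj_neq : forall i x, i < n -> adj i x != x;
  adjC : forall i j x, i.+1 < j -> j < n -> adj i (adj j x) = adj j (adj i x);
  base_flag : mflag;
  adj_conn : forall x y, conn adj n predT x y;
  adj_pip : forall (K : pred nat) x y,
    (forall k, K k -> conn adj n (fun i => i.+1 != k) x y) ->
    conn adj n (fun i => ~~ K i.+1) x y }.

Section ManiplexTheory.
Variables (n : nat) (X : maniplex n).
Implicit Types (x y z : X) (k l : nat).

Definition lconn k : rel X := conn (@adj n X) n (fun i => i.+1 != k).

Lemma lconn_refl k x : lconn k x x. Proof. exact: conn_refl. Qed.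

Lemma lconn_sym k : symmetric (lconn k).
Proof. by apply: conn_sym => i; apply: adjK. Qed.

Lemma lconn_trans k : transitive (lconn k). Proof. exact: conn_trans. Qed.

Lemma lconn_out k x y : (k == 0) || (n < k) -> lconn k x y.
Proof.
by move=> k_out; apply: conn_sub (adj_conn x y) => i ? _; apply: contraTN k_out; lia.
Qed.

Lemma lconn_adj k i x : i < n -> i.+1 != k -> lconn k x (adj i x).
Proof. exact: (@conn_step _ _ _ _ i). Qed.

Lemma lconn_all x y : (forall k, lconn k x y) -> y = x.
Proof. by move=> h; apply: conn_none (adj_pip (K := predT) (fun k _ => h k)). Qed.

(** The diamond condition in flag form: [adj_pip] at all levels but [i.+1] leaves [adj i] as the
    only available step. *)
Lemma adj_uniq i x y : (forall k, k != i.+1 -> lconn k x y) -> y = x \/ y = adj i x.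
Proof.
move=> h; have cxy := adj_pip (K := fun k => k != i.+1) h.
apply: conn_single cxy => [j|j _]; first exact: adjK.
by rewrite negbK eqSS => /eqP.
Qed.

Lemma adj_nlconn i x : i < n -> ~~ lconn i.+1 x (adj i x).
Proof.
move=> lt_in; apply: contraNN (adj_neq x lt_in) => cx; apply/eqP.
apply: lconn_all => k; have [-> //|neq] := eqVneq k i.+1.
by apply: lconn_adj; rewrite // eq_sym.
Qed.

(* The walk from [x] to [z] inside a face of level [l] factors through an upper and a lower part,
   which commute; this is what makes incidence transitive and chains extendable. *)
Lemma lconn_split l x z : lconn l x z -> exists w,
  [/\ forall k, k <= l -> lconn k x w & forall k, l <= k -> lconn k w z].
Proof.
move=> cxz.
have comm i j (y : X) : i < n -> j < n -> l <= i -> j.+1 < l ->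
  adj i (adj j y) = adj j (adj i y) by move=> *; rewrite (@adjC _ _ j i) //; lia.
have /(conn_split comm)[w cxw cwz] :
    conn (@adj n X) n (fun i => (l <= i) || (i.+1 < l)) x z.
  by apply: conn_sub cxz => i _; lia.
by exists w; split=> k ?;
  [apply: conn_sub cxw | apply: conn_sub cwz] => i *; lia.
Qed.

Definition incident k x l y := (k <= l) && [exists z, lconn k x z && lconn l z y].

Lemma incidentP k x l y :
  reflect (exists z, [/\ k <= l, lconn k x z & lconn l z y]) (incident k x l y).
Proof.
apply: (iffP andP) => [[kl /existsP[z /andP[]]]|[z [kl c1 c2]]]; first by exists z.
by split=> //; apply/existsP; exists z; rewrite c1.
Qed.

Lemma incident_trans k x l y m z :
  incident k x l y -> incident l y m z -> incident k x m z.
Proof.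
case/incidentP=> a [kl cxa cay] /incidentP[b [lm cyb cbz]].
have [w [caw cwb]] := lconn_split (lconn_trans cay cyb).
apply/incidentP; exists w; split; first exact: leq_trans kl lm.
  by apply: lconn_trans cxa (caw _ kl).
by apply: lconn_trans (cwb _ lm) cbz.
Qed.

Definition maut (a : X -> X) := forall i x, i < n -> a (adj i x) = adj i (a x).

Lemma aut_lconn a k x y : maut a -> lconn k x y -> lconn k (a x) (a y).
Proof. by move=> aA; apply: conn_homo => i z lt_in _; apply: aA. Qed.

(** The image is closed under every adjacency, hence is everything by connectedness; finiteness then
    gives injectivity. *)
Lemma aut_surj a y : maut a -> exists x, a x = y.
Proof.
move=> aA; apply: (conn_inv (R := fun y => exists x, a x = y)) (adj_conn (a (base_flag X)) y).
  by eexists.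
by move=> i z lt_in _ [x <-]; exists (adj i x); rewrite aA.
Qed.

Lemma aut_inj a : maut a -> injective a.
Proof.
move=> aA x y; have/image_injP: #|image a X| == #|X|.
  by rewrite -(eq_card (A := X)) // => z; have [x' <-] := aut_surj z aA; rewrite codom_f.
by apply.
Qed.

Lemma aut_eq a b x : maut a -> maut b -> a x = b x -> a =1 b.
Proof.
move=> aA bA eq_ab y; apply: (conn_inv (R := fun y => a y = b y)) (adj_conn x y) => // i z lt_in _ eq_z.
by rewrite aA // bA // eq_z.
Qed.

Lemma aut_lconnE a k x y : maut a -> lconn k (a x) (a y) = lconn k x y.
Proof.
move=> aA; apply/idP/idP; last exact: aut_lconn.
case/(conn_lift (fun i z lt_in _ => aA i z lt_in)) => z /(aut_inj aA)->; exact: id.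
Qed.

Lemma aut_incident a k x l y : maut a -> incident k (a x) l (a y) = incident k x l y.
Proof.
move=> aA; apply/incidentP/incidentP => -[z [kl c1 c2]]; last first.
  by exists (a z); rewrite !aut_lconnE.
by have [z' eq_z] := aut_surj z aA; exists z'; subst z; rewrite !aut_lconnE in c1 c2.
Qed.

End ManiplexTheory.

(** One interface for three posets: the orbit poset of a maniplex, the faces of a given polytope,
    and a facet section. Chains, flags and automorphisms are treated once for all of them. *)
Record represents n (X : maniplex n) d (P : porderType d) (f : X -> nat -> P) : Prop :=
  Represents {
    rep_surj : forall q, exists x k, k < n.+2 /\ q = f x k;
    rep_le : forall x y k l, k < n.+2 -> l < n.+2 ->
      (f x k <= f y l)%O = incident k x l y }.

(** Both posets are quotients of the same preorder on [I], and antisymmetry makes the fibres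
    coincide. Sections can thus be compared through flags, without canonical representatives of
    faces. *)
Lemma poset_iso_common (I : Type) d1 d2 (P : porderType d1) (K : porderType d2)
    (f : I -> P) (g : I -> K) :
    (forall q, exists i, q = f i) -> (forall q, exists i, q = g i) ->
    (forall i j, (f i <= f j)%O = (g i <= g j)%O) ->
  poset_iso P K.
Proof.
move=> /choice[f' f'K] /choice[g' g'K] le_fg.
have eq_f i j : g i = g j -> f i = f j.
  by move=> eq_g; apply: le_anti; rewrite !le_fg eq_g lexx.
have eq_g i j : f i = f j -> g i = g j.
  by move=> e; apply: le_anti; rewrite -!le_fg e lexx.
exists (g \o f'); split; last by move=> x y; rewrite /= -le_fg -!f'K.
exists (f \o g') => [x|y] /=.
  by rewrite [RHS]f'K; apply: eq_f; rewrite -g'K.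
by rewrite [RHS]g'K; apply: eq_g; rewrite -f'K.
Qed.

(** Each [g k] is at least [k], and the strict increases still to come leave no room above. This
    pins down levels, both under automorphisms and along chains of maximal length. *)
Lemma strict_incr_id N (g : nat -> nat) :
    (forall k, k < N -> g k < N) -> (forall k, k.+1 < N -> g k < g k.+1) ->
  forall k, k < N -> g k = k.
Proof.
move=> gN g_incr.
have ge k : k < N -> k <= g k.
  elim: k => // k IH lt_kN; apply: leq_ltn_trans (g_incr _ lt_kN).
  by apply: IH; apply: ltnW.
have le j k : k + j < N -> g k + j <= g (k + j).
  elim: j => [|j IH] lt_N; first by rewrite !addn0.
  rewrite !addnS; apply: leq_ltn_trans (g_incr _ _); last by rewrite -addnS.
  by apply: IH; lia.
move=> k lt_kN; have := ge _ lt_kN; have := le (N.-1 - k) k.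
have -> : k + (N.-1 - k) = N.-1 by lia.
have := gN N.-1; lia.
Qed.

(** * Chains and faces of a represented poset *)

Section RepresentedPorder.
Variables (n : nat) (X : maniplex n) (d : Order.disp_t) (P : porderType d).
Variables (f : X -> nat -> P).
Hypothesis repP : represents f.
Implicit Types (x y z : X) (k l : nat).
Local Notation rep_le := (rep_le repP).

Lemma rep_lev x y k l : k < n.+2 -> l < n.+2 -> f x k = f y l -> k = l.
Proof.
move=> ltk ltl eq_f; apply/eqP; rewrite eqn_leq.
have /andP[->_]: incident k x l y by rewrite -rep_le // eq_f.
by have /andP[->_]: incident l y k x by rewrite -rep_le // eq_f.
Qed.

Lemma rep_eq x y k : k < n.+2 -> (f x k == f y k) = lconn k x y.
Proof.
move=> ltk; apply/eqP/idP => [eq_f | cxy].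
  have /incidentP[z [_ c1 c2]]: incident k x k y by rewrite -rep_le // eq_f.
  exact: lconn_trans c1 c2.
apply/eqP; rewrite eq_le !rep_le //; apply/andP.
by split; apply/incidentP; [exists x | exists y]; rewrite leqnn ?lconn_refl // lconn_sym.
Qed.

Lemma rep_eqP x y k : k < n.+2 -> f x k = f y k <-> lconn k x y.
Proof. by move=> ltk; rewrite -rep_eq //; split=> /eqP. Qed.

Lemma rep_le_same x k l : k < n.+2 -> l < n.+2 -> (f x k <= f x l)%O = (k <= l).
Proof.
move=> ltk ltl; rewrite rep_le //; apply/incidentP/idP => [[z []] // | kl].
by exists x; rewrite kl !lconn_refl.
Qed.

Lemma rep_lt_same x k l : k < n.+2 -> l < n.+2 -> (f x k < f x l)%O = (k < l).
Proof.
move=> ltk ltl; rewrite lt_neqAle rep_le_same // ltn_neqAle; congr (_ && _).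
by congr (~~ _); apply/eqP/eqP => [|->//]; apply: rep_lev.
Qed.

Lemma rep_comm x y k l : k < n.+2 -> l < n.+2 -> k <= l -> (f x k >=< f y l)%O ->
  exists2 z, f z k = f x k & f z l = f y l.
Proof.
move=> ltk ltl kl; have aux : (f x k <= f y l)%O -> exists2 z, f z k = f x k & f z l = f y l.
  rewrite rep_le // => /incidentP[z [_ c1 c2]].
  by exists z; apply/rep_eqP; rewrite // lconn_sym.
case/orP=> //; rewrite rep_le // => /andP[lk cyx].
have eq_kl : k = l by lia.
by subst l; apply: aux; rewrite le_eqVlt eq_sym (_ : f y k = f x k) ?eqxx //;
  apply: le_anti; rewrite !rep_le // /incident !leqnn /=; move/existsP: cyx => [z /andP[c1 c2]];
  apply/andP; split; apply/existsP; exists z; rewrite ?c1 ?c2 // lconn_sym c2 lconn_sym.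
Qed.

Lemma rep_inj x y : (forall k, k < n.+2 -> f x k = f y k) -> y = x.
Proof.
move=> eq_f; apply: lconn_all => k; case: (leqP n.+2 k) => ltk.
  by apply: lconn_out; lia.
by apply/rep_eqP => //; apply: eq_f.
Qed.

Lemma rep_adj x i k : i < n -> k < n.+2 -> k != i.+1 -> f (adj i x) k = f x k.
Proof.
by move=> lt_in ltk ne; apply/rep_eqP => //; rewrite lconn_sym lconn_adj // eq_sym.
Qed.

Lemma rep_adj_neq x i : i < n -> f (adj i x) i.+1 != f x i.+1.
Proof.
by move=> lt_in; rewrite rep_eq; [rewrite lconn_sym adj_nlconn | lia].
Qed.

Lemma rep_adj_uniq x y i :
  (forall k, k < n.+2 -> k != i.+1 -> f x k = f y k) -> y = x \/ y = adj i x.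
Proof.
move=> eq_f; apply: adj_uniq => k ne; case: (leqP n.+2 k) => ltk.
  by apply: lconn_out; lia.
by apply/rep_eqP => //; apply: eq_f.
Qed.

(** Induction on the level [m]: a flag [x] through the faces of [C] below [m] is bent so as to pass
    also through the face of [C] at level [m], if there is one. *)
Lemma rep_chain (C : P -> Prop) :
    (exists q, C q) -> (forall p q, C p -> C q -> (p >=< q)%O) ->
  exists x, forall q, C q -> exists2 k, k < n.+2 & q = f x k.
Proof.
move=> [q0 Cq0] Cch.
suff /(_ n.+2)[x xP] : forall m, exists x, forall q y k, C q -> q = f y k -> k < n.+2 ->
    k < m -> q = f x k.
  by exists x => q Cq; have [y [k [ltk eq_q]]] := rep_surj repP q; exists k => //; apply: xP eq_q _ _.
elim=> [|m [x xP]]; first by exists (base_flag X).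
have [[y [ltm Cy]]|noC] := pselect (exists y, m < n.+2 /\ C (f y m)); last first.
  exists x => q z k Cq eq_q ltk; rewrite ltnS leq_eqVlt => /orP[/eqP eq_k|]; last exact: xP eq_q _.
  by case: noC; exists z; subst k q.
have Cm q z : C q -> q = f z m -> q = f y m.
  move=> Cq eq_q; rewrite eq_q in Cq *.
  by have [w <- <-] := rep_comm ltm ltm (leqnn m) (Cch _ _ Cq Cy).
pose below (l : nat) := `[< l < m /\ C (f x l) >].
have [/existsP[l0 bl0] | none] := boolP [exists l : 'I_m, below l]; last first.
  exists y => q z k Cq eq_q ltk; rewrite ltnS leq_eqVlt => /orP[/eqP eq_k|ltkm].
    by subst k; apply: Cm eq_q.
  case/existsP: none; exists (Ordinal ltkm); apply/asboolP; split=> //=.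
  by rewrite -(xP q z k).
have [l /asboolP[ltlm Cl] lmax] : exists2 l, below l & forall k, below k -> k <= l.
  have ex : exists l, below l by exists l0.
  have ub l : below l -> l <= m by case/asboolP=> /ltnW.
  by case: (ex_maxnP ex ub) => l bl lmax; exists l.
have ltl : l < n.+2 by apply: ltn_trans ltm.
have [z zl zm] := rep_comm ltl ltm (ltnW ltlm) (Cch _ _ Cl Cy).
(* [w] follows [x] up to level [l] and [z] from [l] on; by the choice of [l] no face of [C] lies
   strictly between the levels [l] and [m]. *)
have /rep_eqP-/(_ ltl)/lconn_split[w [wlo whi]] : f x l = f z l by [].
exists w => q t k Cq eq_q ltk; rewrite ltnS leq_eqVlt => /orP[/eqP eq_k|ltkm].
  subst k; rewrite (Cm q t) // -zm; apply/rep_eqP => //.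
  by rewrite lconn_sym; apply: whi; apply: ltnW.
have eq_x := xP _ _ _ Cq eq_q ltk ltkm; rewrite eq_x.
by apply/rep_eqP => //; apply: wlo; apply: lmax; apply/asboolP; rewrite -eq_x.
Qed.

End RepresentedPorder.

(** * Flags, automorphisms and chirality read off the maniplex *)

Section RepresentedFinite.
Variables (n : nat) (X : maniplex n) (d : Order.disp_t) (P : finPOrderType d).
Variables (f : X -> nat -> P).
Hypothesis repP : represents f.
Implicit Types (x y z : X) (k l : nat) (s : {perm P}).

Definition flag_of x : {set P} := [set f x (val k) | k : 'I_n.+2].

Lemma flag_ofP x q : reflect (exists2 k, k < n.+2 & q = f x k) (q \in flag_of x).
Proof.
apply: (iffP imsetP) => [[k _ ->] | [k ltk ->]]; first by exists k.
by exists (Ordinal ltk).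
Qed.

Lemma mem_flag_of x k : k < n.+2 -> f x k \in flag_of x.
Proof. by move=> ltk; apply/flag_ofP; exists k. Qed.

Lemma mem_flag_of_eq x y k : k < n.+2 -> (f x k \in flag_of y) = (f x k == f y k).
Proof.
move=> ltk; apply/flag_ofP/eqP => [[l ltl eq_f] | ->]; last by exists k.
by rewrite {2}(rep_lev repP ltk ltl eq_f).
Qed.

Lemma card_flag_of x : #|flag_of x| = n.+2.
Proof.
rewrite card_imset ?card_ord // => k l eq_f; apply: val_inj.
exact: (rep_lev repP (ltn_ord k) (ltn_ord l) eq_f).
Qed.

Lemma chain_flag_of x : chain (flag_of x).
Proof.
apply/forall_inP=> p /flag_ofP[k ltk ->]; apply/forall_inP=> q /flag_ofP[l ltl ->].
by rewrite /Order.comparable !(rep_le_same repP) // leq_total.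
Qed.

Lemma chain_sub_flag_of (C : {set P}) : chain C -> exists x, C \subset flag_of x.
Proof.
move=> /forall_inP Cch; have [-> | [q Cq]] := set_0Vmem C.
  by exists (base_flag X); rewrite sub0set.
have [||x xP] := rep_chain (C := fun q => q \in C) repP; first by exists q.
  by move=> p p' /Cch/forall_inP; apply.
by exists x; apply/subsetP => p /xP[k ltk ->]; apply: mem_flag_of.
Qed.

Lemma flag_of_inj : injective flag_of.
Proof.
move=> x y eq_xy; apply/esym; apply: (rep_inj repP) => k ltk.
by apply/eqP; rewrite -mem_flag_of_eq // -eq_xy mem_flag_of.
Qed.

Lemma flag_flag_of x : flag (flag_of x).
Proof.
apply/maxsetP; split=> [|C /chain_sub_flag_of[y sCy] sxC]; first exact: chain_flag_of.
suff eq_xy : flag_of x = flag_of y by apply/eqP; rewrite eqEsubset sxC eq_xy sCy.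
by apply/eqP; rewrite eqEcard !card_flag_of (subset_trans sxC sCy) leqnn.
Qed.

Lemma flagP (A : {set P}) : reflect (exists x, A = flag_of x) (flag A).
Proof.
apply: (iffP idP) => [/maxsetP[/chain_sub_flag_of[x sAx] maxA] | [x ->]].
  by exists x; rewrite (maxA _ (chain_flag_of x) sAx).
exact: flag_flag_of.
Qed.

Lemma flag_ofD_adj x i : i < n -> flag_of x :\: flag_of (adj i x) = [set f x i.+1].
Proof.
move=> lt_in; have ltS : i.+1 < n.+2 by lia.
apply/setP=> q; rewrite !inE; apply/andP/eqP => [[nq /flag_ofP[k ltk eq_q]] | ->].
  subst q; move: nq; rewrite mem_flag_of_eq //.
  by have [-> //|ne] := eqVneq k i.+1; rewrite (rep_adj repP) // eqxx.
by rewrite mem_flag_of_eq // mem_flag_of // eq_sym (rep_adj_neq repP).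
Qed.

Lemma adjacent_adj x i : i < n -> adjacent (flag_of x) (flag_of (adj i x)).
Proof.
move=> lt_in; rewrite /adjacent !flag_flag_of flag_ofD_adj // cards1 /=.
by rewrite -{2}[x](adjK lt_in) flag_ofD_adj // cards1.
Qed.

Lemma adjacentP x y :
  reflect (exists2 i, i < n & y = adj i x) (adjacent (flag_of x) (flag_of y)).
Proof.
apply: (iffP idP) => [/and4P[_ _ /cards1P[q eq_q] _] | [i lt_in ->]]; last exact: adjacent_adj.
have /setDP[/flag_ofP[k ltk eq_qk] nq] : q \in flag_of x :\: flag_of y.
  by rewrite eq_q set11.
subst q; rewrite mem_flag_of_eq // in nq.
have eq_f l : l < n.+2 -> l != k -> f x l = f y l.
  move=> ltl ne; apply/eqP; rewrite -mem_flag_of_eq //; apply: contraNT ne => nl.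
  have : f x l \in flag_of x :\: flag_of y by rewrite inE nl mem_flag_of.
  by rewrite eq_q inE => /eqP/(rep_lev repP ltl ltk)->.
have k_in : 0 < k <= n.
  by apply: contraNT nq => k_out; rewrite (rep_eq repP) // lconn_out //; lia.
case: k k_in eq_f nq {eq_q} ltk => // k ltk eq_f nq _.
exists k => //; have [eq_yx|] := rep_adj_uniq repP eq_f; last by [].
by rewrite eq_yx eqxx in nq.
Qed.

Lemma Gamma_aut s : s \in Gamma P ->
  exists2 a : X -> X, maut a & forall x k, k < n.+2 -> s (f x k) = f (a x) k.
Proof.
move=> /GammaP s_mono.
have s_comp p q : (s p >=< s q)%O = (p >=< q)%O by rewrite /Order.comparable !s_mono.
have /choice[a aP] x : exists y, forall k, k < n.+2 -> s (f x k) = f y k.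
  have [|p p'|y yP] := rep_chain (C := fun q => q \in s @: flag_of x) repP.
  - by exists (s (f x 0)); apply: imset_f; apply: mem_flag_of.
  - move=> /imsetP[q /flag_ofP[k ltk ->] ->] /imsetP[q' /flag_ofP[l ltl ->] ->].
    by rewrite s_comp /Order.comparable !(rep_le_same repP) // leq_total.
  have /choice[g gP] (k : nat) : exists l, k < n.+2 -> l < n.+2 /\ s (f x k) = f y l.
    have [ltk|?] := ltnP k n.+2; last by exists 0.
    by have [|l ltl ->] := yP (s (f x k)); [apply/imset_f/mem_flag_of | exists l].
  exists y => k ltk; have [_ ->] := gP k ltk; congr (f y _).
  (* The images of the faces of [x] lie on [y] at strictly increasing levels below [n.+2]; hence no
     level moves. *)
  apply: (strict_incr_id (N := n.+2)) => // [l /gP[]//|l ltl].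
  have [lt1 eq1] := gP l (ltnW ltl); have [lt2 eq2] := gP l.+1 ltl.
  rewrite -(rep_lt_same repP y) // -eq1 -eq2 lt_neqAle s_mono (inj_eq perm_inj).
  by rewrite -lt_neqAle (rep_lt_same repP) // ltnW.
exists a => // i x lt_in; have ltS : i.+1 < n.+2 by lia.
case: (@rep_adj_uniq _ _ _ _ _ repP (a x) (a (adj i x)) i) => [k ltk ne|eq_a|//].
  by rewrite -!aP // (rep_adj repP).
by have := rep_adj_neq repP x lt_in; rewrite -(inj_eq (@perm_inj _ s)) !aP // eq_a eqxx.
Qed.

(** For an automorphism [a] the pick succeeds, since [a] acts consistently on faces; the default is
    not reached then. *)
Definition lift_aut (a : X -> X) : {perm P} :=
  odflt 1%g [pick s : {perm P} | [forall x, forall k : 'I_n.+2, s (f x k) == f (a x) k]].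

Lemma lift_autE a x k : maut a -> k < n.+2 -> lift_aut a (f x k) = f (a x) k.
Proof.
move=> aA ltk; rewrite /lift_aut; case: pickP => [s /forallP/(_ x)/forallP|none].
  by move/(_ (Ordinal ltk))/eqP.
have /choice[g gP] q : exists xk : X * nat, xk.2 < n.+2 /\ q = f xk.1 xk.2.
  by have [y [l [ltl ->]]] := rep_surj repP q; exists (y, l).
pose h q := f (a (g q).1) (g q).2.
have hE y l : l < n.+2 -> h (f y l) = f (a y) l.
  move=> ltl; have [lt2 eq_f] := gP (f y l).
  rewrite /h; move: (g _) lt2 eq_f => [z m] /= ltm eq_f.
  have eq_l := rep_lev repP ltl ltm eq_f; subst m.
  by apply/(rep_eqP repP) => //; rewrite aut_lconnE //; apply/(rep_eqP repP).
have h_inj : injective h.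
  move=> p q; have [y [l [ltl ->]]] := rep_surj repP p.
  have [z [m [ltm ->]]] := rep_surj repP q; rewrite !hE // => eq_f.
  have eq_l := rep_lev repP ltl ltm eq_f; subst m.
  by move/(rep_eqP repP): eq_f => /(_ ltl); rewrite aut_lconnE // => /(rep_eqP repP); apply.
have /negP[] := none (perm h_inj).
by apply/forallP => y; apply/forallP => l; rewrite permE hE.
Qed.

Lemma lift_aut_Gamma a : maut a -> lift_aut a \in Gamma P.
Proof.
move=> aA; apply/GammaP => p q.
have [y [l [ltl ->]]] := rep_surj repP p; have [z [m [ltm ->]]] := rep_surj repP q.
by rewrite !lift_autE // !(rep_le repP) // aut_incident.
Qed.

Lemma lift_aut_flag a x : maut a -> lift_aut a @: flag_of x = flag_of (a x).
Proof.
move=> aA; apply/setP => q; apply/imsetP/flag_ofP => [[p /flag_ofP[k ltk ->] ->] | [k ltk ->]].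
  by exists k; rewrite ?lift_autE.
by exists (f x k); rewrite ?mem_flag_of ?lift_autE.
Qed.

Lemma mem_orbit_aut x y :
  reflect (exists2 a, maut a & a x = y) (flag_of y \in orbit 'P^* (Gamma P) (flag_of x)).
Proof.
apply: (iffP orbitP) => [[s Gs] | [a aA <-]]; last first.
  exists (lift_aut a); first exact: lift_aut_Gamma.
  by rewrite -lift_aut_flag //; apply: eq_imset => q.
have [a aA aP] := Gamma_aut Gs; rewrite /= => eq_y; exists a => //.
apply: flag_of_inj; rewrite -eq_y; apply/setP => q.
apply/flag_ofP/imsetP => [[k ltk ->] | [p /flag_ofP[k ltk ->] ->]].
  by exists (f x k); rewrite ?mem_flag_of //= -aP.
by exists k; rewrite //= -aP.
Qed.

Lemma regular_crit : (forall x y, exists2 a : X -> X, maut a & a x = y) -> regular P.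
Proof.
move=> trans; apply/imsetP; exists (flag_of (base_flag X)).
  by rewrite inE flag_flag_of.
apply/setP=> A; rewrite inE; apply/idP/idP => [/flagP[x ->] | ]; first exact/mem_orbit_aut.
case/orbitP => s Gs <- /=; have [a aA aP] := Gamma_aut Gs.
apply/flagP; exists (a (base_flag X)); apply/setP => q.
apply/imsetP/flag_ofP => [[p /flag_ofP[k ltk ->] ->] | [k ltk ->]].
  by exists k; rewrite //= -aP.
by exists (f (base_flag X) k); rewrite ?mem_flag_of //= -aP.
Qed.

(** Transitivity on each colour leaves at most two orbits; they do not merge, because adjacent flags
    have different colours and no automorphism joins them. *)
Lemma chiral_crit (col : X -> bool) : 0 < n ->
    (forall i x, i < n -> col (adj i x) = ~~ col x) ->
    (forall x y, col x = col y -> exists2 a : X -> X, maut a & a x = y) ->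
    (forall a i x, maut a -> i < n -> a x <> adj i x) ->
  chiral P.
Proof.
move=> n_gt0 col_adj trans no_adj; set x0 := base_flag X; split; last first.
  move=> A B adjAB; have /and4P[/flagP[x eqA] /flagP[y eqB] _ _] := adjAB.
  subst A B; apply/negP => /mem_orbit_aut[a aA ax].
  by case/adjacentP: adjAB ax => i lt_in ->; apply: no_adj.
have orb_eq x y : col x = col y -> orbit 'P^* (Gamma P) (flag_of x) = orbit 'P^* (Gamma P) (flag_of y).
  by move=> /esym/trans/mem_orbit_aut/orbit_eqP.
have -> : [set orbit 'P^* (Gamma P) A | A in flags P] =
    [set orbit 'P^* (Gamma P) (flag_of x0); orbit 'P^* (Gamma P) (flag_of (adj 0 x0))].
  apply/setP => O; rewrite !inE; apply/imsetP/orP.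
    case=> A; rewrite inE => /flagP[x ->] ->; case: (boolP (col x == col x0)) => [/eqP|] eq_c.
      by left; apply/eqP; apply: orb_eq.
    by right; apply/eqP; apply: orb_eq; rewrite col_adj //; case: (col x) (col x0) eq_c => [] [].
  by case=> /eqP ->; [exists (flag_of x0) | exists (flag_of (adj 0 x0))];
    rewrite // inE flag_flag_of.
rewrite cards2; case: eqP => // eq_o.
have : flag_of (adj 0 x0) \in orbit 'P^* (Gamma P) (flag_of x0).
  by rewrite eq_o orbit_refl.
by case/mem_orbit_aut => a aA /no_adj; case.
Qed.

End RepresentedFinite.

(** * The polytope of a maniplex *)

Section FacePoset.
Variables (n : nat) (X : maniplex n).

Lemma incident_eq k l (x x' y y' : X) :
  lconn k x x' -> lconn l y y' -> incident k x l y = incident k x' l y'.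
Proof.
move=> cx cy; apply/incidentP/incidentP => -[z [kl c1 c2]]; exists z; split=> //.
- by apply: lconn_trans c1; rewrite lconn_sym.
- exact: lconn_trans c2 cy.
- exact: lconn_trans cx c1.
- by apply: lconn_trans c2 _; rewrite lconn_sym.
Qed.

Definition lstep k : rel X := step (@adj n X) n (fun i => i.+1 != k).

(** A face is a level together with the canonical root of its orbit, so that equal faces are Leibniz
    equal without forming a quotient. *)
Definition mface : Type := {p : 'I_n.+2 * X | fingraph.root (lstep p.1) p.2 == p.2}.

HB.instance Definition _ := Finite.on mface.

Definition mface_le : rel mface := fun F G =>
  incident (val F).1 (val F).2 (val G).1 (val G).2.

Fact mface_le_refl : reflexive mface_le.
Proof. by move=> F; apply/incidentP; exists (val F).2; rewrite leqnn !lconn_refl. Qed.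

Lemma lconn_rootP k (x y : X) : reflect (fingraph.root (lstep k) x = fingraph.root (lstep k) y) (lconn k x y).
Proof. by apply: fingraph.rootP; apply: lconn_sym. Qed.

Fact mface_le_anti : antisymmetric mface_le.
Proof.
move=> [[k x] Fx] [[l y] Gy] /andP[/incidentP[z [/= kl c1 c2]] /incidentP[_ [/= lk _ _]]].
have eq_kl : k = l by apply: val_inj; apply/eqP; rewrite eqn_leq kl lk.
subst l; have /lconn_rootP eq_r := lconn_trans c1 c2.
apply: val_inj; congr pair; move: Fx Gy eq_r => /= /eqP <- /eqP <-.
by rewrite !fingraph.root_root //; apply: lconn_sym.
Qed.

Fact mface_le_trans : transitive mface_le.
Proof. move=> G F H; exact: incident_trans. Qed.

HB.instance Definition _ := Order.Le_isPOrder.Build (Order.Disp tt tt) mface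
  mface_le_refl mface_le_anti mface_le_trans.

Fact mk_face_subproof (k : 'I_n.+2) (x : X) :
  fingraph.root (lstep (k, fingraph.root (lstep k) x).1) (k, fingraph.root (lstep k) x).2 ==
  (k, fingraph.root (lstep k) x).2.
Proof. by rewrite /= fingraph.root_root //; apply: lconn_sym. Qed.

Definition mk_face (x : X) (k : nat) : mface :=
  exist (fun p : 'I_n.+2 * X => fingraph.root (lstep p.1) p.2 == p.2) _
    (mk_face_subproof (inord k) x).

Lemma mk_face_represents : represents mk_face.
Proof.
split=> [[[k x] Fx] | x y k l ltk ltl].
  exists x, k; split; first exact: ltn_ord.
  by apply: val_inj; rewrite /= inord_val (eqP Fx).
transitivity (mface_le (mk_face x k) (mk_face y l)); first by [].
rewrite /mface_le /= !inordK //.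
by apply: incident_eq; rewrite lconn_sym; apply: connect_root.
Qed.

Fact mface_le0x (F : mface) : (mk_face (base_flag X) 0 <= F)%O.
Proof.
have [x [k [ltk ->]]] := rep_surj mk_face_represents F.
rewrite (rep_le mk_face_represents) //; apply/incidentP; exists x.
by rewrite lconn_refl lconn_out.
Qed.

Fact mface_lex1 (F : mface) : (F <= mk_face (base_flag X) n.+1)%O.
Proof.
have [x [k [ltk ->]]] := rep_surj mk_face_represents F.
rewrite (rep_le mk_face_represents) //; apply/incidentP; exists x.
by split; [rewrite -ltnS | apply: lconn_refl | apply: lconn_out; rewrite ltnSn orbT].
Qed.

HB.instance Definition _ := Order.hasBottom.Build (Order.Disp tt tt) mface mface_le0x.
HB.instance Definition _ := Order.hasTop.Build (Order.Disp tt tt) mface mface_lex1.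

Local Notation repX := mk_face_represents.

Definition mface_rank (F : mface) : int := ((val F).1%:Z - 1)%R.

Lemma mface_rankE x k : k < n.+2 -> mface_rank (mk_face x k) = (k%:Z - 1)%R.
Proof. by move=> ltk; rewrite /mface_rank /= inordK. Qed.

Fact mface_rank_lt : {homo mface_rank : F G / (F < G)%O}.
Proof.
move=> F G; have [x [k [ltk ->]]] := rep_surj repX F.
have [y [l [ltl ->]]] := rep_surj repX G.
rewrite lt_neqAle (rep_le repX) // => /andP[ne /incidentP[z [kl c1 c2]]].
rewrite !mface_rankE //; suff : k != l by lia.
apply: contraNN ne => /eqP eq_kl; subst l; rewrite (rep_eq repX) //.
exact: lconn_trans c1 c2.
Qed.

(** [adj_pip], applied to the levels at which the two flags share a face, yields a walk along which
    none of these faces changes. *)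
Fact mface_connected : strongly_flag_connected mface.
Proof.
move=> A B /(flagP repX)[x ->] /(flagP repX)[y ->]; set I := _ :&: _.
pose K k := (k < n.+2) && (mk_face x k == mk_face y k).
have sI z : (forall k, K k -> lconn k x z) -> I \subset flag_of mk_face z.
  move=> Kz; apply/subsetP => q /setIP[/flag_ofP[k ltk ->]].
  rewrite (mem_flag_of_eq repX) // => eq_q; apply/flag_ofP; exists k => //.
  by apply/(rep_eqP repX) => //; apply: Kz; rewrite /K ltk.
have cxy : conn (@adj n X) n (fun i => ~~ K i.+1) x y.
  by apply: adj_pip => k /andP[ltk]; rewrite (rep_eq repX).
have [] // : (forall k, K k -> lconn k x y) /\
  connect [rel A B | [&& adjacent A B, I \subset A & I \subset B]]
     (flag_of mk_face x) (flag_of mk_face y).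
pose R z := (forall k, K k -> lconn k x z) /\
  connect [rel A B | [&& adjacent A B, I \subset A & I \subset B]]
     (flag_of mk_face x) (flag_of mk_face z).
apply: (conn_inv (R := R)) cxy; first by split=> [k _|]; [apply: lconn_refl | apply: connect0].
move=> i z lt_in nKi [Kz cz].
have Kz' k : K k -> lconn k x (adj i z).
  move=> Kk; apply: lconn_trans (Kz _ Kk) _; apply: lconn_adj => //.
  by apply: contraNneq nKi => ->.
split=> //; apply: connect_trans cz (connect1 _) => /=.
by rewrite (adjacent_adj repX) // !sI.
Qed.

Fact mface_diamond (F G : mface) : (F < G)%O -> mface_rank G = (mface_rank F + 2)%R ->
  #|[set H | (F < H < G)%O]| = 2.
Proof.
move=> ltFG; have [x0 [k [ltk eqF]]] := rep_surj repX F.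
have [y0 [l [ltl eqG]]] := rep_surj repX G.
subst F G; rewrite !mface_rankE // => eq_rk; have eq_l : l = k.+2 by lia.
subst l; have [z zk zl] : exists2 z, mk_face z k = mk_face x0 k & mk_face z k.+2 = mk_face y0 k.+2.
  have kk2 : k <= k.+2 by lia.
  by apply: (rep_comm repX ltk ltl kk2); rewrite /Order.comparable ltW.
rewrite -zk -zl {ltFG zk zl x0 y0}.
have lt_kn : k < n by lia.
have ltk1 : k.+1 < n.+2 by lia.
have between w : mk_face w k = mk_face z k -> mk_face w k.+2 = mk_face z k.+2 ->
    (mk_face z k < mk_face w k.+1 < mk_face z k.+2)%O.
  by move=> <- <-; rewrite !(rep_lt_same repX) // !ltnSn.
suff -> : [set H | (mk_face z k < H < mk_face z k.+2)%O] =
    [set mk_face z k.+1; mk_face (adj k z) k.+1].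
  by rewrite cards2 eq_sym (rep_adj_neq repX).
apply/setP => H; rewrite !inE; apply/idP/idP; last first.
  by case/orP=> /eqP ->; apply: between; rewrite ?(rep_adj repX) //; lia.
case/andP=> lt1 lt2; have [w0 [j [ltj eqH]]] := rep_surj repX H.
have := mface_rank_lt lt1; have := mface_rank_lt lt2; rewrite eqH !mface_rankE // => r1 r2.
have eq_j : j = k.+1 by lia.
subst j H; have [|p q|w wP] := rep_chain (C := fun q =>
  [\/ q = mk_face z k, q = mk_face w0 k.+1 | q = mk_face z k.+2]) repX.
- by exists (mk_face z k); constructor.
- move=> [] -> [] ->; rewrite /Order.comparable ?lexx //;
  by rewrite ?(ltW lt1) ?(ltW lt2) ?(ltW (lt_trans lt1 lt2)) ?orbT.
have wE y m : m < n.+2 -> (exists2 j, j < n.+2 & mk_face y m = mk_face w j) -> lconn m y w.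
  move=> ltm [j ltj' eq_j]; apply/(rep_eqP repX) => //.
  by rewrite eq_j (rep_lev repX ltm ltj' eq_j).
have c0 : lconn k z w by apply: wE => //; apply: wP; constructor.
have c1 : lconn k.+1 w0 w by apply: wE => //; apply: wP; constructor.
have c2 : lconn k.+2 z w by apply: wE => //; apply: wP; constructor.
have cK : conn (@adj n X) n (fun i => ~~ ((i.+1 == k) || (i.+1 == k.+2))) z w.
  by apply: (adj_pip (K := fun m => (m == k) || (m == k.+2))) => m /orP[] /eqP->.
have comm i j (y : X) : i < n -> j < n -> i == k -> (j.+1 < k) || (k.+1 < j) ->
  adj i (adj j y) = adj j (adj i y).
  move=> lti ltj' /eqP-> /orP[] ?; last by rewrite adjC.
  by rewrite (@adjC _ _ j k).
(* Keeping the levels [k] and [k.+2] makes [adj k] commute with the remaining steps: the [adj k]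
   part can reach two flags only, and the rest keeps level [k.+1]. *)
have /(conn_split comm)[t czt ctw] :
    conn (@adj n X) n (fun i => (i == k) || ((i.+1 < k) || (k.+1 < i))) z w.
  by apply: conn_sub cK => i *; lia.
have ctw1 : lconn k.+1 t w by apply: conn_sub ctw => i *; lia.
rewrite !(rep_eq repX) //.
have [e|e] : t = z \/ t = adj k z.
- by apply: conn_single czt => [i|i _ /eqP //]; apply: adjK.
- by rewrite -e; apply/orP; left; apply: lconn_trans c1 _; rewrite lconn_sym.
- by rewrite -e; apply/orP; right; apply: lconn_trans c1 _; rewrite lconn_sym.
Qed.

Fact mface_rank_bot : mface_rank \bot%O = (-1)%R.
Proof. by rewrite /mface_rank /= inordK. Qed.

Fact mface_rank_top : mface_rank \top%O = n.
Proof. by rewrite /mface_rank /= inordK // -addn1 PoszD addrK. Qed.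

Fact mface_card_flag (A : {set mface}) : flag A -> #|A| = n.+2.
Proof. by case/(flagP repX) => x ->; apply: card_flag_of repX x. Qed.

Definition polytope_of : polytope n :=
  Polytope mface_rank_bot mface_rank_top mface_rank_lt mface_card_flag mface_connected
    mface_diamond.

End FacePoset.

(** * The maniplex of a polytope *)

Section PolytopeFlags.
Variables (n : nat) (Q : polytope n).
Implicit Types (x y : Q) (A B C : {set Q}) (i k l : nat).

(** The rank shifted by one, as in [maniplex]; ranks are at least $-1$, so [absz] loses nothing. *)
Definition lev x : nat := absz (Defs.rank x + 1)%R.

Lemma rank_lev x : Defs.rank x = ((lev x)%:Z - 1)%R.
Proof.
suff : (-1 <= Defs.rank x)%R by rewrite /lev; lia.
have := le0x x; rewrite le_eqVlt => /predU1P[<-|/rank_lt]; first by rewrite rank_bot.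
by rewrite rank_bot; apply: ltW.
Qed.

Lemma lev_lt x y : (x < y)%O -> lev x < lev y.
Proof. by move=> /rank_lt; rewrite !rank_lev; lia. Qed.

Lemma lev_max x : lev x < n.+2.
Proof.
suff : (Defs.rank x <= n%:Z)%R by rewrite rank_lev; lia.
have := lex1 x; rewrite le_eqVlt => /predU1P[->|/rank_lt]; first by rewrite rank_top.
by rewrite rank_top; apply: ltW.
Qed.

Lemma lev0 x : lev x = 0 -> x = \bot%O.
Proof.
move=> l0; have := le0x x; rewrite le_eqVlt => /predU1P[//|/lev_lt]; by rewrite l0.
Qed.

Lemma levn x : lev x = n.+1 -> x = \top%O.
Proof.
move=> l0; have := lex1 x; rewrite le_eqVlt => /predU1P[//|/lev_lt].
by rewrite l0 => h; have := lev_max (\top%O : Q); lia.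
Qed.

Lemma chain_comp C x y : chain C -> x \in C -> y \in C -> (x >=< y)%O.
Proof. by move=> /forall_inP h /h /forall_inP; apply. Qed.

Lemma comp_lev x y : (x >=< y)%O -> lev x <= lev y -> (x <= y)%O.
Proof.
case/orP=> //; rewrite le_eqVlt => /predU1P[-> //|/lev_lt]; lia.
Qed.

Lemma comp_lev_eq x y : (x >=< y)%O -> lev x = lev y -> x = y.
Proof.
by move=> cxy eq_l; apply: le_anti; rewrite !comp_lev // ?eq_l // comparable_sym.
Qed.

Lemma chain_ext C : chain C -> exists2 A, flag A & C \subset A.
Proof. by move/maxset_exists=> [A]; exists A. Qed.

Lemma flag_chain A : flag A -> chain A.
Proof. by case/maxsetP. Qed.

Lemma flag_card C : chain C -> #|C| = n.+2 -> flag C.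
Proof.
move=> chC cardC; have [A fA sCA] := chain_ext chC.
suff -> : C = A by [].
by apply/eqP; rewrite eqEcard sCA (card_flag fA) cardC leqnn.
Qed.

Definition flagT : Type := {A : {set Q} | flag A}.
HB.instance Definition _ := Finite.on flagT.

(** A flag has [n.+2] faces with distinct levels below [n.+2], so every such level is attained
    exactly once; the default serves larger [k] only. *)
Definition at_lev (a : flagT) k : Q := odflt \bot%O [pick x in val a | lev x == k].

Lemma at_levP (a : flagT) k : k < n.+2 -> (at_lev a k \in val a) /\ lev (at_lev a k) = k.
Proof.
move=> ltk; rewrite /at_lev; case: pickP => [x /andP[xa /eqP]|none] //=.
have fa := valP a; pose g x : 'I_n.+2 := inord (lev x).
have g_inj : {in val a &, injective g}.
  move=> x y xa ya /(congr1 val); rewrite /= !inordK ?lev_max //.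
  by apply: comp_lev_eq; apply: chain_comp xa ya; apply: flag_chain.
have : g @: val a = setT.
  by apply/eqP; rewrite eqEcard subsetT cardsT card_ord card_in_imset // (card_flag fa) leqnn.
move/setP/(_ (Ordinal ltk)); rewrite in_setT => /imsetP[x xa eq_k].
have := none x; rewrite xa /= => /eqP[]; move/(congr1 val): eq_k.
by rewrite /= inordK ?lev_max.
Qed.

Lemma at_lev_in (a : flagT) k : k < n.+2 -> at_lev a k \in val a.
Proof. by case/(at_levP a). Qed.

Lemma lev_at (a : flagT) k : k < n.+2 -> lev (at_lev a k) = k.
Proof. by case/(at_levP a). Qed.

Lemma at_lev_eq (a : flagT) x : x \in val a -> x = at_lev a (lev x).
Proof.
move=> xa; have [ya ly] := at_levP a (lev_max x).
by apply: comp_lev_eq; rewrite ?ly //; apply: chain_comp xa ya; apply: flag_chain (valP a).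
Qed.

Lemma flagT_ext (a b : flagT) : (forall k, k < n.+2 -> at_lev a k = at_lev b k) -> a = b.
Proof.
move=> eq_ab; apply: val_inj; apply/setP => x; apply/idP/idP => xa.
  by rewrite (at_lev_eq xa) eq_ab ?lev_max // at_lev_in // lev_max.
by rewrite (at_lev_eq xa) -eq_ab ?lev_max // at_lev_in // lev_max.
Qed.

Lemma at_lev_le (a : flagT) k l : k < n.+2 -> l < n.+2 -> k <= l -> (at_lev a k <= at_lev a l)%O.
Proof.
move=> ltk ltl kl; apply: comp_lev; last by rewrite !lev_at.
by apply: chain_comp (flag_chain (valP a)) _ _; apply: at_lev_in.
Qed.

Lemma at_lev_lt (a : flagT) k l : k < l -> l < n.+2 -> (at_lev a k < at_lev a l)%O.
Proof.
move=> kl ltl; have ltk := ltn_trans kl ltl; rewrite lt_neqAle (at_lev_le a ltk ltl (ltnW kl)) andbT.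
by apply: contraTneq kl => /(congr1 lev); rewrite !lev_at // => ->; rewrite ltnn.
Qed.

Lemma at_lev0 (a : flagT) : at_lev a 0 = \bot%O.
Proof. by apply: lev0; rewrite lev_at. Qed.

Lemma at_levn (a : flagT) : at_lev a n.+1 = \top%O.
Proof. by apply: levn; rewrite lev_at. Qed.

(** A strictly increasing sequence of [n.+2] faces cannot skip a level, so [F k] has level [k]. *)
Lemma flag_of_seq (F : nat -> Q) : (forall k, k < n.+1 -> (F k < F k.+1)%O) ->
  exists a : flagT, forall k, k < n.+2 -> at_lev a k = F k.
Proof.
move=> F_incr.
have levF k : k < n.+2 -> lev (F k) = k.
  apply: (strict_incr_id (g := fun k => lev (F k))) => l ltl; first exact: lev_max.
  by apply: lev_lt; apply: F_incr; rewrite -ltnS.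
have F_le k l : k <= l -> l < n.+2 -> (F k <= F l)%O.
  elim: l => [|l IH]; first by rewrite leqn0 => /eqP->.
  rewrite leq_eqVlt => /predU1P[-> //|]; rewrite ltnS => kl ltl.
  by apply: le_trans (IH kl (ltnW ltl)) _; apply/ltW/F_incr; rewrite -ltnS.
pose A := [set F (val k) | k : 'I_n.+2].
have chA : chain A.
  apply/forall_inP=> _ /imsetP[k _ ->]; apply/forall_inP=> _ /imsetP[l _ ->].
  by rewrite /Order.comparable; case: (leqP k l) => [|/ltnW] kl; rewrite (F_le _ _ kl) ?orbT ?ltn_ord.
have fA : flag A.
  apply: flag_card => //; rewrite card_imset ?card_ord // => k l /(congr1 lev).
  by rewrite !levF ?ltn_ord // => /val_inj.
exists (exist _ A fA) => k ltk; have : F k \in A by apply/imsetP; exists (Ordinal ltk).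
by move/(@at_lev_eq (exist _ A fA)) ->; rewrite levF.
Qed.

Definition agree_off i (a b : flagT) := forall k, k < n.+2 -> k != i.+1 -> at_lev b k = at_lev a k.

(** The diamond condition makes the pick succeed, in a unique way, for [i < n]; beyond that the
    default [a] is taken. *)
Definition qadj i (a : flagT) : flagT :=
  odflt a [pick b : flagT | (b != a) &&
             [forall k : 'I_n.+2, (val k != i.+1) ==> (at_lev b k == at_lev a k)]].

Lemma agree_neq i a b : agree_off i a b -> b <> a -> at_lev b i.+1 <> at_lev a i.+1.
Proof.
move=> ag ne eq_i; case: ne; apply: flagT_ext => k ltk.
by have [->|] := eqVneq k i.+1; [|apply: ag].
Qed.

Lemma middle_set i a : i < n -> exists z,
  [/\ z != at_lev a i.+1, (at_lev a i < z < at_lev a i.+2)%O &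
      forall y, (at_lev a i < y < at_lev a i.+2)%O -> y = at_lev a i.+1 \/ y = z].
Proof.
move=> lt_in; set D := [set z | (at_lev a i < z < at_lev a i.+2)%O].
have D2 : #|D| = 2.
  by apply: diamond; [apply: at_lev_lt | rewrite !rank_lev !lev_at]; lia.
have aD : at_lev a i.+1 \in D by rewrite inE !at_lev_lt //; lia.
have /cards1P[z eq_z] : #|D :\ at_lev a i.+1| == 1.
  by move: D2; rewrite (cardsD1 (at_lev a i.+1)) aD add1n => -[->].
have : z \in D :\ at_lev a i.+1 by rewrite eq_z set11.
rewrite !inE => /andP[ne zD]; exists z; split=> // y yD.
have [->|ney] := eqVneq y (at_lev a i.+1); first by left.
by right; apply/set1P; rewrite -eq_z !inE ney.
Qed.

Lemma agree_uniq i a b c : i < n -> agree_off i a b -> agree_off i a c ->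
  b <> a -> c <> a -> b = c.
Proof.
move=> lt_in agb agc neb nec; have [z [nz zD zP]] := middle_set a lt_in.
have atz d : agree_off i a d -> d <> a -> at_lev d i.+1 = z.
  move=> ag ne; case: (zP (at_lev d i.+1)) => // [|/(agree_neq ag ne)//].
  by rewrite -!ag ?at_lev_lt //; lia.
apply: flagT_ext => k ltk; have [->|ne] := eqVneq k i.+1; first by rewrite !atz.
by rewrite agb // agc.
Qed.

Lemma qadjP i a : i < n -> qadj i a <> a /\ agree_off i a (qadj i a).
Proof.
move=> lt_in; rewrite /qadj; case: pickP => [b /andP[/eqP neb /forallP ag]|none] /=.
  by split=> // k ltk ne; have /implyP/(_ ne)/eqP := ag (Ordinal ltk).
have [z [nz /andP[az za] zP]] := middle_set a lt_in.
pose F k := if k == i.+1 then z else at_lev a k.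
have [k ltk|b bP] := @flag_of_seq F; last first.
  case/negP: (negbT (none b)); apply/andP; split.
    apply: contraNneq nz => eq_ba; have ltS : i.+1 < n.+2 by lia.
    by have := bP _ ltS; rewrite /F eqxx eq_ba => <-.
  by apply/forallP => k; apply/implyP => ne; rewrite bP // /F (negPf ne).
rewrite /F; have [->|ne] := eqVneq k i.+1.
  by rewrite eqn_leq ltnn /=.
have [[->]|ne'] := eqVneq k.+1 i.+1; first by [].
by apply: at_lev_lt; lia.
Qed.

Lemma qadj_uniq i a b : i < n -> b <> a -> agree_off i a b -> b = qadj i a.
Proof. by move=> lt_in ne ag; have [ne' ag'] := qadjP a lt_in; apply: agree_uniq ag ag' _ _. Qed.

Lemma qadjK i : i < n -> involutive (qadj i).
Proof.
move=> lt_in a; have [ne ag] := qadjP a lt_in; apply/esym; apply: qadj_uniq => // [eq_a|k ltk nk].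
  by apply: ne; rewrite -eq_a.
by rewrite ag.
Qed.

Lemma qadj_at i a k : i < n -> k < n.+2 -> k != i.+1 -> at_lev (qadj i a) k = at_lev a k.
Proof. by move=> lt_in; have [_] := qadjP a lt_in; apply. Qed.

Lemma qadj_neq_at i a : i < n -> at_lev (qadj i a) i.+1 <> at_lev a i.+1.
Proof. by move=> lt_in; have [ne ag] := qadjP a lt_in; apply: agree_neq. Qed.

Lemma qadjC i j a : i.+1 < j -> j < n -> qadj i (qadj j a) = qadj j (qadj i a).
Proof.
move=> lt_ij lt_jn; have lt_in : i < n by lia.
apply/esym; apply: qadj_uniq => //.
  move/(congr1 (at_lev^~ i.+1)); rewrite !(@qadj_at j) //; try lia.
  exact: qadj_neq_at.
move=> k ltk nk; have [->|nkj] := eqVneq k j.+1; last by rewrite !qadj_at.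
(* The change at level [i.+1] leaves the levels [j] to [j.+2] alone, so at level [j.+1] both flags
   carry the same other face [z] of one diamond. *)
have [z [nz zD zP]] := middle_set a lt_jn.
have mid b : (forall l, j <= l <= j.+2 -> l != j.+1 -> at_lev b l = at_lev a l) ->
    at_lev b j.+1 <> at_lev a j.+1 -> at_lev b j.+1 = z.
  move=> eq_b ne; case: (zP (at_lev b j.+1)) => //.
  by rewrite -!eq_b ?at_lev_lt //; lia.
transitivity z; last apply/esym; apply: mid.
- by move=> l /andP[? ?] nl; rewrite (@qadj_at j) ?(@qadj_at i) //; lia.
- have := @qadj_neq_at j (qadj i a) lt_jn; rewrite [at_lev (qadj i a) _]qadj_at //; lia.
- by move=> l /andP[? ?] nl; rewrite (@qadj_at j) //; lia.
- exact: qadj_neq_at.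
Qed.

Lemma qadj_conn (a b : flagT) :
  conn qadj n (fun i => at_lev a i.+1 != at_lev b i.+1) a b.
Proof.
set J := fun i => _; have := flag_connected (valP a) (valP b).
set e := (e in connect e) => /connectP[s].
suff: forall c0, conn qadj n J a c0 -> path e (val c0) s -> val b = last (val c0) s ->
    conn qadj n J a b by apply; apply: conn_refl.
elim: s => [|B s IH] c0 cac /=; first by move=> _ /val_inj->.
case/andP=> /and3P[/and4P[_ fB /cards1P[x eq_x] _] sI sI'] pth eq_b.
pose c : flagT := exist _ B fB.
have /setDP[xc0 xB] : x \in val c0 :\: B by rewrite eq_x set11.
have ag k : k < n.+2 -> k != lev x -> at_lev c k = at_lev c0 k.
  move=> ltk nk; have : at_lev c0 k \in val c.
    apply: contraNT nk => nc; have : at_lev c0 k \in val c0 :\: B.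
      by rewrite inE nc at_lev_in.
    by rewrite eq_x inE => /eqP <-; rewrite lev_at.
  by move/at_lev_eq; rewrite lev_at.
(* The exchanged face is neither the least nor the greatest one, as these lie in every flag. *)
have x_in : 0 < lev x <= n.
  apply: contraNT xB => x_out; have := lev_max x; have [l0|l_gt0] := posnP (lev x) => ltx.
    by rewrite (lev0 l0) -(at_lev0 c) at_lev_in.
  have ln : lev x = n.+1 by lia.
  by rewrite (levn ln) -(at_levn c) at_lev_in.
case eq_i : (lev x) x_in ag => [//|i] lt_in ag.
have eq_c : c = qadj i c0.
  by apply: qadj_uniq => // eq_c; move: xB; rewrite -[B]/(val c) eq_c xc0.
apply: (IH c) pth eq_b => //; apply: conn_trans cac _; rewrite eq_c.
(* If [a] and [b] shared their face of level [i.+1], every flag of the walk would contain it, and it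
   could not be the face exchanged here. *)
apply: conn_step => //; rewrite /J; apply: contraNneq xB => eq_ab.
have ltS : i.+1 < n.+2 by lia.
have xI : at_lev a i.+1 \in val a :&: val b by rewrite inE {2}eq_ab !at_lev_in.
have := subsetP sI _ xI => /at_lev_eq; rewrite lev_at // -eq_i -(at_lev_eq xc0) eq_i => <-.
exact: (subsetP sI').
Qed.

Lemma qadj_lconn_at k (a b : flagT) : k < n.+2 ->
  conn qadj n (fun i => i.+1 != k) a b <-> at_lev a k = at_lev b k.
Proof.
move=> ltk; split=> [|eq_ab].
  apply: (conn_inv (R := fun b => at_lev a k = at_lev b k)) => // i c lt_in ne ->.
  by rewrite qadj_at // eq_sym.
by apply: conn_sub (qadj_conn a b) => i _; apply: contraNneq => ->; rewrite eq_ab.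
Qed.

Variable base : flagT.

Definition flag_maniplex : maniplex n.
refine (@Maniplex n flagT qadj qadjK _ qadjC base _ _).
- by move=> i a lt_in; apply/eqP; have [] := qadjP a lt_in.
- by move=> a b; apply: conn_sub (qadj_conn a b).
- move=> K a b Kab; apply: conn_sub (qadj_conn a b) => i lt_in; apply: contraNN => /Kab.
  by rewrite qadj_lconn_at ?ltnS 1?ltnW // => ->.
Defined.

Lemma at_lev_represents : @represents n flag_maniplex _ Q at_lev.
Proof.
split=> [q|a b k l ltk ltl].
  have chq : chain [set q].
    by apply/forall_inP=> x /set1P->; apply/forall_inP=> y /set1P->; rewrite comparablexx.
  have [A fA] := chain_ext chq; rewrite sub1set => qA.
  by exists (exist _ A fA : flagT), (lev q); split; [apply: lev_max | apply: at_lev_eq].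
apply/idP/incidentP => [le_ab | [c [kl /qadj_lconn_at-/(_ ltk)-> /qadj_lconn_at-/(_ ltl)<-]]];
  last exact: at_lev_le.
have kl : k <= l.
  move: le_ab; rewrite le_eqVlt => /predU1P[/(congr1 lev)|/lev_lt]; rewrite !lev_at //.
    by move->.
  exact: ltnW.
have chq : chain [set at_lev a k; at_lev b l].
  apply/forall_inP=> x /set2P[] ->; apply/forall_inP=> y /set2P[] ->;
  by rewrite ?comparablexx // /Order.comparable le_ab ?orbT.
have [A fA sA] := chain_ext chq; pose c : flagT := exist _ A fA.
have /at_lev_eq := subsetP sA (at_lev a k) (set21 _ _) : at_lev a k \in val c.
have /at_lev_eq := subsetP sA (at_lev b l) (set22 _ _) : at_lev b l \in val c.
rewrite !lev_at // => eq_b eq_a.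
by exists c; split=> //; apply/qadj_lconn_at.
Qed.

Lemma flag_of_at_lev (a : flagT) : flag_of (X := flag_maniplex) at_lev a = val a.
Proof.
apply/setP => q; apply/flag_ofP/idP => [[k ltk ->] | qa]; first exact: at_lev_in.
by exists (lev q); [apply: lev_max | apply: at_lev_eq].
Qed.

End PolytopeFlags.

(** * The automorphism group on flags and the two classes of the rotation subgroup *)

Lemma index2_mem (gT : finGroupType) (G H : {group gT}) x y :
    H \subset G -> #|G : H|%g = 2 -> x \in G -> x \notin H -> y \in G ->
  (x * y \in H)%g = (y \notin H).
Proof.
move=> sHG iGH xG nxH yG; have [yH|nyH] := boolP (y \in H); first by rewrite groupMr // (negPf nxH).
suff : y \in H :|: (x^-1 *: H)%g by rewrite inE (negPf nyH) mem_lcoset invgK.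
suff -> : H :|: (x^-1 *: H)%g = G by [].
have disj : [disjoint H & (x^-1 *: H)%g].
  rewrite -setI_eq0; apply/eqP/setP => z; rewrite !inE mem_lcoset invgK.
  by apply: contraNF nxH => /andP[zH]; rewrite groupMr.
apply/eqP; rewrite eqEcard subUset sHG /=; apply/andP; split.
  by apply/subsetP => z; rewrite mem_lcoset invgK => /(subsetP sHG); rewrite groupMl.
move: disj; rewrite -leq_card_setU => /eqP->.
by rewrite card_lcoset -(Lagrange sHG) iGH muln2 addnn.
Qed.

Section GammaOnFlags.
Variables (n : nat) (Q : polytope n) (a0 : flagT Q).
Implicit Types (s t : {perm Q}) (a b : flagT Q).
Local Notation MQ := (flag_maniplex a0).
Local Notation repQ := (at_lev_represents a0).

Definition flag_act s a : flagT Q := insubd a (s @: val a).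

Lemma flag_act_spec s : s \in Gamma Q ->
  (forall a, val (flag_act s a) = s @: val a) /\
  (maut (X := MQ) (flag_act s) /\ forall a k, k < n.+2 -> s (at_lev a k) = at_lev (flag_act s a) k).
Proof.
move=> Gs; have [al alA alP] := Gamma_aut repQ Gs.
have val_al a : s @: val a = val (al a).
  rewrite -!(flag_of_at_lev a0); apply/setP => q.
  apply/imsetP/flag_ofP => [[p /flag_ofP[k ltk ->] ->] | [k ltk ->]].
    by exists k; rewrite ?alP.
  by exists (at_lev a k); rewrite ?alP //; apply/flag_ofP; exists k.
have eq_al a : flag_act s a = al a by rewrite /flag_act val_al valKd.
split=> [a|]; first by rewrite eq_al.
by split=> [i a|a k] lt; rewrite !eq_al ?alA ?alP.
Qed.

Lemma val_flag_act s a : s \in Gamma Q -> val (flag_act s a) = s @: val a.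
Proof. by case/flag_act_spec. Qed.

Lemma flag_act_aut s : s \in Gamma Q -> maut (X := MQ) (flag_act s).
Proof. by case/flag_act_spec => _ []. Qed.

Lemma flag_act_qadj s i a : s \in Gamma Q -> i < n -> flag_act s (qadj i a) = qadj i (flag_act s a).
Proof. by move/flag_act_aut; apply. Qed.

Lemma flag_act_at s a k : s \in Gamma Q -> k < n.+2 -> s (at_lev a k) = at_lev (flag_act s a) k.
Proof. by move=> /flag_act_spec[_ []]; auto. Qed.

Lemma flag_act1 a : flag_act 1%g a = a.
Proof. by apply: val_inj; rewrite val_flag_act ?group1 // -[RHS]imset_id;
  apply: eq_imset => x; rewrite perm1. Qed.

Lemma flag_actM s t a : s \in Gamma Q -> t \in Gamma Q -> flag_act (s * t)%g a = flag_act t (flag_act s a).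
Proof.
move=> Gs Gt; apply: val_inj; rewrite !val_flag_act ?groupM // -imset_comp.
by apply: eq_imset => x; rewrite /= permM.
Qed.

Lemma flag_actV s a : s \in Gamma Q -> flag_act s^-1%g (flag_act s a) = a.
Proof. by move=> Gs; rewrite -flag_actM ?groupV // mulgV flag_act1. Qed.

Lemma flag_act_free s t a : s \in Gamma Q -> t \in Gamma Q -> flag_act s a = flag_act t a -> s = t.
Proof.
move=> Gs Gt eq_a; have eq_st := aut_eq (flag_act_aut Gs) (flag_act_aut Gt) eq_a.
apply/permP => q; have [b [k [ltk ->]]] := rep_surj repQ q.
by rewrite (flag_act_at _ Gs ltk) (flag_act_at _ Gt ltk) eq_st.
Qed.

Section DirectlyRegular.
Hypothesis n_gt0 : 0 < n.
Hypothesis dreg : directly_regular (val a0).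
Local Notation Gp := (Gamma_plus (val a0)).
Local Notation rho := (rho (val a0)).

Lemma flag_act_trans a b : exists2 s, s \in Gamma Q & flag_act s a = b.
Proof.
have [reg _] := dreg.
have aF : val a \in flags Q by rewrite inE (valP a).
have : val b \in flags Q by rewrite inE (valP b).
rewrite -(atransP reg _ aF) => /orbitP[s Gs eq_b]; exists s => //.
by apply: val_inj; rewrite val_flag_act // -eq_b; apply: eq_imset => x.
Qed.

Lemma rhoP i : i < n -> rho i \in Gamma Q /\ flag_act (rho i) a0 = qadj i a0.
Proof.
move=> lt_in; rewrite /Defs.rho; case: pickP => [s /andP[Gs]|none] /=; last first.
  have [s Gs eq_b] := flag_act_trans a0 (qadj i a0).
  have := none s; rewrite Gs -val_flag_act // eq_b -!(flag_of_at_lev a0) /i_adjacent.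
  rewrite (adjacent_adj repQ a0 lt_in) (flag_ofD_adj repQ a0 lt_in) /=.
  have ltS : i.+1 < n.+2 by lia.
  by move/negP; case; apply/forall_inP => q /set1P->; rewrite rank_lev lev_at //; apply/eqP; lia.
rewrite -val_flag_act // -!(flag_of_at_lev a0) => /andP[/(adjacentP repQ)[j lt_jn eq_j]].
rewrite eq_j (flag_ofD_adj repQ a0 lt_jn) => /forall_inP/(_ _ (set11 _)).
rewrite rank_lev lev_at ?ltnS 1?ltnW // => /eqP eq_ij; split=> //.
by congr (qadj _ a0); lia.
Qed.

Lemma Gp_sub : Gp \subset Gamma Q.
Proof.
rewrite gen_subG; apply/subsetP => s /imsetP[i]; rewrite inE => i_gt0 ->.
have [] := @rhoP i (ltn_ord i); have [|] := @rhoP i.-1; first by have := ltn_ord i; lia.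
by move=> G1 _ G2 _; apply: groupM.
Qed.

(** Automorphisms commute with adjacency, so the flag [i]-adjacent to the image of [a0] under [t] is
    its image under [rho i * t]. Connectedness and freeness conclude. *)
Lemma rho_gen s : s \in Gamma Q -> s \in <<[set rho (val i) | i : 'I_n]>>%g.
Proof.
move=> Gs; set R := <<_>>%g.
have RG : R \subset Gamma Q.
  by rewrite gen_subG; apply/subsetP => _ /imsetP[i _ ->]; have [] := rhoP (ltn_ord i).
suff [t Rt /(flag_act_free Gs)->] : exists2 t, t \in R & flag_act s a0 = flag_act t a0; rewrite ?(subsetP RG) //.
apply: (conn_inv (R := fun b => exists2 t, t \in R & b = flag_act t a0)) (adj_conn (a0 : MQ) (flag_act s a0)).
  by exists 1%g; rewrite ?group1 // flag_act1.
move=> i b lt_in _ [t Rt ->]; have [Gi eq_i] := rhoP lt_in.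
have Gt := subsetP RG _ Rt.
exists (rho i * t)%g; last by rewrite flag_actM // eq_i flag_act_qadj.
by rewrite groupM // mem_gen //; apply/imsetP; exists (Ordinal lt_in).
Qed.

(** Consecutive products of the generators lie in the rotation subgroup; if one [rho i] did too, all
    of them would, and the index would be 1. *)
Lemma rho_notin i : i < n -> rho i \notin Gp.
Proof.
move=> lt_in; apply/negP => rhoi.
have sig j : j.+1 < n -> (rho j * rho j.+1)%g \in Gp.
  by move=> ltj; apply: mem_gen; apply/imsetP; exists (Ordinal ltj); rewrite ?inE.
have rho0 j : j < n -> (rho j \in Gp) = (rho 0 \in Gp).
  elim: j => // j IH ltj; rewrite -IH; last exact: ltnW.
  apply/idP/idP => h; first by rewrite -(groupMr _ h) sig.
  by rewrite -(groupMl _ h) sig.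
have sGGp : Gamma Q \subset Gp.
  apply/subsetP => s /rho_gen; apply: subsetP; rewrite gen_subG.
  apply/subsetP => _ /imsetP[j _ ->].
  have: rho j \in Gp by rewrite (rho0 _ (ltn_ord j)) -(rho0 _ lt_in).
  exact: id.
have [_] := dreg; have -> : Gp = Gamma Q by apply/eqP; rewrite eqEsubset Gp_sub.
by rewrite indexgg.
Qed.

Definition par b : bool := ~~ [exists s in Gp, flag_act s a0 == b].

Lemma par_flag_act s : s \in Gamma Q -> par (flag_act s a0) = (s \notin Gp).
Proof.
move=> Gs; congr (~~ _); apply/exists_inP/idP => [[t tG /eqP eq_t]|sG]; last by exists s.
by rewrite -(flag_act_free (subsetP Gp_sub _ tG) Gs eq_t).
Qed.

Lemma par_qadj i b : i < n -> par (qadj i b) = ~~ par b.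
Proof.
move=> lt_in; have [s Gs <-] := flag_act_trans a0 b; have [Gi eq_i] := rhoP lt_in.
rewrite -(flag_act_qadj _ Gs lt_in) -eq_i -(flag_actM _ Gi Gs) (par_flag_act Gs) (par_flag_act (groupM Gi Gs)).
have [_ iGH] := dreg.
by congr (~~ _); apply: (index2_mem Gp_sub iGH Gi (rho_notin lt_in) Gs).
Qed.

Lemma par_Gp s b : s \in Gp -> par (flag_act s b) = par b.
Proof.
move=> sG; have [t Gt <-] := flag_act_trans a0 b; have Gs := subsetP Gp_sub _ sG.
by rewrite -(flag_actM _ Gt Gs) (par_flag_act Gt) (par_flag_act (groupM Gt Gs)) groupMr.
Qed.

Lemma par_trans a b : par a = par b -> exists2 s, s \in Gp & flag_act s a = b.
Proof.
have [s Gs <-] := flag_act_trans a0 a; have [t Gt <-] := flag_act_trans a0 b.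
rewrite !par_flag_act // => eq_st; exists (s^-1 * t)%g.
  have [sG|nsG] := boolP (s \in Gp); first by rewrite groupMl ?groupV // -[_ \in _]negbK -eq_st negbK.
  have [_ iGH] := dreg.
  have Gsi : s^-1%g \in Gamma Q by rewrite groupV.
  have nsiG : s^-1%g \notin Gp by rewrite groupV.
  have -> : ((s^-1 * t)%g \in Gp) = (t \notin Gp) := index2_mem Gp_sub iGH Gsi nsiG Gt.
  by rewrite -eq_st.
by rewrite flag_actM ?groupV // flag_actV.
Qed.

Lemma card_Gamma : #|Gamma Q| = #|Gp| * 2.
Proof. by have [_ <-] := dreg; rewrite Lagrange // Gp_sub. Qed.

End DirectlyRegular.
End GammaOnFlags.

(** * Voltage covers *)

Section Volt.
Variables (gT : finGroupType) (tau : nat -> gT).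
Local Open Scope group_scope.

(** The class changes at each step, so a step and its return carry inverse voltages. *)
Definition tv (e : bool) i : gT := if e then (tau i)^-1 else tau i.

Fixpoint volt (e : bool) (w : seq nat) : gT :=
  if w is i :: w' then tv e i * volt (~~ e) w' else 1.

Lemma tvK e i : tv e i * tv (~~ e) i = 1.
Proof. by case: e; rewrite /= ?mulgV ?mulVg. Qed.

Lemma volt_cat e w w' : volt e (w ++ w') = volt e w * volt (e (+) odd (size w)) w'.
Proof.
elim: w e => [|i w IH] e /=; first by rewrite mul1g addbF.
by rewrite IH mulgA addNb addbN.
Qed.

End Volt.

Lemma setX_proj (T1 T2 : finType) (A : {set T1}) (B : {set T2}) g :
  g \in setX A B -> (g.1 \in A) /\ (g.2 \in B).
Proof. by rewrite inE => /andP. Qed.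

Section ProductGroup.
Variables (gT kT : finGroupType) (a a' : gT) (b b' : kT).
Local Open Scope group_scope.

Lemma prodM : (a, b) * (a', b') = (a * a', b * b'). Proof. by []. Qed.
Lemma prodV : (a, b)^-1 = (a^-1, b^-1). Proof. by []. Qed.
Lemma prodJ : (a, b) ^ (a', b') = (a ^ a', b ^ b'). Proof. by []. Qed.

End ProductGroup.

Definition walk n (X : maniplex n) (w : seq nat) (x : X) : X :=
  foldl (fun x i => adj i x) x w.

Lemma walk_conn n (X : maniplex n) (J : pred nat) w (x : X) :
  all (fun i => (i < n) && J i) w -> conn (@adj n X) n J x (walk w x).
Proof.
elim: w x => [|i w IH] x /=; first by rewrite conn_refl.
case/andP=> /andP[lt_in Ji] Jw; apply: (@conn_trans _ _ _ _ (adj i x)); last exact: IH.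
exact: conn_step.
Qed.

Lemma walk_aut n (X : maniplex n) (a : X -> X) w x :
  maut a -> all (fun i => i < n) w -> a (walk w x) = walk w (a x).
Proof.
by move=> aA; elim: w x => [//|i w IH] x /= /andP[lt_in /IH->]; rewrite aA.
Qed.

(* A maniplex [cmap] with a group [cK] acting simply transitively on each of the two classes of
   [cpar], together with voltages [ctau] in a simple group [cL]. *)
Record cover_data (n : nat) := CoverData {
  cmap : maniplex n;
  cpar : cmap -> bool;
  cgT : finGroupType; ckT : finGroupType;
  cL : {group cgT}; cK : {group ckT};
  kact : ckT -> cmap -> cmap;
  ctau : nat -> cgT;
  cn_gt0 : 0 < n;
  cpar_adj : forall i a, i < n -> cpar (adj i a) = ~~ cpar a;
  kact_aut : forall k, k \in cK -> maut (kact k);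
  kact1 : forall a, kact 1%g a = a;
  kactM : forall k h a, k \in cK -> h \in cK -> kact (k * h)%g a = kact h (kact k a);
  kact_free : forall k h a, k \in cK -> h \in cK -> kact k a = kact h a -> k = h;
  cpar_kact : forall k a, k \in cK -> cpar (kact k a) = cpar a;
  cpar_trans : forall a b, cpar a = cpar b -> exists2 k, k \in cK & kact k a = b;
  ctau_in : forall i, ctau i \in cL;
  ctau0 : ctau 0 = 1%g;
  ctau_gen : cL \subset <<[set ctau (val i) | i : 'I_n]>>%g;
  ctau_comm : forall i j e, i.+1 < j -> j < n ->
    (tv ctau e j * tv ctau (~~ e) i = tv ctau e i * tv ctau (~~ e) j)%g;
  cL_simple : forall N : {group cgT}, (N <| cL)%g -> N :=: 1%g \/ N :=: cL;
  cL_ndvd : ~~ (#|cL| %| #|cK|);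
  cvert : forall (w : seq nat) a, all (fun i => 0 < i < n) w -> walk w a = a ->
    volt ctau (cpar a) w = 1%g
}.

Section Cover.
Variables (n : nat) (C : cover_data n).
Local Notation M := (cmap C).
Local Notation par := (@cpar n C).
Local Notation L := (cL C).
Local Notation K := (cK C).
Local Notation tau := (@ctau n C).
Local Notation tvt := (tv tau).
Local Open Scope group_scope.

Definition coverT : Type := {x : cgT C * M | x.1 \in L}.
HB.instance Definition _ := Finite.on coverT.
Implicit Types (x y : coverT) (a b : M).

Lemma tv_in e i : tvt e i \in L.
Proof. by case: e; rewrite /= ?groupV ctau_in. Qed.

Definition mkcover (l : cgT C) (lL : l \in L) a : coverT :=
  exist (fun x : cgT C * M => x.1 \in L) (l, a) lL.

Definition cadj i x : coverT :=
  mkcover (groupM (valP x) (tv_in (par (val x).2) i)) (adj i (val x).2).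

Lemma cover_ext x y : (val x).1 = (val y).1 -> (val x).2 = (val y).2 -> x = y.
Proof.
by move=> e1 e2; apply: val_inj; move: e1 e2; case: (val x) (val y) => [? ?] [? ?] /= -> ->.
Qed.

Lemma cadjK i : (i < n)%N -> involutive (cadj i).
Proof.
move=> lt_in x; apply: cover_ext => /=; last exact: adjK.
by rewrite cpar_adj // -mulgA tvK mulg1.
Qed.

Lemma cadj_neq i x : (i < n)%N -> cadj i x != x.
Proof.
move=> lt_in; apply: contraNneq (adj_neq (val x).2 lt_in) => e.
by rewrite -[X in _ == X]/((val x).2) -{2}e.
Qed.

Lemma cadjC i j x : (i.+1 < j)%N -> (j < n)%N -> cadj i (cadj j x) = cadj j (cadj i x).
Proof.
move=> lt_ij lt_jn; apply: cover_ext => /=; last exact: adjC.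
have lt_in : (i < n)%N by lia.
by rewrite !cpar_adj // -!mulgA ctau_comm.
Qed.

(** Left translations of [L] commute with the right multiplications by voltages; the inverse turns
    them into a right action, to match [kact]. *)
Definition dact (g : cgT C * ckT C) x : coverT :=
  insubd x (g.1^-1 * (val x).1, kact g.2 (val x).2).

Local Notation D := (setX L K).

Lemma val_dact g x : g \in D -> val (dact g x) = (g.1^-1 * (val x).1, kact g.2 (val x).2).
Proof.
move=> /setX_proj[g1 g2]; rewrite /dact val_insubd /= groupMl ?groupV // (valP x).
by [].
Qed.

Lemma dact_cadj g i x : g \in D -> (i < n)%N -> dact g (cadj i x) = cadj i (dact g x).
Proof.
move=> gD lt_in; have [_ g2] := setX_proj gD.
apply: cover_ext; rewrite /= ?val_dact //= ?mulgA ?cpar_kact // ?kact_aut //.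
Qed.

Lemma dactM g h x : g \in D -> h \in D -> dact (g * h) x = dact h (dact g x).
Proof.
move=> gD hD; have [_ g2] := setX_proj gD; have [_ h2] := setX_proj hD.
apply: val_inj; rewrite !val_dact ?groupM //= invMg mulgA.
by congr pair; exact: (kactM (val x).2 g2 h2).
Qed.

Lemma dact_free g h x : g \in D -> h \in D -> dact g x = dact h x -> g = h.
Proof.
move=> gD hD /(congr1 val); rewrite !val_dact // => -[/mulIg/invg_inj e1 e2].
have [_ g2] := setX_proj gD; have [_ h2] := setX_proj hD.
by move: (kact_free g2 h2 e2) e1; case: g {gD e2 g2} h {hD h2} => ? ? [? ?] /= -> ->.
Qed.

Lemma dact_trans x y : par (val x).2 = par (val y).2 -> exists2 g, g \in D & dact g x = y.
Proof.
case/cpar_trans => k kK eq_k; exists ((val x).1 * (val y).1^-1, k).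
  by rewrite inE /= kK groupM ?groupV // ?(valP x) ?(valP y).
have gD : ((val x).1 * (val y).1^-1, k) \in D.
  by rewrite inE /= kK groupM ?groupV // ?(valP x) ?(valP y).
apply: cover_ext; rewrite val_dact //= ?eq_k //.
by rewrite invMg invgK -mulgA mulVg mulg1.
Qed.

Lemma dact_conn g x y (J : pred nat) : g \in D ->
  conn cadj n J x y -> conn cadj n J (dact g x) (dact g y).
Proof. by move=> gD; apply: conn_homo => i z lt_in _; apply: dact_cadj. Qed.

Lemma cover_lift (J : pred nat) x b : conn (@adj n M) n J (val x).2 b ->
  exists2 y, (val y).2 = b & conn cadj n J x y.
Proof. exact: (conn_lift (f := fun x : coverT => (val x).2)). Qed.

Let x0 : coverT := mkcover (group1 L) (base_flag M).
(** The part of [L * K] that preserves the connected component of [x0]. Since [L * K] is transitive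
    on each class, the cover is connected once [H] is everything. *)
Let H := [set g in D | conn cadj n predT x0 (dact g x0)].

Fact H_group_set : group_set H.
Proof.
have inH g : (g \in H) = (g \in D) && conn cadj n predT x0 (dact g x0) by rewrite inE.
apply/group_setP; split=> [|g h]; rewrite !inH.
  rewrite group1 /= (_ : dact 1 x0 = x0) ?conn_refl //.
  by apply: cover_ext; rewrite val_dact ?group1 //= ?invg1 ?mul1g ?kact1.
case/andP=> gD cg /andP[hD ch]; rewrite groupM //= dactM //.
by apply: conn_trans ch _; apply: dact_conn.
Qed.

Let HG := Group H_group_set.

Let H_D g : g \in H -> g \in D.
Proof. by rewrite inE => /andP[]. Qed.

Let H_mem l k y : l \in L -> k \in K -> (val y).1 = l^-1 -> (val y).2 = kact k (base_flag M) ->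
  conn cadj n predT x0 y -> (l, k) \in H.
Proof.
move=> lL kK e1 e2 cy; have gD : (l, k) \in D by rewrite inE /= lL.
rewrite inE gD /= (_ : dact _ _ = y) //.
by apply: cover_ext; rewrite val_dact //= mulg1.
Qed.

Let H_snd k : k \in K -> exists l, (l, k) \in H.
Proof.
move=> kK; have [y e2 cy] := @cover_lift predT x0 _ (adj_conn (base_flag M) (kact k (base_flag M))).
by exists ((val y).1^-1); apply: H_mem (_ : conn _ _ _ _ y); rewrite ?groupV ?invgK ?(valP y).
Qed.

(** The walk [0, i] returns to the class of the base flag and, as [tau 0] is trivial, its voltage is
    [tau i] or its inverse; these elements generate [L]. *)
Let H_fst l : l \in L -> exists k, (l, k) \in H.
Proof.
suff sL : L \subset (fst @* HG)%g.
  by move/(subsetP sL) => /morphimP[[l' k] _ /= lkH ->]; exists k.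
apply: subset_trans (ctau_gen C) _; rewrite gen_subG; apply/subsetP => _ /imsetP[i _ ->].
have lt_in := ltn_ord i; set e := par (base_flag M).
suff : tvt (~~ e) i \in (fst @* HG)%g by rewrite /tv; case: (e) => // /groupVr; rewrite invgK.
rewrite -groupV; pose y := cadj i (cadj 0 x0).
have cy : conn cadj n predT x0 y.
  apply: conn_trans (_ : conn _ _ _ _ (cadj 0 x0)) _; apply: conn_step => //; exact: cn_gt0.
have [k kK eq_k] : exists2 k, k \in K & kact k (base_flag M) = (val y).2.
  by apply: cpar_trans; rewrite /= !cpar_adj ?negbK //; apply: cn_gt0.
have kH : ((tvt (~~ e) i)^-1, k) \in H.
  apply: H_mem cy => //; first by rewrite groupV tv_in.
  rewrite /= invgK mul1g cpar_adj ?cn_gt0 //.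
  by rewrite {1}/tv ctau0 invg1 if_same mul1g.
by apply/morphimP; exists ((tvt (~~ e) i)^-1, k); rewrite ?in_setT.
Qed.

Let N1 := [set l in L | (l, 1) \in H].

(* Goursat's lemma: a subgroup of [L * K] projecting onto both factors is everything, as [L] is
   simple and not a quotient of [K]. *)
Lemma cover_stab_full : H = D.
Proof.
have inN l : (l \in N1) = (l \in L) && ((l, 1) \in H) by rewrite inE.
have N1_group_set : group_set N1.
  apply/group_setP; split=> [|l l']; rewrite !inN; first by rewrite group1 (group1 HG).
  case/andP=> lL lH /andP[l'L l'H]; rewrite groupM //=.
  by have := groupM (lH : _ \in HG) l'H; rewrite prodM mulg1.
have nN1 : Group N1_group_set <| L.
  apply/andP; split; first by apply/subsetP => l /=; rewrite inN => /andP[].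
  apply/subsetP => l lL; rewrite inE; apply/subsetP => z /imsetP[m /=].
  rewrite !inN => /andP[mL mH] ->; rewrite groupJ //=; have [k lk] := H_fst lL.
  by have := groupJ (mH : _ \in HG) lk; rewrite prodJ conj1g.
have [/= N11|/= N1L] := cL_simple nN1; last first.
  apply/eqP; rewrite eqEsubset; apply/andP; split; first by apply/subsetP => g /H_D.
  apply/subsetP => -[l k] /setX_proj[/= lL kK]; have [l' l'k] := H_snd kK.
  have /setX_proj[/= l'L _] := H_D l'k.
  have : l * l'^-1 \in N1 by rewrite N1L groupM ?groupV.
  rewrite inN => /andP[_ h]; have := groupM (h : _ \in HG) l'k.
  by rewrite prodM mul1g -mulgA mulVg mulg1.
(* With [N1] trivial, [H] maps bijectively onto [K] and still onto [L], so the order of [L] would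
   divide that of [K]. *)
case/negP: (cL_ndvd C).
have -> : #|K| = #|H|.
  rewrite -[RHS](card_in_imset (f := snd)).
    apply: eq_card => k; apply/idP/imsetP => [/H_snd[l lk]|[[l k'] /H_D/setX_proj[_ kK] ->//]].
    by exists (l, k).
  move=> [l k] [l' k'] lk l'k' /= ek; subst k'; congr pair.
  apply/eqP; rewrite eq_mulgV1; apply/eqP/set1gP; rewrite -N11 inN.
  have /setX_proj[/= lL _] := H_D lk; have /setX_proj[/= l'L _] := H_D l'k'.
  rewrite groupM ?groupV //=.
  by have := groupM (lk : _ \in HG) (groupVr (l'k' : _ \in HG)); rewrite prodV prodM mulgV.
have -> : L :=: (fst @* HG)%g.
  apply/eqP; rewrite eqEsubset; apply/andP; split; apply/subsetP => l.
    by move/H_fst => [k lk]; apply/morphimP; exists (l, k); rewrite ?in_setT.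
  by case/morphimP => g _ /H_D/setX_proj[g1 _] ->.
exact: dvdn_morphim.
Qed.

Lemma cover_conn x y : conn cadj n predT x y.
Proof.
have cadj_sym : symmetric (conn cadj n predT) by apply: conn_sym => i; apply: cadjK.
suff {x y} c0 y : conn cadj n predT x0 y.
  by apply: conn_trans (c0 y); rewrite cadj_sym.
suff {y} ev y : par (val y).2 = par (base_flag M) -> conn cadj n predT x0 y.
  have [/ev //|] := eqVneq (par (val y).2) (par (base_flag M)) => ne.
  have n_gt0 := cn_gt0 C.
  apply: conn_trans (ev (cadj 0 y) _) _.
    by rewrite /= cpar_adj //; move: ne; case: (par _) (par _) => [] [].
  by rewrite cadj_sym; apply: conn_step.
move=> e; have [g gD <-] : exists2 g, g \in D & dact g x0 = y by apply: dact_trans.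
by move: gD; rewrite -cover_stab_full inE => /andP[].
Qed.

Lemma cover_vert x y : conn cadj n (fun i => i != 0%N) x y -> (val x).2 = (val y).2 -> x = y.
Proof.
have aux : conn cadj n (fun i => i != 0%N) x y -> exists w,
    [/\ all (fun i => 0 < i < n)%N w, walk w (val x).2 = (val y).2 &
        (val y).1 = (val x).1 * volt tau (par (val x).2) w /\
        par (val y).2 = par (val x).2 (+) odd (size w)].
  apply: (conn_inv (R := fun y => exists w,
    [/\ all (fun i => 0 < i < n)%N w, walk w (val x).2 = (val y).2 &
        (val y).1 = (val x).1 * volt tau (par (val x).2) w /\
        par (val y).2 = par (val x).2 (+) odd (size w)])).
    by exists [::]; rewrite /= mulg1 addbF.
  move=> i z lt_in i_neq0 [w [wn ww [wv wp]]]; exists (rcons w i); split.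
  - by rewrite all_rcons wn lt0n i_neq0 lt_in.
  - by rewrite -cats1 /walk foldl_cat /= -/(walk w _) ww.
  - by rewrite -cats1 volt_cat /= cpar_adj // wv wp size_cat addn1 /= addbN mulg1 mulgA.
case/aux => w [wn ww [wv _]] e2; apply: cover_ext => //.
by rewrite wv cvert ?mulg1 // ww.
Qed.

(** If level 1 is among those kept, a walk provided by the base lifts, and injectivity on
    vertex-figures identifies its end with [y]. Otherwise the walk is cut at the lowest relevant
    level [k], and level 1 is added to the constraints of its upper part. *)
Lemma cover_pip (I : pred nat) x y :
    (forall k, I k -> conn cadj n (fun i => i.+1 != k) x y) ->
  conn cadj n (fun i => ~~ I i.+1) x y.
Proof.
have cadj_sym J : symmetric (conn cadj n J) by apply: conn_sym => i; apply: cadjK.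
have withv (J : pred nat) z t : J 1%N ->
    (forall k, J k -> conn cadj n (fun i => i.+1 != k) z t) ->
    conn cadj n (fun i => ~~ J i.+1) z t.
  move=> J1 Jzt; have [|t' e ct'] := @cover_lift (fun i => ~~ J i.+1) z (val t).2.
    apply: adj_pip => k /Jzt.
    exact: (conn_homo (f := fun x : coverT => (val x).2)).
  suff <- : t' = t by [].
  apply: cover_vert => //; apply: conn_trans (_ : conn _ _ _ _ z) _.
    rewrite cadj_sym; apply: conn_sub ct' => i _; apply: contraNneq => ->; exact: J1.
  by apply: conn_sub (Jzt _ J1) => i.
move=> Ixy; have [I1|nI1] := boolP (I 1%N); first exact: withv.
have [/existsP[k0 /andP[k0_gt1 Ik0]] | none] :=
    boolP [exists k : 'I_n.+1, (1 < k)%N && I k]; last first.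
  apply: conn_sub (cover_conn x y) => i lt_in _; apply: contraNN none => Ii.
  apply/existsP; exists (Ordinal (lt_in : (i.+1 < n.+1)%N)); rewrite /= Ii andbT.
  by case: i lt_in Ii => // _ Ii; rewrite Ii in nI1.
have exk : exists k, (1 < k)%N && I k by exists k0; rewrite k0_gt1.
case: (ex_minnP exk) => k /andP[k_gt1 Ik] kmin.
have le_kn : (k <= n)%N.
  by apply: leq_trans (kmin _ _) (_ : k0 <= n)%N; rewrite ?k0_gt1 // -ltnS.
have comm i j z : (i < n)%N -> (j < n)%N -> (k <= i)%N -> (j.+1 < k)%N ->
    cadj i (cadj j z) = cadj j (cadj i z).
  by move=> *; rewrite (@cadjC j i) //; lia.
(* The steps from [x] to [w] have index at least [k], hence keep level 1; those from [w] to [y] only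
   change levels below [k], which are unconstrained. *)
have /(conn_split comm)[w cxw cwy] :
    conn cadj n (fun i => (k <= i) || (i.+1 < k))%N x y.
  by apply: conn_sub (Ixy _ Ik) => i _; lia.
have Ilow i : (i.+1 < k)%N -> ~~ I i.+1.
  move=> lt_ik; case: i lt_ik => [//|i] lt_ik; apply/negP => Ii.
  by have := kmin i.+2; rewrite Ii /= => /(_ isT); lia.
apply: (@conn_trans _ _ _ _ w).
  apply: conn_sub (withv (fun j => I j || (j == 1%N)) x w _ _); last 2 first.
  - by rewrite eqxx orbT.
  - move=> j /orP[Ij | /eqP->]; last by apply: conn_sub cxw => i _; lia.
    apply: conn_trans (Ixy _ Ij) _; rewrite cadj_sym.
    by apply: conn_sub cwy => i _ /Ilow; apply: contraNneq => ->.
  by move=> i _; rewrite negb_or => /andP[].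
by apply: conn_sub cwy => i _; apply: Ilow.
Qed.

Definition cover_maniplex : maniplex n :=
  Maniplex cadjK cadj_neq cadjC x0 cover_conn cover_pip.

Local Notation X := cover_maniplex.

Lemma dact_aut g : g \in D -> maut (X := X) (dact g).
Proof. by move=> gD i x lt_in; apply: dact_cadj. Qed.

Lemma cover_walk w (x : X) : all (fun i => i < n)%N w ->
  (val (walk w x)).1 = (val x).1 * volt tau (par (val x).2) w /\
  (val (walk w x)).2 = walk w (val x).2.
Proof.
elim: w x => [|i w IH] x /=; first by rewrite mulg1.
by case/andP=> lt_in /IH-/(_ (cadj i x))[-> ->] /=; rewrite cpar_adj // mulgA.
Qed.

Lemma par_walk w (a : M) : all (fun i => i < n)%N w ->
  par (walk w a) = par a (+) odd (size w).
Proof.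
elim: w a => [|i w IH] a /=; first by rewrite addbF.
by case/andP=> lt_in /IH->; rewrite cpar_adj // addNb addbN.
Qed.

Lemma aut_par (al : X -> X) : maut al ->
  exists e, forall x, par (val (al x)).2 = par (val x).2 (+) e.
Proof.
move=> alA; exists (par (val (al x0)).2 (+) par (val x0).2) => x.
apply: (conn_inv (R := fun x => par (val (al x)).2 = par (val x).2 (+) _)) (cover_conn x0 x).
  by rewrite addbC addbK.
by move=> i z lt_in _ e; rewrite alA //= !cpar_adj // e addNb.
Qed.

Lemma cover_chiral (w : seq nat) : all (fun i => i < n)%N w -> ~~ odd (size w) ->
    volt tau false w = 1 -> volt tau true w <> 1 ->
  forall (al : X -> X) x, maut al -> par (val (al x)).2 = par (val x).2.
Proof.
move=> wn w_even w1 w2 al x alA; have [e eP] := aut_par alA.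
rewrite eP; case: e eP => [eP|]; last by rewrite addbF.
(* [L * K] is simply transitive on each class, so conjugation by [al] can be read off at the single
   flag [x0]. *)
have /choice[psi psiP] g : exists h, g \in D -> h \in D /\ forall y, al (dact g y) = dact h (al y).
  have [gD|?] := boolP (g \in D); last by exists 1.
  have [|h hD eq_h] := @dact_trans (al x0) (al (dact g x0)).
    by rewrite !eP val_dact // cpar_kact //; case/setX_proj: gD.
  exists h => _; split=> // y.
  apply: (@aut_eq _ X (al \o dact g) (dact h \o al) x0) => //= i z lt_in /=.
    by rewrite dact_aut // alA.
  by rewrite alA // dact_aut.
have psiD g : g \in D -> psi g \in D by case/psiP.
have psiE g y : g \in D -> al (dact g y) = dact (psi g) (al y) by case/psiP => _; apply.
have psiM : {in D &, {morph psi : g h / g * h}}.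
  move=> g h gD hD; apply: (@dact_free _ _ (al x0)); rewrite ?psiD ?groupM ?psiD //.
  by rewrite -psiE ?groupM // !dactM ?psiD // -!psiE.
have psi_inj : {in D &, injective psi}.
  move=> g h gD hD e; apply: (@dact_free _ _ x0) => //.
  by apply: (aut_inj alA); rewrite !psiE // e.
have psi_surj g : g \in D -> exists2 h, h \in D & psi h = g.
  have eqD : psi @: D = D.
    apply/eqP; rewrite eqEcard card_in_imset // leqnn andbT.
    by apply/subsetP => _ /imsetP[h hD ->]; apply: psiD.
  by rewrite -{1}eqD => /imsetP[h hD ->]; exists h.
pose f k := (psi (1, k)).1.
have oneD k : k \in K -> (1, k) \in D by move=> kK; rewrite inE /= group1.
have fM : {in K &, {morph f : k h / k * h}}.
  move=> k h kK hK; have := psiM _ _ (oneD _ kK) (oneD _ hK); rewrite prodM mulg1 /f => ->.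
  by case: (psi (1, k)) (psi (1, h)) => ? ? [? ?]; rewrite prodM.
pose F := Morphism fM.
(* [psi] is onto, so the [L]-components of the images of [K] form a normal subgroup of [L]. It is a
   quotient of [K], hence not [L]; being trivial, it leaves [K] stable under [psi]. *)
have nF : (F @* K)%G <| L.
  apply/andP; split.
    apply/subsetP => _ /morphimP[k kK _ ->]; by have /setX_proj[] := psiD _ (oneD _ kK).
  apply/subsetP => l lL; rewrite inE; apply/subsetP => _ /imsetP[_ /morphimP[k kK _ ->] ->].
  have lD : (l, 1) \in D by rewrite inE /= lL group1.
  have [g gD eq_g] := psi_surj _ lD; have /setX_proj[_ g2] := gD.
  apply/morphimP; exists (k ^ g.2); rewrite ?groupJ //.
  rewrite /= /f (_ : (1, k ^ g.2) = (1, k) ^ g); last first.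
    by case: (g) => ? ?; rewrite prodJ conj1g.
  have psiJ : psi ((1, k) ^ g) = psi (1, k) ^ psi g.
    apply: (@mulgI _ (psi g)); rewrite -conjgC -!psiM ?groupJ ?oneD //.
    by rewrite -conjgC.
  by rewrite psiJ eq_g; case: (psi (1, k)) => ? ?; rewrite prodJ.
have [F1|FL] := cL_simple nF; last first.
  by case/negP: (cL_ndvd C); rewrite -FL; apply: dvdn_morphim.
(* From a flag of class [false], walking along [w] amounts to acting by an element of [K]. Applying
   [al], the same holds at [al y], of class [true], where [w] has nontrivial voltage. *)
have fix1 y : par (val y).2 = false -> False.
  move=> py; have [e1 e2] := cover_walk y wn.
  have [k kK eq_k] : exists2 k, k \in K & kact k (val y).2 = walk w (val y).2.
    by apply: cpar_trans; rewrite par_walk // (negPf w_even) addbF.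
  have ey : walk (X := X) w y = dact (1, k) y.
    by apply: cover_ext; rewrite val_dact ?oneD //= ?e1 ?e2 ?py ?w1 ?mulg1 ?invg1 ?mul1g.
  have := cover_walk (al y) wn; rewrite -walk_aut // ey psiE ?oneD //.
  rewrite val_dact ?psiD ?oneD // eP py /= => -[].
  have -> : (psi (1, k)).1 = 1.
    by apply/set1gP; rewrite -F1; apply/morphimP; exists k.
  by rewrite invg1 mul1g -{1}[(val (al y)).1]mulg1 => /mulgI/esym.
have [px|/negPf/fix1 //] := boolP (par (val x).2).
by case: (fix1 (cadj 0 x)); rewrite /= cpar_adj ?cn_gt0 // px.
Qed.

Section NoReflection.
Hypothesis no_refl : forall (al : X -> X) x, maut al -> par (val (al x)).2 = par (val x).2.
Local Notation P := (polytope_of X).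

Definition cface (x : X) (k : nat) : P := mk_face x k.

Lemma cface_represents : represents cface.
Proof. exact: mk_face_represents. Qed.

Local Notation repP := cface_represents.

Definition cover_perm g : {perm P} := lift_aut cface (dact g).

Lemma cover_permE g x k : g \in D -> (k < n.+2)%N ->
  cover_perm g (cface x k) = cface (dact g x) k.
Proof. by move=> gD ltk; apply: (lift_autE repP) => //; apply: dact_aut. Qed.

Lemma cover_permM : {in D &, {morph cover_perm : g h / g * h}}.
Proof.
move=> g h gD hD; apply/permP => q; have [x [k [ltk ->]]] := rep_surj repP q.
transitivity (cover_perm h (cover_perm g (cface x k))); last by rewrite permM.
have e2 := cover_permE x gD ltk; have e3 := cover_permE (dact g x) hD ltk.
apply: etrans (cover_permE x (groupM gD hD) ltk) _.
apply: etrans (congr1 (cface^~ k) (dactM x gD hD)) _.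
exact: esym (etrans (congr1 (cover_perm h) e2) e3).
Qed.

(** An automorphism preserves the classes and is determined by the image of one flag; simple
    transitivity on a class then leaves no automorphisms but the [dact g]. *)
Lemma cover_Gamma_isog : Gamma P \isog setX L K.
Proof.
rewrite isog_sym; apply/isogP; exists (Morphism cover_permM).
  apply/injmP => g h gD hD /= e; apply: (@dact_free _ _ x0) => //.
  apply/esym; apply: (rep_inj repP) => k ltk; 
  have e1 := cover_permE x0 gD ltk; have e2 := cover_permE x0 hD ltk.
  exact: etrans (esym e1) (etrans (congr1 (fun s : {perm P} => s (cface x0 k)) e) e2).
apply/eqP; rewrite eqEsubset; apply/andP; split; apply/subsetP => s.
  by case/morphimP => g gD _ ->; apply: (lift_aut_Gamma repP); apply: dact_aut.
move=> /(Gamma_aut repP)[al alA alP].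
have [g gD eq_g] := @dact_trans x0 (al x0) (esym (no_refl _ alA)).
have alE := aut_eq (dact_aut gD) alA eq_g.
apply/morphimP; exists g => //; apply/permP => q; have [x [k [ltk ->]]] := rep_surj repP q.
apply: etrans (alP x k ltk) (etrans (congr1 (cface^~ k) (esym (alE x))) (esym _)).
exact: cover_permE.
Qed.

Lemma cover_polytope_chiral : chiral P.
Proof.
apply: (chiral_crit repP (col := fun x => par (val x).2)).
- exact: cn_gt0.
- by move=> i x lt_in; apply: cpar_adj.
- by move=> x y /dact_trans[g gD <-]; exists (dact g) => //; apply: dact_aut.
move=> a i x aA lt_in e; have := no_refl x aA; rewrite e /= cpar_adj //.
by case: (par _).
Qed.

End NoReflection.

End Cover.

(** * Facets as maniplexes of lower rank *)

Lemma conn_range (X : finType) (r : nat -> X -> X) n n' (J J' : pred nat) x y :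
    (forall i, i < n -> J i -> (i < n') && J' i) -> conn r n J x y -> conn r n' J' x y.
Proof.
move=> sJ; apply: (conn_inv (R := conn r n' J' x)); first exact: conn_refl.
move=> i z lt_in Ji cxz; have /andP[lt' Ji'] := sJ i lt_in Ji.
by apply: conn_trans cxz _; apply: conn_step.
Qed.

Section FacetManiplex.
Variables (n : nat) (X : maniplex n.+1) (x : X).

Definition facetT : Type := {y : X | lconn n.+1 x y}.
HB.instance Definition _ := Finite.on facetT.
Implicit Types (y z : facetT).

Definition fadj i y : facetT := insubd y (adj i (val y)).

Lemma val_fadj i y : i < n -> val (fadj i y) = adj i (val y).
Proof.
move=> lt_in; rewrite /fadj val_insubd (lconn_trans (valP y)) // lconn_adj //; lia.
Qed.

Lemma conn_facet (J : pred nat) y z :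
  conn fadj n J y z <-> conn (@adj _ X) n.+1 (fun i => (i != n) && J i) (val y) (val z).
Proof.
split.
  apply: (conn_inv (R := fun z => conn _ _ (fun i => (i != n) && J i) (val y) (val z))).
    exact: conn_refl.
  move=> i t lt_in Ji cyt; rewrite val_fadj //.
  by apply: conn_trans cyt _; apply: conn_step; rewrite ?Ji ?andbT ?ltnS 1?ltnW // neq_ltn lt_in.
move=> cyz; have {}cyz : conn (@adj _ X) n J (val y) (val z).
  by apply: conn_range cyz => i ltS /andP[ne ->]; rewrite andbT ltn_neqAle ne.
have [|z' /val_inj-> //] := conn_lift (f := val) (rX := fadj) _ cyz.
by move=> i t lt_in _; apply: val_fadj.
Qed.

Lemma facet_lconn y z (I : pred nat) : (forall k, I k -> lconn k (val y) (val z)) ->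
  conn fadj n (fun i => ~~ I i.+1) y z.
Proof.
move=> Iyz; apply/conn_facet.
(* Two flags of the facet also share level [n.+1], which is added to [I]. *)
have : conn (@adj _ X) n.+1 (fun i => ~~ (I i.+1 || (i.+1 == n.+1))) (val y) (val z).
  apply: (adj_pip (K := fun k => I k || (k == n.+1))) => k /orP[/Iyz //|/eqP->].
  by apply: (@lconn_trans _ _ _ x); rewrite ?(valP z) // lconn_sym (valP y).
by apply: conn_sub => i _; rewrite negb_or eqSS andbC.
Qed.

Lemma conn_facet_lconn k y z : conn fadj n (fun i => i.+1 != k) y z -> lconn k (val y) (val z).
Proof. by move/conn_facet; apply: conn_sub => i _ /andP[]. Qed.

Fact fadjK i : i < n -> involutive (fadj i).
Proof. by move=> lt_in y; apply: val_inj; rewrite !val_fadj // adjK // ltnW. Qed.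

Fact fadj_neq i y : i < n -> fadj i y != y.
Proof. by move=> lt_in; rewrite -val_eqE val_fadj // adj_neq // ltnW. Qed.

Fact fadjC i j y : i.+1 < j -> j < n -> fadj i (fadj j y) = fadj j (fadj i y).
Proof.
move=> lt_ij lt_jn; have lt_in : i < n by lia.
by apply: val_inj; rewrite !val_fadj // adjC // ltnW.
Qed.

Fact fadj_conn y z : conn fadj n predT y z.
Proof. by apply: conn_sub (facet_lconn (I := pred0) _). Qed.

Fact fadj_pip (I : pred nat) y z :
    (forall k, I k -> conn fadj n (fun i => i.+1 != k) y z) ->
  conn fadj n (fun i => ~~ I i.+1) y z.
Proof. by move=> h; apply: facet_lconn => k /h; apply: conn_facet_lconn. Qed.

Definition facet_base : facetT := exist (fun y : X => is_true (lconn n.+1 x y)) x (lconn_refl _ x).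

Definition facet_maniplex : maniplex n :=
  Maniplex fadjK fadj_neq fadjC facet_base fadj_conn fadj_pip.

Lemma facet_lconnE k y z : lconn (X := facet_maniplex) k y z = lconn k (val y) (val z).
Proof.
apply/idP/idP; first exact: conn_facet_lconn.
move=> c; have := @facet_lconn y z (pred1 k); apply=> j /eqP-> //.
Qed.

(** A witness of incidence in [X] may leave the facet; [lconn_split] replaces it by a flag that
    agrees with [z] from level [l] on, hence stays in the facet. *)
Lemma facet_incident k l y z : l <= n.+1 ->
  incident (X := facet_maniplex) k y l z = incident k (val y) l (val z).
Proof.
move=> le_l; apply/incidentP/incidentP => -[t [kl]].
  by rewrite !facet_lconnE => c1 c2; exists (val t).
move=> c1 /lconn_split[w [ctw cwz]].
have xw : lconn n.+1 x w by apply: lconn_trans (valP z) _; rewrite lconn_sym; apply: cwz.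
exists (exist (fun y : X => is_true (lconn n.+1 x y)) w xw : facetT); rewrite !facet_lconnE; split=> //=.
  by apply: lconn_trans c1 (ctw _ kl).
exact: cwz.
Qed.

End FacetManiplex.

Section FacetPoset.
Variables (n : nat) (X : maniplex n.+1) (P : polytope n.+1) (f : X -> nat -> P).
Hypothesis repP : represents f.
Variables (x : X) (F : P).
Hypothesis defF : F = f x n.+1.

Definition facet_face (y : facet_maniplex x) (k : nat) : facet F :=
  insubd (\top%O : facet F) (f (val y) k).

Lemma val_facet_face y k : k < n.+2 -> val (facet_face y k) = f (val y) k.
Proof.
move=> ltk; rewrite /facet_face val_insubd le0x defF.
have -> : f x n.+1 = f (val y) n.+1 by apply/(rep_eqP repP) => //; apply: valP.
by have -> : (f (val y) k <= f (val y) n.+1)%O by rewrite (rep_le_same repP) //; lia.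
Qed.

Lemma facet_represents : represents facet_face.
Proof.
split=> [q|y z k l ltk ltl]; last first.
  rewrite -Order.le_val !val_facet_face // (rep_le repP) ?facet_incident //; lia.
have /andP[_ le_qF] := valP q; have [y [k [ltk eq_q]]] := rep_surj repP (val q).
have lekn : k <= n.+1.
  by move: le_qF; rewrite eq_q defF (rep_le repP) // => /andP[].
have [||z zk zn] := rep_comm repP (x := y) (y := x) ltk (_ : n.+1 < n.+3) lekn => //.
  by rewrite -eq_q -defF /Order.comparable le_qF.
have xz : lconn n.+1 x z by apply/(rep_eqP repP).
exists (exist (fun y : X => is_true (lconn n.+1 x y)) z xz : facetT x), k; split=> //.
by apply: val_inj; rewrite val_facet_face //= eq_q zk.
Qed.

End FacetPoset.

Lemma facet_top n (X : maniplex n.+1) (P : polytope n.+1) (f : X -> nat -> P) (F : P) :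
    represents f -> (forall x k, k < n.+3 -> Defs.rank (f x k) = (k%:Z - 1)%R) ->
  is_facet F -> exists x, F = f x n.+1.
Proof.
move=> repP rk; have [x [k [ltk ->]]] := rep_surj repP F.
by rewrite /is_facet rk // => e; exists x; congr (f x _); lia.
Qed.

(** * Vertex-figures of the cover *)

Section VertexFigure.
Variables (n : nat) (C : cover_data n) (Q : polytope n) (fQ : cmap C -> nat -> Q).
Hypothesis repQ : represents fQ.
Local Notation X := (cover_maniplex C).
Variables (P : polytope n) (f : X -> nat -> P).
Hypothesis repP : represents f.
Variables (x : X) (v : P) (v' : Q).
Hypothesis (defv : v = f x 1) (defv' : v' = fQ (val x).2 1).

(** The common index set for [poset_iso_common]: flags of the cover at the vertex, with a level from
    1 on. *)
Let Idx := {yk : X * nat | lconn 1 x yk.1 && (0 < yk.2 < n.+2)}.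

Let n1 : 1 < n.+2. Proof. by []. Qed.

Lemma conn_cover_vert (I : pred nat) (y z : X) : I 1 -> lconn 1 y z ->
    (forall k, I k -> lconn k (val y).2 (val z).2) -> conn (@adj _ X) n (fun i => ~~ I i.+1) y z.
Proof.
move=> I1 cyz Iyz.
have [t e ct] := @cover_lift _ C (fun i => ~~ I i.+1) y (val z).2 (adj_pip Iyz).
suff <- : t = z by [].
apply: cover_vert => //; apply: (@conn_trans _ _ _ _ y).
  rewrite conn_sym; first by apply: conn_sub ct => i _; apply: contraNneq => ->.
  exact: cadjK.
by apply: conn_sub cyz => i.
Qed.

(** For the descent from [Q] to the cover: the witness is first moved so as to share the vertex,
    then reached from [y] by a lifted walk at that vertex, and joined to [z] by
    [conn_cover_vert]. *)
Lemma cover_incident k l (y z : X) : 0 < k -> lconn 1 y z ->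
  incident k y l z = incident k (val y).2 l (val z).2.
Proof.
move=> k_gt0 cyz.
have homo j (s t : X) : lconn j s t -> lconn j (val s).2 (val t).2.
  exact: (conn_homo (f := fun x : coverT C => (val x).2)).
apply/incidentP/incidentP => -[t [kl c1 c2]].
  by exists (val t).2; split=> //; apply: homo.
have [w [cyw cwt]] := lconn_split c1.
have c1k : conn (@adj _ (cmap C)) n (fun i => ~~ ((i.+1 == 1) || (i.+1 == k))) (val y).2 w.
  by apply: (adj_pip (K := fun j => (j == 1) || (j == k))) => j /orP[] /eqP->; apply: cyw.
have [t' e ct'] := @cover_lift _ C _ y w c1k.
have ct1 : lconn (X := X) 1 y t' by apply: conn_sub ct' => i _; rewrite negb_or => /andP[].
exists t'; split=> //; first by apply: conn_sub ct' => i _; rewrite negb_or => /andP[].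
have ct'z : lconn (X := X) 1 t' z by apply: lconn_trans cyz; rewrite lconn_sym.
have : conn (@adj _ X) n (fun i => ~~ ((i.+1 == 1) || (i.+1 == l))) t' z.
  apply: (conn_cover_vert (I := fun j => (j == 1) || (j == l))) => // j /orP[] /eqP->.
    exact: homo.
  by rewrite e; apply: lconn_trans (cwt _ kl) c2.
by apply: conn_sub => i _; rewrite negb_or => /andP[].
Qed.

Lemma vertex_figure_iso : poset_iso (vertex_figure v) (vertex_figure v').
Proof.
pose g1 (i : Idx) : vertex_figure v := insubd (\top%O : vertex_figure v) (f (val i).1 (val i).2).
pose g2 (i : Idx) : vertex_figure v' := insubd (\top%O : vertex_figure v') (fQ (val (val i).1).2 (val i).2).
have homo j (s t : X) : lconn j s t -> lconn j (val s).2 (val t).2.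
  exact: (conn_homo (f := fun x : coverT C => (val x).2)).
have g1E i : val (g1 i) = f (val i).1 (val i).2.
  rewrite /g1; case: i => [[y k] /= /andP[cxy /andP[k0 ltk]]] /=; rewrite val_insubd lex1 andbT.
  by rewrite defv (iffRL (rep_eqP repP _ _ n1) cxy) (rep_le_same repP) // k0.
have g2E i : val (g2 i) = fQ (val (val i).1).2 (val i).2.
  rewrite /g2; case: i => [[y k] /= /andP[cxy /andP[k0 ltk]]] /=; rewrite val_insubd lex1 andbT.
  by rewrite defv' (iffRL (rep_eqP repQ _ _ n1) (homo _ _ _ cxy)) (rep_le_same repQ) // k0.
have mkI y k : lconn (X := X) 1 x y -> 0 < k -> k < n.+2 -> exists i : Idx, val i = (y, k).
  move=> cxy k0 ltk; have h : lconn 1 x (y, k).1 && (0 < (y, k).2 < n.+2) by rewrite cxy k0.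
  by exists (exist (fun yk : X * nat => is_true (lconn 1 x yk.1 && (0 < yk.2 < n.+2))) (y, k) h).
apply: (poset_iso_common (f := g1) (g := g2)) => [q|q|i j].
- have /andP[le_vq _] := valP q; have [y [k [ltk eq_q]]] := rep_surj repP (val q).
  have k0 : 0 < k by move: le_vq; rewrite eq_q defv (rep_le repP) // => /andP[].
  have [|z z1 zk] := rep_comm repP (x := x) (y := y) n1 ltk k0.
    by rewrite -eq_q -defv /Order.comparable le_vq.
  have [|i ei] := mkI z k _ k0 ltk; first exact/(rep_eqP repP).
  by exists i; apply: val_inj; rewrite g1E ei /= zk.
- have /andP[le_vq _] := valP q; have [b [k [ltk eq_q]]] := rep_surj repQ (val q).
  have k0 : 0 < k by move: le_vq; rewrite eq_q defv' (rep_le repQ) // => /andP[].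
  have [|z z1 zk] := rep_comm repQ (x := (val x).2) (y := b) n1 ltk k0.
    by rewrite -eq_q -defv' /Order.comparable le_vq.
  have [y ey cxy] := @cover_lift _ C (fun i => i.+1 != 1) x z (iffLR (rep_eqP repQ _ _ n1) (esym z1)).
  have [i ei] := mkI y k cxy k0 ltk.
  by exists i; apply: val_inj; rewrite g2E ei /= ey zk.
rewrite -!Order.le_val !g1E !g2E.
case: i => [[y k] /= /andP[cxy /andP[k0 ltk]]]; case: j => [[z l] /= /andP[cxz /andP[l0 ltl]]] /=.
rewrite (rep_le repP) // (rep_le repQ) //; apply: cover_incident => //.
by apply: lconn_trans cxz; rewrite lconn_sym.
Qed.

End VertexFigure.

(** * Flags of the square tessellation *)

(* The flag at the vertex [(ux, uy)] whose face is the quadrant square towards the signs [usx],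
   [usy] ([true] is the negative direction) and whose edge is vertical iff [ue]. *)
Record uflag := UFlag { ux : int; uy : int; ue : bool; usx : bool; usy : bool }.

Local Open Scope ring_scope.

Definition sg (s : bool) : int := if s then -1 else 1.

Definition uadj (i : nat) (u : uflag) : uflag :=
  let: UFlag x y e sx sy := u in
  match i with
  | 0 => if e then UFlag x (y + sg sy) e sx (~~ sy) else UFlag (x + sg sx) y e (~~ sx) sy
  | 1 => UFlag x y (~~ e) sx sy
  | _ => if e then UFlag x y e (~~ sx) sy else UFlag x y e sx (~~ sy)
  end.

(** A cell is named by its lower left corner, whence the shift by one in negative directions. *)
Definition ucell (u : uflag) (k : nat) : cell :=
  let: UFlag x y e sx sy := u in
  match k with
  | 1 => ((x, false), (y, false))
  | 2 => if e then ((x, false), (y - sy%:Z, true)) else ((x - sx%:Z, true), (y, false))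
  | _ => ((x - sx%:Z, true), (y - sy%:Z, true))
  end.

Definition utr (t : int * int) (u : uflag) : uflag :=
  let: UFlag x y e sx sy := u in UFlag (x + t.1) (y + t.2) e sx sy.

Definition upar (u : uflag) : bool := ue u (+) usx u (+) usy u.

Definition uwalk (w : seq nat) (u : uflag) : uflag := foldl (fun u i => uadj i u) u w.

(** Vacuous at the levels 0 and 4, whose faces all flags share. *)
Definition sameu (k : nat) (u v : uflag) : Prop := (0 < k < 4)%N -> ucell u k = ucell v k.

Ltac ueq := congr UFlag; lia.
Ltac celleq := congr ((_, _), (_, _)); lia.

Lemma upar_uadj i u : upar (uadj i u) = ~~ upar u.
Proof. by case: i => [|[|i]]; case: u => [x y [] [] []]. Qed.

Lemma utr_uadj t i u : utr t (uadj i u) = uadj i (utr t u).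
Proof. by case: i => [|[|i]]; case: u => [x y [] [] []]; rewrite /= ?(addrAC _ _ t.1) ?(addrAC _ _ t.2). Qed.

Lemma utr_ucell t u k : ucell (utr t u) k = translate t (ucell u k).
Proof.
by case: k => [|[|[|k]]]; case: u => [x y [] sx sy]; rewrite /translate //=; celleq.
Qed.

Lemma utrD t s u : utr s (utr t u) = utr (t.1 + s.1, t.2 + s.2) u.
Proof. by case: u => *; rewrite /= !addrA. Qed.

Lemma utr_inj t s u : utr t u = utr s u -> t = s.
Proof.
by case: u => x y e sx sy [] /addrI e1 /addrI e2; case: t s e1 e2 => ? ? [? ?] /= -> ->.
Qed.

Lemma uwalk_cat w w' u : uwalk (w ++ w') u = uwalk w' (uwalk w u).
Proof. exact: foldl_cat. Qed.

Lemma uadj_sameu i u k : (i < 3)%N -> k != i.+1 -> sameu k u (uadj i u).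
Proof.
case: i => [|[|[|//]]] _; case: k => [|[|[|[|k]]]] // _ _;
  by case: u => [x y [] [] []]; rewrite /= /sg //=; celleq.
Qed.

Lemma sameu_trans k u v w : sameu k u v -> sameu k v w -> sameu k u w.
Proof. by move=> h1 h2 lk; rewrite h1 ?h2. Qed.

Lemma sameu_sym k u v : sameu k u v -> sameu k v u.
Proof. by move=> h lk; rewrite h. Qed.

Lemma sameu_utr k t u v : sameu k u v -> sameu k (utr t u) (utr t v).
Proof. by move=> h lk; rewrite !utr_ucell h. Qed.

(** Explicit words in the stabilisers. At a vertex, step 2 changes the sign transverse to the edge
    and its conjugate by step 1 the other sign; in a square, step 0 and its conjugate play these
    parts with the two directions exchanged. *)
Lemma sameu_walk k u v : (0 < k < 4)%N -> sameu k u v ->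
  exists2 w, all (fun i => (i < 3)%N && (i.+1 != k)) w & uwalk w u = v.
Proof.
move=> lk /(_ lk); case: u v => [x y e sx sy] [x' y' e' sx' sy'].
case: k lk => [|[|[|[|//]]]] // _ /=.
- case=> -> ->.
  exists ((if sx == sx' then [::] else if e then [:: 2] else [:: 1; 2; 1]) ++
          (if sy == sy' then [::] else if e then [:: 1; 2; 1] else [:: 2]) ++
          (if e == e' then [::] else [:: 1]))%N.
    by case: (sx == sx'); case: (sy == sy'); case: e e' => [] [].
  by case: e e' sx sx' sy sy' => [] [] [] [] [] [].
- case: e e' => [] [] //= [] e1 e2.
    exists ((if sy == sy' then [::] else [:: 0]) ++ (if sx == sx' then [::] else [:: 2]))%N.
      by case: (sy == sy'); case: (sx == sx').
    case: sx sx' sy sy' e1 e2 => [] [] [] [] /=; rewrite /sg => e1 e2; ueq.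
  exists ((if sx == sx' then [::] else [:: 0]) ++ (if sy == sy' then [::] else [:: 2]))%N.
    by case: (sy == sy'); case: (sx == sx').
  case: sx sx' sy sy' e1 e2 => [] [] [] [] /=; rewrite /sg => e1 e2; ueq.
- case=> e1 e2.
  exists ((if sx == sx' then [::] else if e then [:: 1; 0; 1] else [:: 0]) ++
          (if sy == sy' then [::] else if e then [:: 0] else [:: 1; 0; 1]) ++
          (if e == e' then [::] else [:: 1]))%N.
    by case: (sx == sx'); case: (sy == sy'); case: e e' => [] [].
  by case: e e' sx sx' sy sy' e1 e2 => [] [] [] [] [] [] /=; rewrite /sg => e1 e2; ueq.
Qed.

Lemma ucell_le u k l : (0 < k)%N -> (k <= l < 4)%N -> cell_le (ucell u k) (ucell u l).
Proof.
case: k => [|[|[|[|k]]]] // _; case: l => [|[|[|[|l]]]] // _;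
  by case: u => [x y [] sx sy]; rewrite /cell_le /itv_sub /=; lia.
Qed.

Lemma ucell_le_flag u k v l : (0 < k < 4)%N -> (0 < l < 4)%N ->
    cell_le (ucell u k) (ucell v l) ->
  (k <= l)%N /\ exists2 w, ucell u k = ucell w k & ucell w l = ucell v l.
Proof.
case: u v => [x y e sx sy] [x' y' e' sx' sy'].
case: k => [|[|[|[|//]]]] // _; case: l => [|[|[|[|//]]]] // _;
  rewrite /cell_le /itv_sub /=.
- by move=> h; split=> //; exists (UFlag x y e sx sy) => //=; celleq.
- move=> h; split=> //.
  (* A vertex at the lower end of an interval looks in the positive direction, at the upper end in
     the negative one. *)
  exists (UFlag x y e' (x != x' - sx'%:Z) (y != y' - sy'%:Z)) => //=.
  by case: e' h => /= h; celleq.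
- move=> h; split=> //.
  exists (UFlag x y e' (x != x' - sx'%:Z) (y != y' - sy'%:Z)) => //=; celleq.
- by case: e => /=; lia.
- move=> h; split=> //; exists (UFlag x y e sx sy) => //=.
  by case: e e' h => [] [] /= h; first [celleq | exfalso; lia].
- move=> h; split=> //.
  exists (UFlag x y e (if e then x != x' - sx'%:Z else sx)
                      (if e then sy else y != y' - sy'%:Z)).
    by case: e h.
  by case: e h => /= h; celleq.
- by lia.
- by case: e' => /=; lia.
- by move=> h; split=> //; exists (UFlag x y e sx sy) => //=; celleq.
Qed.

(** The vector with coordinates [k] along the edge of [u] and [l] across it, towards the square of
    [u]. *)
Definition dvec (u : uflag) (k l : int) : int * int :=
  if ue u then (l * sg (usx u), k * sg (usy u)) else (k * sg (usx u), l * sg (usy u)).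

Definition tword (k l : nat) : seq nat :=
  flatten (nseq k [:: 0; 1; 2; 1]%N) ++ flatten (nseq l [:: 1; 0; 1; 2]%N).

Lemma tword_all k l : all (fun i => i < 3)%N (tword k l).
Proof.
rewrite all_cat; apply/andP; split.
  by elim: k => //= k IH; rewrite IH.
by elim: l => //= l IH; rewrite IH.
Qed.

Lemma tword_even k l : ~~ odd (size (tword k l)).
Proof.
rewrite size_cat oddD; have ev w j : odd (size (flatten (nseq j w) : seq nat)) = odd (j * size w).
  by elim: j => //= j IH; rewrite size_cat oddD IH mulSn oddD.
by rewrite !ev !oddM /= !andbF.
Qed.

Lemma uwalk_tword k l u : uwalk (tword k l) u = utr (dvec u k%:Z l%:Z) u.
Proof.
have w1 j v : uwalk (flatten (nseq j [:: 0; 1; 2; 1]%N)) v = utr (dvec v j%:Z 0) v.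
  elim: j v => [|j IH] v; first by case: v => [x y [] [] []]; rewrite /dvec /=; ueq.
  rewrite /= IH; case: v => [x y [] [] []]; rewrite /dvec /= /sg; ueq.
have w2 j v : uwalk (flatten (nseq j [:: 1; 0; 1; 2]%N)) v = utr (dvec v 0 j%:Z) v.
  elim: j v => [|j IH] v; first by case: v => [x y [] [] []]; rewrite /dvec /=; ueq.
  rewrite /= IH; case: v => [x y [] [] []]; rewrite /dvec /= /sg; ueq.
by rewrite uwalk_cat w1 w2; case: u => [x y [] [] []]; rewrite /dvec /= /sg; ueq.
Qed.

Definition u0 := UFlag 0 0 false false false.

(** The signs are first turned towards the target, so that translation words with natural exponents
    reach it. *)
Lemma uwalk_conn u : exists2 w, all (fun i => i < 3)%N w & uwalk w u0 = u.
Proof.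
case: u => x y e sx sy.
have [|w1 w1A w1E] := @sameu_walk 1 u0 (UFlag 0 0 false (x < 0) (y < 0)) isT; first by [].
have [|w2 w2A w2E] := @sameu_walk 1 (UFlag x y false (x < 0) (y < 0)) (UFlag x y e sx sy) isT.
  by [].
exists (w1 ++ tword (absz x) (absz y) ++ w2).
  rewrite all_cat (all_cat _ (tword _ _)) tword_all andTb; apply/andP.
  by split; [apply: sub_all w1A | apply: sub_all w2A] => i /andP[].
rewrite uwalk_cat (uwalk_cat (tword _ _)) w1E uwalk_tword -w2E; congr uwalk.
by rewrite /dvec /= /sg; congr UFlag; case: ifP; lia.
Qed.

Section Lattice.
Variables b c : nat.
Local Notation lat := (in_lattice b c).

Lemma lattice_rot t : lat t -> lat (- t.2, t.1).
Proof. by case=> k [l ->]; exists (- l), k => /=; congr pair; lia. Qed.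

(** The frames of even flags are the quarter turns of the standard frame, under which the lattice is
    stable; those of odd flags are their mirror images. *)
Lemma dvec_lattice u : ~~ upar u -> lat (dvec u b%:Z c%:Z).
Proof.
have h1 : lat (b%:Z, c%:Z) by exists 1, 0; congr pair; lia.
have h2 := lattice_rot h1; have h3 := lattice_rot h2; have h4 := lattice_rot h3.
rewrite /upar /dvec; case: u => [x y [] [] []] //= _; rewrite /sg ?mulr1 ?mulrN1 //.
by move: h4; rewrite /= !opprK.
Qed.

Lemma dvec_nlattice u : ~ lat (b%:Z, - c%:Z) -> upar u -> ~ lat (dvec u b%:Z c%:Z).
Proof.
move=> nlat; rewrite /upar /dvec.
case: u => [x y [] [] []] //= _; rewrite /sg ?mulr1 ?mulrN1 => h; apply: nlat.
- by move: (lattice_rot h); rewrite /= opprK.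
- by move: (lattice_rot (lattice_rot (lattice_rot h))); rewrite /= opprK.
- by move: (lattice_rot (lattice_rot h)); rewrite /= opprK.
- exact: h.
Qed.

Definition tface (u : uflag) (k : nat) : torus_map b c :=
  match k with
  | 0 => None
  | 1 | 2 | 3 => Some (Some (\pi_(torus_cell b c)%qT (ucell u k)))
  | _ => Some None
  end.

Lemma pi_cellP (x y : cell) :
  \pi_(torus_cell b c)%qT x = \pi_(torus_cell b c)%qT y <->
  exists2 t, lat t & y = translate t x.
Proof.
split; first exact: cell_equivP.
by move=> h; apply/(@eqmodP _ (cell_equiv_rel b c))/asboolP.
Qed.

Lemma tface_mid u k : (0 < k < 4)%N -> tface u k = Some (Some (\pi_(torus_cell b c)%qT (ucell u k))).
Proof. by case: k => [|[|[|[|]]]]. Qed.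

Lemma tface_utr t u k : lat t -> tface (utr t u) k = tface u k.
Proof.
move=> tL; case: k => [|[|[|[|k]]]] //; rewrite /tface; congr (Some (Some _));
  apply/esym/pi_cellP; exists t => //; exact: utr_ucell.
Qed.

(** The right-hand side is that of [emb_incident], so the torus and the facet have the same
    incidence between plane flags. *)
Lemma tface_leP u v k l : (k < 5)%N -> (l < 5)%N -> (tface u k <= tface v l)%O <->
  (k <= l)%N /\ exists w t, [/\ lat t, sameu k u w & sameu l w (utr t v)].
Proof.
move=> ltk ltl; have l0 := lattice0 b c.
have ut0 w : utr (0, 0) w = w by case: w => *; rewrite /= !addr0.
have [k0|k_gt0] := posnP k.
  by subst k; split=> // _; split=> //; exists v, (0, 0); split; rewrite ?ut0.
have [k4|k_lt4] := leqP 4 k.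
  have -> : k = 4%N by lia.
  split=> [|[le_l _]]; last by have -> : l = 4%N by lia.
  by case: l {ltl} => [|[|[|[|l]]]] // _; split=> //; exists u, (0, 0).
have [l00|l_gt0] := posnP l.
  by rewrite l00 tface_mid ?k_gt0 //; split=> // -[]; lia.
have [l4|l_lt4] := leqP 4 l.
  have -> : l = 4%N by lia.
  rewrite tface_mid ?k_gt0 //; split=> // _; split; first lia.
  by exists u, (0, 0); split.
rewrite !tface_mid ?k_gt0 ?l_gt0 //.
split=> [/asboolP[x [y [/pi_cellP[t tL ->] /pi_cellP[s sL ->] le_xy]]] | [kl [w [t [tL sk sl]]]]].
  pose t' := (s.1 - t.1, s.2 - t.2).
  have t'L : lat t' by apply: (latticeD sL (latticeN tL)).
  have : cell_le (ucell u k) (ucell (utr t' v) l).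
    rewrite utr_ucell -(cell_le_translate t) translateD /=.
    by rewrite !subrK; case: (s) le_xy.
  case/ucell_le_flag; rewrite ?k_gt0 ?l_gt0 // => kl [w e1 e2]; split=> //.
  by exists w, t'; split=> // _.
apply/asboolP; exists (ucell w k), (ucell w l); split.
- by rewrite sk ?k_gt0.
- by apply/pi_cellP; exists t; rewrite // -utr_ucell sl ?l_gt0.
- by apply: ucell_le; rewrite ?kl.
Qed.

Lemma tface_surj (q : torus_map b c) : exists u k, (k < 5)%N /\ q = tface u k.
Proof.
case: q => [[q|]|]; [|by exists u0, 4%N|by exists u0, 0%N].
case eq_q: (repr q) => [[i e] [j f]].
(* The level of a cell is its dimension plus one, and an edge is vertical exactly when [f] holds. *)
exists (UFlag i j f false false), (1 + e + f)%N; split; first by case: e f {eq_q} => [] [].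
rewrite tface_mid; last by case: e f {eq_q} => [] [].
rewrite -[q]reprK eq_q; congr (Some (Some (\pi_(torus_cell b c)%qT _))).
by case: e f {eq_q} => [] []; rewrite /= ?subr0.
Qed.

End Lattice.

Local Close Scope ring_scope.

(** * Facets covered by the square tessellation *)

Section TorusFacet.
Variables (X : maniplex 4) (P : polytope 4) (f : X -> nat -> P).
Hypothesis repP : represents f.
Variables (x : X) (F : P).
Hypothesis defF : F = f x 4.
Variables (b c : nat) (emb : uflag -> X).
Hypothesis emb_adj : forall i u, i < 3 -> emb (uadj i u) = adj i (emb u).
Hypothesis emb_base : lconn 4 x (emb u0).
Hypothesis emb_ker : forall u v, emb u = emb v <-> exists2 t, in_lattice b c t & u = utr t v.
Local Notation lat := (in_lattice b c).

Lemma emb_walk w u : all (fun i => i < 3) w -> emb (uwalk w u) = walk w (emb u).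
Proof. by elim: w u => //= i w IH u /andP[lt_i3 /IH->]; rewrite emb_adj. Qed.

Lemma emb_facet u : lconn 4 x (emb u).
Proof.
have [w wA <-] := uwalk_conn u; apply: lconn_trans emb_base _; rewrite emb_walk //.
by apply: walk_conn; apply: sub_all wA => i; lia.
Qed.

Lemma emb_surj y : lconn 4 x y -> exists u, y = emb u.
Proof.
move=> cxy; have: lconn 4 (emb u0) y by apply: lconn_trans cxy; rewrite lconn_sym.
apply: (conn_inv (R := fun y => exists u, y = emb u)); first by exists u0.
by move=> i z lt_i4 ne [u ->]; exists (uadj i u); rewrite emb_adj //; lia.
Qed.

Lemma emb_lconn k u v : k < 5 ->
  lconn k (emb u) (emb v) <-> exists2 t, lat t & sameu k u (utr t v).
Proof.
move=> ltk; split=> [cuv | [t tL suv]].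
  have : conn (@adj _ X) 4 (fun i => ~~ ((i.+1 == k) || (i.+1 == 4))) (emb u) (emb v).
    apply: (adj_pip (K := fun j => (j == k) || (j == 4))) => j /orP[] /eqP-> //.
    by apply: (@lconn_trans _ _ _ x); rewrite ?emb_facet // lconn_sym emb_facet.
  suff h y : conn (@adj _ X) 4 (fun i => ~~ ((i.+1 == k) || (i.+1 == 4))) (emb u) y ->
      exists2 u', y = emb u' & sameu k u u'.
    case/h => u' /esym/emb_ker[t tL eu']; rewrite eu' => suv.
    by exists t.
  apply: (conn_inv (R := fun y => exists2 u', y = emb u' & sameu k u u')); first by exists u.
  move=> i z lt_i4 ne [u' -> suu']; exists (uadj i u'); first by rewrite emb_adj //; lia.
  by apply: sameu_trans suu' _; apply: uadj_sameu; lia.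
have -> : emb v = emb (utr t v) by apply/esym/emb_ker; exists t.
have [k_mid|k_out] := boolP (0 < k < 4); last first.
  have [->|->] : k = 0 \/ k = 4 by lia.
    exact: lconn_out.
  by apply: (@lconn_trans _ _ _ x); rewrite ?emb_facet // lconn_sym emb_facet.
have [w wA <-] := sameu_walk k_mid suv.
rewrite emb_walk; last by apply: sub_all wA => i /andP[].
by apply: walk_conn; apply: sub_all wA => i; lia.
Qed.

Lemma emb_incident k l u v : k < 5 -> l < 5 -> incident k (emb u) l (emb v) <->
  k <= l /\ exists w t, [/\ lat t, sameu k u w & sameu l w (utr t v)].
Proof.
move=> ltk ltl; split=> [/incidentP[z [kl c1 c2]] | [kl [w [t [tL s1 s2]]]]]; last first.
  apply/incidentP; exists (emb w); split=> //; apply/emb_lconn => //; last by exists t.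
  by exists (0, 0)%R; [apply: lattice0 | case: w s1 {s2} => *; rewrite /= !addr0].
split=> //; have [z' [cz cz']] := lconn_split c2.
have [w eq_w] : exists w, z' = emb w.
  by apply: emb_surj; apply: lconn_trans (emb_facet v) _; rewrite lconn_sym; apply: cz'.
have /emb_lconn-/(_ ltk)[t tL s1] : lconn k (emb u) (emb w).
  by rewrite -eq_w; apply: lconn_trans c1 (cz _ kl).
have /emb_lconn-/(_ ltl)[s sL s2] : lconn l (emb w) (emb v) by rewrite -eq_w; apply: cz'.
exists (utr t w), (s.1 + t.1, s.2 + t.2)%R; split=> //; first exact: latticeD.
by rewrite -utrD; apply: sameu_utr.
Qed.

Lemma facet_torus_iso : poset_iso (facet F) (torus_map b c).
Proof.
pose g1 (i : uflag * 'I_5) : facet F := insubd (\top%O : facet F) (f (emb i.1) i.2).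
have g1E i : val (g1 i) = f (emb i.1) i.2.
  rewrite /g1 val_insubd le0x defF (_ : f x 4 = f (emb i.1) 4).
    have lti := ltn_ord i.2.
    by have -> : (f (emb i.1) i.2 <= f (emb i.1) 4)%O by rewrite (rep_le_same repP) //; lia.
  by apply/(rep_eqP repP) => //; apply: emb_facet.
apply: (poset_iso_common (f := g1) (g := fun i => tface b c i.1 i.2)) => [q|q|[u k] [v l]].
- have [y [k [ltk eq_q]]] := rep_surj (facet_represents repP defF) q.
  have [u eq_y] := emb_surj (valP y).
  exists (u, Ordinal (ltk : k < 5)); apply: val_inj.
  by rewrite g1E eq_q val_facet_face //= eq_y.
- by have [u [k [ltk ->]]] := tface_surj q; exists (u, Ordinal ltk).
have ltk := ltn_ord k; have ltl := ltn_ord l.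
rewrite -Order.le_val !g1E /= (rep_le repP _ _ (ltnW ltk) (ltnW ltl)).
apply/idP/idP => [/(emb_incident _ _ ltk ltl) h | /(tface_leP _ _ _ _ ltk ltl) h].
  exact/(tface_leP _ _ _ _ ltk ltl).
exact/(emb_incident _ _ ltk ltl).
Qed.

Local Notation T := (facet_maniplex x).
Local Notation repF := (facet_represents repP defF).

Lemma val_facet_walk w (y : T) : all (fun i => i < 3) w -> val (walk w y) = walk w (val y).
Proof. by elim: w y => //= i w IH y /andP[lt_i3 /IH->]; rewrite /= val_fadj. Qed.

(* Automorphisms commute with walks, so the translation word of [(b, c)], which fixes [y], would
   fix the adjacent flag [a y], where it acts as the translation by a mirror image of [(b, c)]. *)
Lemma facet_no_refl (a : T -> T) i y : ~ lat (b%:Z, - c%:Z)%R -> maut a -> i < 3 ->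
  a y <> adj i y.
Proof.
move=> nlat aA lt_i3 e; have [u eq_u] := emb_surj (valP y).
have wA := tword_all b c.
have fixP z v : val z = emb v -> walk (X := T) (tword b c) z = z <-> lat (dvec v b%:Z c%:Z)%R.
  move=> ez; have -> : walk (X := T) (tword b c) z = z <-> emb (uwalk (tword b c) v) = emb v.
    rewrite emb_walk // -ez -(val_facet_walk _ wA).
    by split=> [-> //|]; apply: val_inj.
  rewrite uwalk_tword; split=> [/emb_ker[t tL /utr_inj->] // | dL].
  by apply/emb_ker; eexists; first exact: dL.
have ev : val (adj i y : T) = emb (uadj i u) by rewrite /= val_fadj // eq_u emb_adj.
have same : walk (X := T) (tword b c) y = y <-> walk (X := T) (tword b c) (adj i y) = adj i y.
  rewrite -e -walk_aut //; split=> [-> //|]; exact: aut_inj.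
have [pu|pu] := boolP (upar u).
  apply: (dvec_nlattice nlat pu); apply/(fixP _ _ eq_u)/same/(fixP _ _ ev).
  by apply: dvec_lattice; rewrite upar_uadj negbK.
apply: (@dvec_nlattice b c (uadj i u) nlat); first by rewrite upar_uadj.
by apply/(fixP _ _ ev)/same/(fixP _ _ eq_u); apply: dvec_lattice.
Qed.

Lemma facet_chiral (col : X -> bool) : ~ lat (b%:Z, - c%:Z)%R ->
    (forall i y, i < 4 -> col (adj i y) = ~~ col y) ->
    (forall y z, col y = col z -> exists2 a : X -> X, maut a & a y = z) ->
  chiral (facet F).
Proof.
move=> nlat col_adj trans.
apply: (chiral_crit repF (col := fun y => col (val y))) => //.
- by move=> i y lt_i3; rewrite /= val_fadj // col_adj // ltnW.
- move=> y z /trans[a aA ayz].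
  have aT (t : T) : lconn 4 x (a (val t)).
    apply: lconn_trans (valP z) _; rewrite -ayz aut_lconnE //.
    by apply: lconn_trans (valP t); rewrite lconn_sym (valP y).
  exists (fun t => exist (fun y : X => is_true (lconn 4 x y)) _ (aT t) : facetT x).
    by move=> i t lt_i3; apply: val_inj; rewrite /= !val_fadj // aA // ltnW.
  exact: val_inj.
- by move=> a i y aA lt_i3; apply: facet_no_refl.
Qed.

(** Symmetries of the tessellation that normalise the lattice, hence descend to the torus. *)
Definition usym (h : uflag -> uflag) :=
  (forall i u, i < 3 -> h (uadj i u) = uadj i (h u)) /\
  (forall t u, lat t -> exists2 s, lat s & h (utr t u) = utr s (h u)).

Lemma facet_regular : (forall u v, exists2 h, usym h & h u = v) -> regular (facet F).
Proof.
move=> sym; apply: (regular_crit repF) => y z.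
have [u eq_y] := emb_surj (valP y); have [v eq_z] := emb_surj (valP z).
have [h [h_adj h_lat] huv] := sym u v.
have /choice[a aP] (t : T) : exists t' : T, forall u', val t = emb u' -> val t' = emb (h u').
  have [u1 eq_t] := emb_surj (valP t).
  exists (exist (fun y : X => is_true (lconn 4 x y)) _ (emb_facet (h u1)) : facetT x) => u2 /=.
  rewrite eq_t => /emb_ker[s sL ->]; have [s' s'L ->] := h_lat _ u2 sL.
  by apply/emb_ker; exists s'.
exists a; last by apply: val_inj; rewrite (aP _ _ eq_y) huv eq_z.
move=> i t lt_i3; apply: val_inj; have [u1 eq_t] := emb_surj (valP t).
rewrite [RHS]val_fadj // (aP _ _ eq_t) -emb_adj // -h_adj //; apply: aP.
by rewrite /= val_fadj // eq_t emb_adj.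
Qed.

End TorusFacet.

(** * Regularity of the torus of a square lattice parallel to the axes *)

Section SquareLattice.
Variable m : nat.
Local Open Scope ring_scope.

Lemma lattice_squareP t : in_lattice m 0 t <-> exists k l : int, t = (k * m%:Z, l * m%:Z).
Proof. by split=> -[k [l ->]]; exists k, l; congr pair; lia. Qed.

Definition uflip (fx fy : bool) (u : uflag) : uflag :=
  let: UFlag x y e sx sy := u in UFlag (x * sg fx) (y * sg fy) e (sx (+) fx) (sy (+) fy).

Definition uswap (u : uflag) : uflag :=
  let: UFlag x y e sx sy := u in UFlag y x (~~ e) sy sx.

Lemma usym_flip fx fy : usym m 0 (uflip fx fy).
Proof.
split=> [i [x y e sx sy] _ | t [x y e sx sy] /lattice_squareP[k [l ->]]].
  case: i => [|[|i]]; case: e; case: sx; case: sy; case: fx; case: fy; rewrite /= /sg;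
  congr UFlag; lia.
exists (k * sg fx * m%:Z, l * sg fy * m%:Z).
  by apply/lattice_squareP; exists (k * sg fx), (l * sg fy).
by rewrite /=; case: fx; case: fy; rewrite /sg; congr UFlag; lia.
Qed.

Lemma usym_swap : usym m 0 uswap.
Proof.
split=> [i [x y e sx sy] _ | t [x y e sx sy] /lattice_squareP[k [l ->]]].
  by case: i => [|[|i]]; case: e.
by exists (l * m%:Z, k * m%:Z) => //; apply/lattice_squareP; exists l, k.
Qed.

Lemma usym_utr s : usym m 0 (utr s).
Proof.
split=> [i u _ | t u tL]; first exact: utr_uadj.
by exists t => //; rewrite !utrD; congr (utr (_, _) _); apply: addrC.
Qed.

Lemma usym_comp h h' : usym m 0 h -> usym m 0 h' -> usym m 0 (h' \o h).
Proof.
move=> [h1 h2] [h1' h2']; split=> [i u lt_i | t u tL] /=; first by rewrite h1 ?h1'.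
by have [s sL ->] := h2 t u tL; apply: h2'.
Qed.

(** Sign changes and translations reach all flags with the same edge direction; the exchange of
    coordinates changes the direction. *)
Lemma usym_trans u v : exists2 h, usym m 0 h & h u = v.
Proof.
have frame w : ue w = ue v -> exists2 h, usym m 0 h & h w = v.
  case: w => x y e sx sy /= ->; pose h := uflip (sx (+) usx v) (sy (+) usy v).
  exists (utr (ux v - x * sg (sx (+) usx v), uy v - y * sg (sy (+) usy v)) \o h).
    exact: usym_comp (usym_flip _ _) (usym_utr _).
  rewrite /h /=; case: v {h} => x' y' e' sx' sy' /=.
  by congr UFlag; rewrite ?addKb //; lia.
have [/frame //|ne] := eqVneq (ue u) (ue v).
have [|h hS hE] := frame (uswap u).
  by case: u ne => x y [] sx sy /=; case: (ue v).
by exists (h \o uswap) => //; apply: usym_comp usym_swap hS.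
Qed.

End SquareLattice.

Local Open Scope ring_scope.

(** * Elements of PSL_2 *)

Section Mat2.
Variable R : comNzRingType.

Definition mat2 (a b c d : R) : 'M[R]_2 :=
  \matrix_(i, j) if i == 0 then (if j == 0 then a else b) else (if j == 0 then c else d).

Lemma mat2M a b c d a' b' c' d' : mat2 a b c d *m mat2 a' b' c' d' =
  mat2 (a * a' + b * c') (a * b' + b * d') (c * a' + d * c') (c * b' + d * d').
Proof.
by apply/matrixP => i j; rewrite !mxE big_ord_recl big_ord1 !mxE /=; case: eqP; case: eqP.
Qed.

Lemma mat2_eta (A : 'M[R]_2) : A = mat2 (A 0 0) (A 0 1) (A 1 0) (A 1 1).
Proof.
apply/matrixP => i j; rewrite !mxE.
have c2 (k : 'I_2) : (k != 0) -> k = 1 by case: k => -[|[|//]] ? //= _; apply: val_inj.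
by have [->|/c2->] := eqVneq i 0; have [->|/c2->] := eqVneq j 0.
Qed.

Lemma det_mat2 a b c d : \det (mat2 a b c d) = a * d - b * c.
Proof.
rewrite (expand_det_row _ 0) big_ord_recl big_ord1 /cofactor !det_mx11 !mxE /=.
by rewrite expr0 expr1 mul1r mulN1r mulrN.
Qed.

Lemma mat2_inj a b c d a' b' c' d' : mat2 a b c d = mat2 a' b' c' d' ->
  [/\ a = a', b = b', c = c' & d = d'].
Proof.
move=> /matrixP e; have := e 0 0; have := e 0 1; have := e 1 0; have := e 1 1.
by rewrite !mxE /= => -> -> -> ->.
Qed.

Lemma mat2_1 : mat2 1 0 0 1 = 1%:M.
Proof.
apply/matrixP => i j; rewrite !mxE.
by case: i j => -[|[|//]] ? [[|[|//]] ?].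
Qed.

End Mat2.

Section L2Elements.
Variable F : finFieldType.

(* [SL2F 'F_p] is convertible to [SL2 p]; over an abstract field unification stays tractable. *)
Definition SL2F : {set {'GL_2[F]}} := [set A | \det (GLval A) == 1].

Lemma group_set_SL2F : group_set SL2F.
Proof.
apply/group_setP; split=> [|A B]; rewrite !inE; first by rewrite GL_1E det1.
by rewrite GL_MxE det_mulmx => /eqP-> /eqP->; rewrite mulr1.
Qed.

Canonical SL2F_group := Group group_set_SL2F.

Definition L2F := (SL2F / 'Z(SL2F))%g.

Canonical L2F_group := [group of L2F].

Implicit Types a b c d x y : F.

(** Total in the entries, with value 1 on singular matrices; the lemmas carry the determinant as a
    hypothesis. *)
Definition gl2 a b c d : {'GL_2[F]} := insubd (1%g : {'GL_2[F]}) (mat2 a b c d).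
Definition E a b c d : coset_of 'Z(SL2F) := coset 'Z(SL2F) (gl2 a b c d).

Lemma val_gl2 a b c d : a * d - b * c = 1 -> GLval (gl2 a b c d) = mat2 a b c d.
Proof.
move=> dt; rewrite /gl2 /insubd insubT //.
by rewrite -[_ \is a _]/(_ \in unitmx) unitmxE det_mat2 dt unitr1.
Qed.

Opaque gl2.

Lemma gl2_SL a b c d : a * d - b * c = 1 -> gl2 a b c d \in SL2F.
Proof. by move=> dt; rewrite inE val_gl2 // det_mat2 dt. Qed.

Lemma det2M a b c d a' b' c' d' : a * d - b * c = 1 -> a' * d' - b' * c' = 1 ->
  (a * a' + b * c') * (c * b' + d * d') - (a * b' + b * d') * (c * a' + d * c') = 1.
Proof.
move=> dt dt'.
have -> : (a * a' + b * c') * (c * b' + d * d') - (a * b' + b * d') * (c * a' + d * c') =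
  (a * d - b * c) * (a' * d' - b' * c') by ring.
by rewrite dt dt' mulr1.
Qed.

Lemma gl2_inj a b c d a' b' c' d' : a * d - b * c = 1 -> a' * d' - b' * c' = 1 ->
  gl2 a b c d = gl2 a' b' c' d' -> [/\ a = a', b = b', c = c' & d = d'].
Proof.
move=> dt dt' e; apply: mat2_inj.
exact: etrans (esym (val_gl2 dt)) (etrans (congr1 (@GLval _ _) e) (val_gl2 dt')).
Qed.

Lemma gl2M a b c d a' b' c' d' : a * d - b * c = 1 -> a' * d' - b' * c' = 1 ->
  (gl2 a b c d * gl2 a' b' c' d')%g =
  gl2 (a * a' + b * c') (a * b' + b * d') (c * a' + d * c') (c * b' + d * d').
Proof.
move=> dt dt'.
apply: val_inj; apply: etrans (GL_MxE _ _) _.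
apply: etrans (congr2 mulmx (val_gl2 dt) (val_gl2 dt')) _.
exact: etrans (mat2M a b c d a' b' c' d') (esym (val_gl2 (det2M dt dt'))).
Qed.

Lemma SL2_gl2 (A : {'GL_2[F]}) : A \in SL2F ->
  exists a b c d, a * d - b * c = 1 /\ A = gl2 a b c d.
Proof.
rewrite inE => /eqP dA; have eA := mat2_eta (GLval A); set a := GLval A 0 0 in eA.
set b := GLval A 0 1 in eA; set c := GLval A 1 0 in eA; set d := GLval A 1 1 in eA.
have dt : a * d - b * c = 1 by rewrite -det_mat2 -eA.
by exists a, b, c, d; split=> //; apply: val_inj; rewrite [RHS]val_gl2.
Qed.

Lemma E_congr a b c d a' b' c' d' : a = a' -> b = b' -> c = c' -> d = d' ->
  E a b c d = E a' b' c' d'.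
Proof. by move=> -> -> -> ->. Qed.

Lemma gl2_congr a b c d a' b' c' d' : a = a' -> b = b' -> c = c' -> d = d' ->
  gl2 a b c d = gl2 a' b' c' d'.
Proof. by move=> -> -> -> ->. Qed.

Lemma SL2_norm : SL2F \subset 'N('Z(SL2F))%g.
Proof. exact: normal_norm (center_normal _). Qed.

Lemma E_mul a b c d a' b' c' d' : a * d - b * c = 1 -> a' * d' - b' * c' = 1 ->
  (E a b c d * E a' b' c' d')%g =
  E (a * a' + b * c') (a * b' + b * d') (c * a' + d * c') (c * b' + d * d').
Proof.
move=> dt dt'; have N1 := subsetP SL2_norm _ (gl2_SL dt); have N2 := subsetP SL2_norm _ (gl2_SL dt').
exact: etrans (esym (morphM _ N1 N2)) (congr1 (coset _) (gl2M dt dt')).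
Qed.

Lemma E_one : E 1 0 0 1 = 1%g.
Proof.
rewrite /E (_ : gl2 1 0 0 1 = 1%g) ?morph1 //.
by apply: val_inj; rewrite [LHS]val_gl2 ?mulr1 ?mulr0 ?subr0 // mat2_1.
Qed.

Lemma E_inv a b c d : a * d - b * c = 1 -> (E a b c d)^-1%g = E d (- b) (- c) a.
Proof.
move=> dt; have dt' : d * a - (- b) * (- c) = 1 by rewrite -dt; ring.
apply/eqP; rewrite eq_invg_mul (E_mul dt dt').
have -> : a * d + b * - c = 1 by rewrite -dt; ring.
have -> : c * - b + d * a = 1 by rewrite -dt; ring.
have -> : a * - b + b * a = 0 by ring.
have -> : c * d + d * - c = 0 by ring.
by rewrite E_one.
Qed.

Lemma E_L2 a b c d : a * d - b * c = 1 -> E a b c d \in L2F.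
Proof. by move=> dt; apply: mem_quotient; apply: gl2_SL. Qed.

Lemma L2_E z : z \in L2F -> exists a b c d, a * d - b * c = 1 /\ z = E a b c d.
Proof.
case/morphimP => A _ /SL2_gl2[a [b [c [d [dt ->]]]]] ->.
by exists a, b, c, d.
Qed.

(** It is enough to commute with one transvection and with the rotation of order 4, whose matrix has
    rows $(0,-1)$ and $(1,0)$. *)
Lemma center_gl2 a b c d : a * d - b * c = 1 -> gl2 a b c d \in 'Z(SL2F)%g -> [/\ b = 0, c = 0 & a = d].
Proof.
move=> dt /centerP[_ comm].
have dt1 : 1 * 1 - 1 * 0 = 1 :> F by ring.
have dt3 : 0 * 0 - (- 1) * 1 = 1 :> F by ring.
have [e1 e2 _ _] := gl2_inj (det2M dt dt1) (det2M dt1 dt)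
  (etrans (esym (gl2M dt dt1)) (etrans (comm _ (gl2_SL dt1)) (gl2M dt1 dt))).
have [f1 _ _ _] := gl2_inj (det2M dt dt3) (det2M dt3 dt)
  (etrans (esym (gl2M dt dt3)) (etrans (comm _ (gl2_SL dt3)) (gl2M dt3 dt))).
have c0 : c = 0.
  have -> : c = (1 * a + 1 * c) - (a * 1 + b * 0) by ring.
  by rewrite e1 subrr.
have b0 : b = 0.
  have -> : b = (a * 0 + b * 1) - (0 * a + -1 * c) - c by ring.
  by rewrite f1 subrr c0 subr0.
split=> //; have -> : a = (a * 1 + b * 1) - b by ring.
by rewrite e2 b0; ring.
Qed.

Lemma E_neg a b c d : a * d - b * c = 1 -> E (- a) (- b) (- c) (- d) = E a b c d.
Proof.
move=> dt; have dtN : (-1) * (-1) - 0 * 0 = 1 :> F by ring.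
have E_N1 : E (-1) 0 0 (-1) = 1%g.
  apply: coset_id; apply/centerP; split=> [|B /SL2_gl2[a' [b' [c' [d' [dt' ->]]]]]]; first exact: gl2_SL.
  apply: etrans (gl2M dtN dt') (etrans _ (esym (gl2M dt' dtN))); apply: gl2_congr; ring.
rewrite -[RHS]mul1g -E_N1 (E_mul dtN dt); apply: E_congr; ring.
Qed.

Lemma E_eq1 a b c d : a * d - b * c = 1 -> E a b c d = 1%g -> [/\ b = 0, c = 0 & a = d].
Proof.
move=> dt /coset_idr h; apply: center_gl2 => //; apply: h.
by apply: (subsetP SL2_norm); apply: gl2_SL.
Qed.

End L2Elements.

Arguments E {F} (a b c d)%_R.
#[global] Opaque gl2 E.

Local Close Scope ring_scope.

Local Open Scope ring_scope.

(** * Cube flags *)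

Inductive ord3 := O012 | O021 | O102 | O120 | O201 | O210.

(* A flag of the 3-cube: a vertex and the order in which the axes are adjoined to it. *)
Record vflag := VFlag { vb0 : bool; vb1 : bool; vb2 : bool; vord : ord3 }.

Definition first_axis o := match o with O012 | O021 => 0 | O102 | O120 => 1 | _ => 2 end%N.
Definition swap01 o := match o with
  O012 => O102 | O102 => O012 | O021 => O201 | O201 => O021 | O120 => O210 | O210 => O120 end.
Definition swap12 o := match o with
  O012 => O021 | O021 => O012 | O102 => O120 | O120 => O102 | O201 => O210 | O210 => O201 end.

(* The indices 1, 2, 3 are those of the vertex-figure of a 4-polytope. *)
Definition vadj (i : nat) (v : vflag) : vflag :=
  let: VFlag b0 b1 b2 o := v in
  match i with
  | 1 => match first_axis o with
         | 0 => VFlag (~~ b0) b1 b2 o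
         | 1 => VFlag b0 (~~ b1) b2 o
         | _ => VFlag b0 b1 (~~ b2) o
         end
  | 2 => VFlag b0 b1 b2 (swap01 o)
  | _ => VFlag b0 b1 b2 (swap12 o)
  end%N.

Definition vwalk (w : seq nat) (v : vflag) : vflag := foldl (fun v i => vadj i v) v w.

(** A chosen word from the flag at the vertex 000 with axis order 012 to [v]. *)
Definition vword (v : vflag) : seq nat :=
  let: VFlag b0 b1 b2 o := v in
  ((if b0 then [:: 1] else [::]) ++ (if b1 then [:: 2; 1; 2] else [::]) ++
   (if b2 then [:: 3; 2; 1; 2; 3] else [::]) ++
   match o with
   | O012 => [::] | O102 => [:: 2] | O021 => [:: 3] | O201 => [:: 3; 2]
   | O120 => [:: 2; 3] | O210 => [:: 2; 3; 2]
   end)%N.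

Lemma vword_size i v : (0 < i < 4)%N -> odd (size (vword (vadj i v))) = ~~ odd (size (vword v)).
Proof. by case: i => [|[|[|[|//]]]] // _; case: v => [] [] [] [] []. Qed.

(* [Z8] is [Z[zeta]] with [zeta ^ 4 = -1], in the basis of powers of [zeta]. *)
Definition Z8 : Type := (int * int * int * int)%type.
Definition z8add (x y : Z8) : Z8 :=
  let: (a, b, c, d) := x in let: (a', b', c', d') := y in (a + a', b + b', c + c', d + d').
Definition z8opp (x : Z8) : Z8 := let: (a, b, c, d) := x in (- a, - b, - c, - d).
Definition z8mul (x y : Z8) : Z8 :=
  let: (a, b, c, d) := x in let: (a', b', c', d') := y in
  (a * a' - b * d' - c * c' - d * b', a * b' + b * a' - c * d' - d * c',
   a * c' + b * b' + c * a' - d * d', a * d' + b * c' + c * b' + d * a').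

Definition M8 : Type := (Z8 * Z8 * Z8 * Z8)%type.
Definition m8mul (x y : M8) : M8 :=
  let: (a, b, c, d) := x in let: (a', b', c', d') := y in
  (z8add (z8mul a a') (z8mul b c'), z8add (z8mul a b') (z8mul b d'),
   z8add (z8mul c a') (z8mul d c'), z8add (z8mul c b') (z8mul d d')).
Definition m8opp (x : M8) : M8 :=
  let: (a, b, c, d) := x in (z8opp a, z8opp b, z8opp c, z8opp d).

Definition z8_0 : Z8 := (0, 0, 0, 0).
Definition z8_1 : Z8 := (1, 0, 0, 0).
Definition z8_z : Z8 := (0, 1, 0, 0).
Definition z8_s : Z8 := (0, 0, 1, 0).
Definition z8_zi : Z8 := (0, 0, 0, -1).

Definition m8tau (i : nat) : M8 :=
  match i with
  | 0 => (z8_1, z8_0, z8_0, z8_1)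
  | 1 => (z8_zi, z8_0, z8_0, z8_z)
  | 2 => (z8opp z8_s, z8_1, z8_0, z8_s)
  | _ => (z8_0, z8opp z8_1, z8_1, z8_0)
  end.
Definition m8tv (e : bool) (i : nat) : M8 :=
  if e then (let: (a, b, c, d) := m8tau i in (d, z8opp b, z8opp c, a)) else m8tau i.
Fixpoint m8volt (e : bool) (w : seq nat) : M8 :=
  if w is i :: w' then m8mul (m8tv e i) (m8volt (~~ e) w') else (z8_1, z8_0, z8_0, z8_1).

(** The voltage of [vword] is a potential on the 48 flags: one more step agrees, up to the sign that
    is lost in $PSL_2$, with the word of the flag reached. Closed walks then have trivial
    voltage. *)
Definition cube_check (v : vflag) (i : nat) (e : bool) : bool :=
  let x := m8volt e (vword (vadj i v)) in let y := m8volt e (rcons (vword v) i) in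
  (x == y) || (x == m8opp y).

Lemma cube_checkT v i e : (0 < i < 4)%N -> cube_check v i e.
Proof.
case: i => [|[|[|[|//]]]] // _; case: v => [] [] [] [] []; case: e;
  vm_compute; reflexivity.
Qed.

Local Close Scope ring_scope.

Local Open Scope ring_scope.

(** * Transvections and the simplicity of $PSL_2$ *)

Section L2Generators.
Variables (F : finFieldType) (z : F).
Hypothesis z4 : z ^+ 4 = -1.
Hypothesis two_neq0 : 2%:R != 0 :> F.
Hypothesis primeF : forall x : F, exists k : nat, x = k%:R.
Implicit Types a b c d x y : F.

Local Notation s := (z ^+ 2).
Local Notation zi := (- z ^+ 3).

Lemma z_zi : z * zi = 1.
Proof. by rewrite mulrN -exprS z4 opprK. Qed.

Lemma s_sq : s * s = -1.
Proof. by rewrite -exprD z4. Qed.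

Definition T x := E 1 x 0 1.
Arguments T x%_R.

Lemma detT x : 1 * 1 - x * 0 = 1 :> F. Proof. by rewrite mulr0 subr0 mulr1. Qed.

Lemma detL x : 1 * 1 - 0 * x = 1 :> F. Proof. by rewrite mul0r subr0 mulr1. Qed.

Lemma T_L2 x : T x \in L2F F. Proof. exact: E_L2 (detT x). Qed.

Lemma T_mul x y : (T x * T y)%g = T (x + y).
Proof. by rewrite /T (E_mul (detT x) (detT y)); apply: E_congr; ring. Qed.

Lemma T_exp x k : (T x ^+ k)%g = T (x *+ k).
Proof.
elim: k => [|k IH]; first by rewrite expg0 mulr0n /T E_one.
by rewrite expgS IH T_mul mulrS.
Qed.

Lemma T_eq1 x : T x = 1%g <-> x = 0.
Proof.
split=> [/(E_eq1 (detT x))[] // | ->]; exact: E_one.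
Qed.

Lemma T_all (H : {group coset_of 'Z(SL2F F)}) x : x != 0 -> T x \in H -> forall y, T y \in H.
Proof.
move=> x0 Tx y; have [k ek] := primeF (y / x).
have -> : y = x *+ k by rewrite -mulr_natr -ek mulrC divfK.
by rewrite -T_exp groupX.
Qed.

Lemma L2_elementary (H : {group coset_of 'Z(SL2F F)}) :
  (forall x, T x \in H) -> (forall x, E 1 0 x 1 \in H) -> L2F F \subset H.
Proof.
move=> HT HL.
(* Multiplying out [T x], [E 1 0 c 1] and [T y] gives $a = 1 + xc$ and $d = 1 + yc$; the determinant
   then forces [b]. *)
have Hc a b c d : c != 0 -> a * d - b * c = 1 -> E a b c d \in H.
  move=> c0 dt; pose x := (a - 1) / c; pose y := (d - 1) / c.
  have xc : x * c = a - 1 by rewrite divfK.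
  have yc : y * c = d - 1 by rewrite divfK.
  have -> : E a b c d = (T x * (E 1 0 c 1 * T y))%g.
    rewrite /T (E_mul (detL c) (detT y)) (E_mul (detT x) (det2M (detL c) (detT y))).
    have e1 : a = 1 * (1 * 1 + 0 * 0) + x * (c * 1 + 1 * 0).
      have -> : 1 * (1 * 1 + 0 * 0) + x * (c * 1 + 1 * 0) = 1 + x * c by ring.
      by rewrite xc addrC subrK.
    have e4 : d = 0 * (1 * y + 0 * 1) + 1 * (c * y + 1 * 1).
      have -> : 0 * (1 * y + 0 * 1) + 1 * (c * y + 1 * 1) = y * c + 1 by ring.
      by rewrite yc subrK.
    have e3 : c = 0 * (1 * 1 + 0 * 0) + 1 * (c * 1 + 1 * 0) by ring.
    have e2 : b = 1 * (1 * y + 0 * 1) + x * (c * y + 1 * 1).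
      apply: (mulIf c0).
      have -> : (1 * (1 * y + 0 * 1) + x * (c * y + 1 * 1)) * c = y * c + x * c * (y * c) + x * c by ring.
      rewrite xc yc; have -> : b * c = a * d - 1 by rewrite -dt; ring.
      ring.
    by rewrite -e1 -e2 -e3 -e4.
  by rewrite !groupM.
apply/subsetP => w /L2_E[a [b [c [d [dt ->]]]]].
have [c0|] := eqVneq c 0; last by move=> c0; apply: Hc.
have d0 : d != 0.
  by apply: contra_eq_neq dt => ->; rewrite c0 !mulr0 subr0 eq_sym oner_eq0.
(* With [c = 0], multiplying by [E 1 0 1 1] brings [d], which is nonzero, to the lower left
   corner. *)
rewrite -(groupMr _ (HL 1)) (E_mul dt (detL 1)).
by apply: Hc (det2M dt (detL 1)); rewrite c0 mul0r mulr1 add0r.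
Qed.

Lemma det3 : 0 * 0 - (-1) * 1 = 1 :> F. Proof. by ring. Qed.

Definition w3 := E 0 (-1) 1 0 : coset_of 'Z(SL2F F).

Lemma T_w3 x : (w3 * T (- x) * w3^-1)%g = E 1 0 x 1.
Proof.
rewrite /w3 /T (E_inv det3) (E_mul det3 (detT (- x))).
have det3' : 0 * 0 - - (-1) * - 1 = 1 :> F by ring.
rewrite (E_mul (det2M det3 (detT (- x))) det3'); apply: E_congr; ring.
Qed.

Lemma detz : z * zi - 0 * 0 = 1. Proof. by rewrite z_zi; ring. Qed.

(** A normal subgroup with one nontrivial transvection has all of them: multiples give the upper
    ones, conjugation by [w3] the lower ones. Such a transvection comes from commutators, first with
    the diagonal element of [z], then with [T 1]. *)
Lemma L2F_simple (N : {group coset_of 'Z(SL2F F)}) : (N <| L2F F)%g ->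
  N :=: 1%g \/ N :=: L2F F.
Proof.
move=> nN; have sN := normal_sub nN.
have NJ g h : g \in N -> h \in L2F F -> (g ^ h)%g \in N.
  by move=> gN hL; rewrite memJ_norm // (subsetP (normal_norm nN)).
have w3L : w3 \in L2F F by apply: E_L2 det3.
suff [N1|[x x0 Tx]] : N :=: 1%g \/ exists2 x, x != 0 & T x \in N; [by left | right |].
  apply/eqP; rewrite eqEsubset sN; apply: L2_elementary; first exact: T_all x0 Tx.
  move=> y; rewrite -T_w3 -mulgA -{1}(invgK w3) -conjgE.
  by apply: NJ; [apply: T_all x0 Tx _ | rewrite groupV].
have [N1|[g gN g1]] : N :=: 1%g \/ exists2 g, g \in N & g != 1%g.
  have [sN1|] := boolP (N \subset [1]%g); first by left; apply/trivgP.
  by case/subsetPn => g gN; rewrite inE => g1; right; exists g.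
- by left.
right.
suff comb a b c d : a * d - b * c = 1 -> c != 0 -> E a b c d \in N -> exists2 x, x != 0 & T x \in N.
  have [a [b [c [d [dt eg]]]]] := L2_E (subsetP sN _ gN).
  rewrite {}eg in gN g1; have [c0|c0] := eqVneq c 0; last exact: comb dt c0 gN.
  have [b0|b0] := eqVneq b 0; last first.
    have := NJ _ _ gN w3L; rewrite conjgE /w3 (E_inv det3).
    have det3' : 0 * 0 - - (-1) * - 1 = 1 :> F by ring.
    rewrite (E_mul dt det3) (E_mul det3' (det2M dt det3)); apply: comb; first exact: (det2M det3' (det2M dt det3)).
    by rewrite !(mulr0, mul0r, mulr1, addr0, add0r) mulN1r oppr_eq0.
  subst b c.
  have ad : a * d = 1 by rewrite -dt; ring.
  (* The commutator of a diagonal element with [T 1]; it is nontrivial because [d] is neither 1 nor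
     -1. *)
  exists (1 - d * d).
    apply: contraNneq g1 => /eqP; rewrite subr_eq0 => /eqP dd.
    have : (d - 1) * (d + 1) = 0.
      have -> : (d - 1) * (d + 1) = d * d - 1 by ring.
      by rewrite -dd subrr.
    move/eqP; rewrite mulf_eq0 => /orP[|].
      by rewrite subr_eq0 => /eqP ed; move: ad; rewrite ed mulr1 => ->; rewrite E_one.
    rewrite addr_eq0 => /eqP ed; move: ad; rewrite ed mulrN1 => /eqP; rewrite eqr_oppLR => /eqP->.
    have := E_neg (detL (0 : F)); rewrite oppr0 E_one => ->; exact: eqxx.
  have := groupM (groupVr gN) (NJ _ _ gN (T_L2 1)).
  have dV := E_inv dt; have dtV : d * a - - 0 * - 0 = 1 by rewrite -dt; ring.
  have TV : (T 1)^-1%g = E 1 (- 1) (- 0) 1 by apply: E_inv (detT 1).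
  have dtT : 1 * 1 - (- 1) * (- 0) = 1 :> F by ring.
  rewrite dV conjgE TV /T (E_mul dt (detT 1)) (E_mul dtT (det2M dt (detT 1))).
  rewrite (E_mul dtV (det2M dtT (det2M dt (detT 1)))).
  set A := E _ _ _ _; suff -> : A = E 1 (1 - d * d) 0 1 by [].
  rewrite /A; apply: E_congr; rewrite -?ad; ring: ad.
move=> dt c0 {}gN; exists 2%:R => //.
pose x := a / c; have xc : x * c = a by rewrite divfK.
have cV : c * c^-1 = 1 by rewrite mulfV.
have dt1 : 0 * (a + d) - (- c^-1) * c = 1 by rewrite mul0r sub0r mulNr opprK mulVf.
(* Conjugation by [T (a / c)] clears the upper left entry, which makes the commutator with a
   diagonal matrix upper triangular. *)
have A1 : E 0 (- c^-1) c (a + d) \in N.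
  suff -> : E 0 (- c^-1) c (a + d) = (E a b c d ^ T x)%g by apply: NJ (T_L2 x).
  have TV : (T x)^-1%g = E 1 (- x) (- 0) 1 by apply: E_inv (detT x).
  have dtT : 1 * 1 - (- x) * (- 0) = 1 :> F by ring.
  rewrite conjgE TV /T (E_mul dt (detT x)) (E_mul dtT (det2M dt (detT x))).
  have e1 : 0 = 1 * (a * 1 + b * 0) + - x * (c * 1 + d * 0).
    have -> : 1 * (a * 1 + b * 0) + - x * (c * 1 + d * 0) = a - x * c by ring.
    by rewrite xc subrr.
  have e3 : c = - 0 * (a * 1 + b * 0) + 1 * (c * 1 + d * 0) by ring.
  have e4 : a + d = - 0 * (a * x + b * 1) + 1 * (c * x + d * 1).
    have -> : - 0 * (a * x + b * 1) + 1 * (c * x + d * 1) = x * c + d by ring.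
    by rewrite xc.
  have e2 : - c^-1 = 1 * (a * x + b * 1) + - x * (c * x + d * 1).
    apply: (mulIf c0); rewrite mulNr mulVf //.
    have -> : (1 * (a * x + b * 1) + - x * (c * x + d * 1)) * c =
      a * (x * c) + b * c - (x * c) * (x * c) - (x * c) * d by ring.
    by rewrite xc -dt; ring.
  by rewrite -e1 -e2 -e3 -e4.
have DL : E z 0 0 zi \in L2F F by apply: E_L2 detz.
pose t := a + d; pose y := t * (1 + s) * c^-1.
have dtB : s * (- s) - y * 0 = 1 by rewrite mulrN s_sq; ring.
have B1 : E s y 0 (- s) \in N.
  have dt1V : t * 0 - (- - c^-1) * (- c) = 1 by rewrite -dt1; ring.
  have dtz' : zi * z - (- 0) * (- 0) = 1 by rewrite -detz; ring.
  have -> : E s y 0 (- s) = ((E 0 (- c^-1) c t)^-1 * (E 0 (- c^-1) c t ^ E z 0 0 zi))%g.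
    rewrite conjgE (E_inv dt1) (E_inv detz) (E_mul dt1 detz) (E_mul dtz' (det2M dt1 detz)).
    rewrite (E_mul dt1V (det2M dtz' (det2M dt1 detz))).
    rewrite /y /t; clear -z4 cV; move: (c^-1) cV => k cV; apply: E_congr.
    - ring: z4 cV.
    - ring: z4 cV.
    - ring: z4 cV.
    - ring: z4 cV.
  by apply: groupM (groupVr A1) (NJ _ _ A1 DL).
have T1V : (T 1)^-1%g = E 1 (- 1) (- 0) 1 by apply: E_inv (detT 1).
have dtT : 1 * 1 - (- 1) * (- 0) = 1 :> F by ring.
have dtBV : (- s) * s - (- y) * (- 0) = 1 by rewrite -dtB; ring.
(* On the affine line [E s y 0 (- s)] is a map $w \mapsto -w + \mathrm{const}$, which inverts
   translations, so its commutator with [T 1] is the translation by 2. *)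
have -> : T 2%:R = ((E s y 0 (- s))^-1 * (E s y 0 (- s) ^ T 1))%g.
  rewrite conjgE T1V (E_inv dtB) /T (E_mul dtB (detT 1)) (E_mul dtT (det2M dtB (detT 1))).
  rewrite (E_mul dtBV (det2M dtT (det2M dtB (detT 1)))).
  apply: E_congr; ring: z4.
by apply: groupM (groupVr B1) (NJ _ _ B1 (T_L2 1)).
Qed.

End L2Generators.

Local Close Scope ring_scope.

Local Open Scope ring_scope.

(** A divisibility suffices for the order condition: the determinant takes values in a group of
    order $q - 1$, and the centre lies in $\{1, -1\}$. *)
Lemma card_L2F (F : finFieldType) : (#|F| * (#|F| ^ 2 - 1) %| 2 * #|L2F F|)%N.
Proof.
pose f (A : {'GL_2[F]}) : {unit F} := insubd (1%g : {unit F}) (\det (GLval A)).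
have fE A : val (f A) = \det (GLval A).
  by rewrite /f val_insubd -unitmxE GL_unitmx.
have fM : {in [set: {'GL_2[F]}] &, {morph f : A B / (A * B)%g}}.
  by move=> A B _ _; apply: val_inj; rewrite fE GL_MxE det_mulmx /= !fE.
pose phi := Morphism fM.
have kerE : ('ker phi = SL2F F)%g.
  apply/setP => A; rewrite !inE /=; apply/eqP/eqP => [e|dA].
    by rewrite -fE e.
  by apply: val_inj; rewrite fE dA.
have cardGL : #|[set: {'GL_2[F]}]| = (#|F| * #|F|.-1 ^ 2 * #|F|.+1)%N by exact: card_GL_2.
have im : (#|(phi @* [set: {'GL_2[F]}])%g| %| #|F|.-1)%N.
  by rewrite -card_finField_unit cardSg ?subsetT.
have := card_morphim phi [set: {'GL_2[F]}]; rewrite setIid kerE => imE.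
have := Lagrange (subsetT (SL2F F)); rewrite -{}imE cardGL.
case/dvdnP: im => j ej eSL.
have q_gt1 : (1 < #|F|)%N by apply: card_finNzRing_gt1.
have k_gt0 : (0 < #|(phi @* [set: {'GL_2[F]}])%g|)%N by apply: cardG_gt0.
have eS : #|SL2F F| = (#|F| * (#|F| ^ 2 - 1) * j)%N.
  apply/eqP; rewrite -(eqn_pmul2r k_gt0) eSL; apply/eqP.
  have -> : (#|F| ^ 2 - 1 = #|F|.-1 * #|F|.+1)%N 
    by have := subn_sqr #|F| 1; rewrite exp1n => ->; rewrite subn1 addn1.
  have aux q q1 q2 k : q1 = (j * k)%N -> (q * q1 ^ 2 * q2 = q * (q1 * q2) * j * k)%N.
    by move=> ->; ring.
  exact: aux ej.
have Zle : ('Z(SL2F F) \subset [set 1; gl2 (-1)%R 0%R 0%R (-1)%R])%g.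
  apply/subsetP => A ZA; have /centerP[sA _] := ZA.
  have [a [b [c [d [dt eA]]]]] := SL2_gl2 sA; rewrite eA in ZA *.
  have [b0 c0 ad] := center_gl2 dt ZA; subst b c d.
  have : (a - 1) * (a + 1) = 0.
    have -> : (a - 1) * (a + 1) = a * a - 0 * 0 - 1 by ring.
    by rewrite dt subrr.
  move/eqP; rewrite mulf_eq0 subr_eq0 addr_eq0 !inE => /orP[] /eqP->; last by rewrite eqxx orbT.
  apply/orP; left; apply/eqP; apply: val_inj; rewrite [LHS]val_gl2; last by ring.
  exact: mat2_1.
have Zcard : (#|'Z(SL2F F)%g| %| 2)%N.
  have := subset_leq_card Zle; rewrite cards2; have := cardG_gt0 'Z(SL2F F)%G.
  rewrite /=; case: #|_| => [|[|[|k]]] //; by case: eqP.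
have := Lagrange (center_sub (SL2F F)); rewrite -card_quotient ?SL2_norm // eS => eL.
apply: dvdn_trans (dvdn_mulr j (dvdnn _)) _; rewrite -eL.
exact: dvdn_mul.
Qed.

(** * Voltages from the honeycomb {4,4,3} *)

Section L2Voltages.
Variables (F : finFieldType) (z : F).
Hypothesis z4 : z ^+ 4 = -1.
Hypothesis primeF : forall x : F, exists k : nat, x = k%:R.

Local Notation s := (z ^+ 2).
Local Notation zi := (- z ^+ 3).

(** With the centre of the base square as origin, the mirrors of {4,4,3} are $\Re w = 0$, $\Re w =
    \Im w$, $\Im w = -1/2$ and $|w| = 1$. Reflecting in the first and then in each of the others
    gives $-iw$, $-w-i$ and $-1/w$; these are the matrices below, with [s] for $i$ and scaled to
    determinant 1. *)
Definition tauL (i : nat) : coset_of 'Z(SL2F F) :=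
  match i with
  | 0 => 1%g
  | 1 => E zi 0 0 z
  | 2 => E (- s) 1 0 s
  | _ => w3 F
  end.

Lemma dtau1 : zi * z - 0 * 0 = 1. Proof. ring: z4. Qed.
Lemma dtau2 : (- s) * s - 1 * 0 = 1. Proof. ring: z4. Qed.

Lemma tauL_in i : tauL i \in L2F F.
Proof.
case: i => [|[|[|i]]]; [exact: group1 | exact: E_L2 dtau1 | exact: E_L2 dtau2 |].
exact: E_L2 (det3 F).
Qed.

(** For [i = 0] this says that [tau 2] and [tau 3] are involutions, and for the pair 1, 3 that
    $\tau_3\tau_1^{-1}$ is one. *)
Lemma tauL_comm i j e : (i.+1 < j)%N -> (j < 4)%N ->
  (tv tauL e j * tv tauL (~~ e) i = tv tauL e i * tv tauL (~~ e) j)%g.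
Proof.
have t2 : (tauL 2)^-1%g = tauL 2.
  rewrite /tauL (E_inv dtau2) -[LHS]E_neg; last by ring: z4.
  by apply: E_congr; ring.
have t3 : (tauL 3)^-1%g = tauL 3.
  rewrite /tauL /w3 (E_inv (det3 F)) -[LHS]E_neg; last by ring.
  by apply: E_congr; ring.
have t13 : (tauL 3 * (tauL 1)^-1 = tauL 1 * (tauL 3)^-1)%g.
  have d1' : z * zi - - 0 * - 0 = 1 by ring: z4.
  rewrite t3 /tauL /w3 (E_inv dtau1) (E_mul (det3 F) d1') (E_mul dtau1 (det3 F)).
  by apply: E_congr; ring.
have t13' : ((tauL 3)^-1 * tauL 1 = (tauL 1)^-1 * tauL 3)%g.
  rewrite -[(tauL 3)^-1%g]mul1g -(mulVg (tauL 1)) -!mulgA; congr (_ * _)%g.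
  by rewrite mulgA -t13 mulgKV.
case: i => [|[|i]]; case: j => [|[|[|[|j]]]] // _ _; case: e; rewrite /tv /= ?invg1 ?mul1g ?mulg1 //.
Qed.

(* [hal u] is a square root of the rotation factor [a] of the affine map [z -> a z + hbe u] sending
   the base flag to [u] (or to the mirror image of [u] if [u] is odd). *)
Definition hal (u : uflag) : F :=
  if ue u then (if usx u then z else zi) else (if usy u then s else 1).
Definition hali (u : uflag) : F :=
  if ue u then (if usx u then zi else z) else (if usy u then - s else 1).
(** The centre of the square of [u] relative to that of the base square, the origin of the
    coordinate in [tauL]; [s] stands for $i$. *)
Definition hbe (u : uflag) : F :=
  (ux u - (usx u)%:Z)%:~R + s * (uy u - (usy u)%:Z)%:~R.
Definition hL (u : uflag) : coset_of 'Z(SL2F F) := E (hal u) (hbe u * hali u) 0 (hali u).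

Lemma dhL u : hal u * hali u - hbe u * hali u * 0 = 1.
Proof. by rewrite /hal /hali mulr0 subr0; case: u => x y [] [] [] /=; ring: z4. Qed.

Lemma hL_adj i u : (i < 3)%N -> hL (uadj i u) = (hL u * tv tauL (upar u) i)%g.
Proof.
have d1' : z * zi - - 0 * - 0 = 1 by ring: z4.
have d2' : s * - s - - 1 * - 0 = 1 by ring: z4.
have eqE a b c d a' b' c' d' : a * d - b * c = 1 ->
  [/\ a = a', b = b', c = c' & d = d'] \/ [/\ a = - a', b = - b', c = - c' & d = - d'] ->
  E a b c d = E a' b' c' d' :> coset_of 'Z(SL2F F).
  move=> dt [[]|[]] e1 e2 e3 e4; first exact: E_congr.
  by rewrite -(E_neg dt); apply: E_congr; rewrite ?e1 ?e2 ?e3 ?e4 opprK.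
case: i => [|[|[|//]]] _.
- have -> : tv tauL (upar u) 0 = 1%g by rewrite /tv /=; case: ifP; rewrite ?invg1.
  rewrite mulg1; apply: E_congr => //; case: u => x y [] [] [];
    rewrite /hal /hali /hbe /sg /= ?(rmorphD, rmorphB, rmorphN, rmorph1, rmorph0) /=; ring.
- have -> : tv tauL (upar u) 1 = if upar u then E z (- 0) (- 0) zi else E zi 0 0 z.
    by rewrite /tv /=; case: ifP; rewrite // (E_inv dtau1).
  case: ifP => pu; [rewrite (E_mul (dhL u) d1') | rewrite (E_mul (dhL u) dtau1)];
  apply: eqE (dhL _) _; case: u pu => x y [] [] [] //= _;
    rewrite /hal /hali /hbe /sg /= ?(rmorphD, rmorphB, rmorphN, rmorph1, rmorph0) /=;
  first [left; split; ring: z4 | right; split; ring: z4].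
- have -> : tv tauL (upar u) 2 = if upar u then E s (- 1) (- 0) (- s) else E (- s) 1 0 s.
    by rewrite /tv /=; case: ifP; rewrite // (E_inv dtau2).
  case: ifP => pu; [rewrite (E_mul (dhL u) d2') | rewrite (E_mul (dhL u) dtau2)];
  apply: eqE (dhL _) _; case: u pu => x y [] [] [] //= _;
    rewrite /hal /hali /hbe /sg /= ?(rmorphD, rmorphB, rmorphN, rmorph1, rmorph0) /=;
  first [left; split; ring: z4 | right; split; ring: z4].
Qed.

Lemma hL_utr t u : hL (utr t u) = (T (t.1%:~R + s * t.2%:~R) * hL u)%g.
Proof.
rewrite /T /hL (E_mul (detT _) (dhL u)).
case: u => x y e sx sy; apply: E_congr; rewrite /hal /hali /hbe /= ?rmorphB ?rmorphD /=; ring.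
Qed.

Lemma hL_ker t u : hL (utr t u) = hL u <-> t.1%:~R + s * t.2%:~R = 0 :> F.
Proof.
rewrite hL_utr -T_eq1; split=> [e|->]; last by rewrite mul1g.
by apply: (mulIg (hL u)); rewrite mul1g.
Qed.

Lemma hL_in u : hL u \in L2F F. Proof. exact: E_L2 (dhL u). Qed.

Lemma hL_walk w u : all (fun i => i < 3)%N w ->
  hL (uwalk w u) = (hL u * volt tauL (upar u) w)%g.
Proof.
elim: w u => [|i w IH] u /=; first by rewrite mulg1.
by case/andP=> lt_i3 /IH->; rewrite hL_adj // upar_uadj mulgA.
Qed.

Lemma volt_in (H : {group coset_of 'Z(SL2F F)}) e w :
  (forall i, (i < 4)%N -> tauL i \in H) -> all (fun i => i < 4)%N w -> volt tauL e w \in H.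
Proof.
move=> tH; elim: w e => [|i w IH] e /=; first by rewrite group1.
case/andP=> lt_i /IH h; rewrite groupM //= /tv; case: ifP => _; rewrite ?groupV; exact: tH.
Qed.

Lemma tauL_gen : L2F F \subset <<[set tauL (val i) | i : 'I_4]>>%g.
Proof.
pose H := <<[set tauL (val i) | i : 'I_4]>>%G.
suff: L2F F \subset H by [].
have tH i : (i < 4)%N -> tauL i \in H.
  by move=> lt_i4; apply: mem_gen; apply/imsetP; exists (Ordinal lt_i4).
have T1 : T 1 \in H.
  (* This word is the unit translation along the base edge, so its voltage is [T 1]. *)
  have := @hL_walk [:: 0; 1; 2; 1]%N u0 isT.
  have -> : uwalk [:: 0; 1; 2; 1]%N u0 = utr (1, 0) u0 by [].
  rewrite hL_utr /= mulr0 addr0 => e.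
  have {e} -> : T 1 = (hL u0 * volt tauL (upar u0) [:: 0; 1; 2; 1]%N * (hL u0)^-1)%g.
    by apply: (mulIg (hL u0)); rewrite -mulgA mulVg mulg1.
  have -> : hL u0 = 1%g.
    by rewrite -E_one; apply: E_congr; rewrite // /hbe /= subrr mulr0z mulr0 addr0 mul0r.
  by rewrite invg1 mulg1 mul1g; apply: volt_in.
have TH x : T x \in H by apply: (T_all primeF (oner_neq0 F) T1).
apply: L2_elementary => // x; rewrite -T_w3.
by rewrite groupM ?groupV ?(tH 3%N) // groupM ?(tH 3%N).
Qed.

Definition ev (x : Z8) : F :=
  let: (a, b, c, d) := x in a%:~R + b%:~R * z + c%:~R * z ^+ 2 + d%:~R * z ^+ 3.

Lemma ev_add x y : ev (z8add x y) = ev x + ev y.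
Proof. by case: x y => [[[a b] c] d] [[[a' b'] c'] d'] /=; rewrite !rmorphD; ring. Qed.

Lemma ev_opp x : ev (z8opp x) = - ev x.
Proof. by case: x => [[[a b] c] d] /=; rewrite !rmorphN; ring. Qed.

Lemma ev_mul x y : ev (z8mul x y) = ev x * ev y.
Proof.
case: x y => [[[a b] c] d] [[[a' b'] c'] d'] /=.
rewrite !(rmorphD, rmorphB, rmorphN, rmorphM) /=; ring: z4.
Qed.

Definition evdet (x : M8) : F := let: (a, b, c, d) := x in ev a * ev d - ev b * ev c.
Definition evE (x : M8) : coset_of 'Z(SL2F F) :=
  let: (a, b, c, d) := x in E (ev a) (ev b) (ev c) (ev d).

Lemma evE_mul x y : evdet x = 1 -> evdet y = 1 ->
  evdet (m8mul x y) = 1 /\ evE (m8mul x y) = (evE x * evE y)%g.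
Proof.
case: x y => [[[a b] c] d] [[[a' b'] c'] d'] dx dy; rewrite /evE /evdet /m8mul.
rewrite !ev_add !ev_mul; split; first exact: det2M dx dy.
by rewrite (E_mul dx dy).
Qed.

Lemma evE_opp x : evdet x = 1 -> evE (m8opp x) = evE x.
Proof. by case: x => [[[a b] c] d] dx; rewrite /evE /m8opp !ev_opp; apply: E_neg. Qed.

Lemma m8tvP e i : evdet (m8tv e i) = 1 /\ tv tauL e i = evE (m8tv e i).
Proof.
have e0 : ev z8_0 = 0 by rewrite /ev /= ; ring.
have e1 : ev z8_1 = 1 by rewrite /ev /= ; ring.
have ez : ev z8_z = z by rewrite /ev /= ; ring.
have es : ev z8_s = s by rewrite /ev /= ; ring.
have ezi : ev z8_zi = zi by rewrite /ev /= rmorphN /=; ring.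
have tau_ev j : evdet (m8tau j) = 1 /\ tauL j = evE (m8tau j).
  case: j => [|[|[|j]]]; rewrite /evdet /evE /m8tau ?ev_opp ?e0 ?e1 ?ez ?es ?ezi; split=> //.
  - by ring.
  - by rewrite E_one.
  - exact: dtau1.
  - exact: dtau2.
  - exact: det3.
rewrite /tv /m8tv; have [] := tau_ev i; case: e => // + ->.
case: (m8tau i) => [[[a b] c] d] dt; rewrite /evdet /evE !ev_opp (E_inv dt); split=> //.
by rewrite -dt /evdet; ring.
Qed.

Lemma m8voltP e w : evdet (m8volt e w) = 1 /\ volt tauL e w = evE (m8volt e w).
Proof.
elim: w e => [|i w IH] e.
  have e0 : ev z8_0 = 0 by rewrite /ev /= ; ring.
  have e1 : ev z8_1 = 1 by rewrite /ev /= ; ring.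
  by rewrite /volt /m8volt /evdet /evE e0 e1 E_one; split=> //; ring.
rewrite -[volt tauL e (i :: w)]/(tv tauL e i * volt tauL (~~ e) w)%g.
rewrite -[m8volt e (i :: w)]/(m8mul (m8tv e i) (m8volt (~~ e) w)).
have [d1 ->] := m8tvP e i; have [d2 ->] := IH (~~ e).
by have [-> ->] := evE_mul d1 d2.
Qed.

Lemma cube_volt e v w : all (fun i => 0 < i < 4)%N w -> vwalk w v = v ->
  volt tauL e w = 1%g.
Proof.
(* The class at the start of [vword v] that makes [e] the class at [v]. *)
pose e' := e (+) odd (size (vword v)).
have stepP i v' : (0 < i < 4)%N -> volt tauL e' (vword (vadj i v')) =
    (volt tauL e' (vword v') * tv tauL (e' (+) odd (size (vword v'))) i)%g.
  move=> lt_i; have := cube_checkT v' e' lt_i; rewrite /cube_check.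
  have [_ ->] := m8voltP e' (vword (vadj i v')).
  have [dy ey] := m8voltP e' (rcons (vword v') i).
  move=> chk; have -> : evE (m8volt e' (vword (vadj i v'))) = evE (m8volt e' (rcons (vword v') i)).
    by case/orP: chk => /eqP -> //; apply: evE_opp.
  by rewrite -ey -cats1 volt_cat /= mulg1.
have walkP u v' : all (fun i => 0 < i < 4)%N u -> volt tauL e' (vword (vwalk u v')) =
    (volt tauL e' (vword v') * volt tauL (e' (+) odd (size (vword v'))) u)%g.
  elim: u v' => [|i u IH] v' /=; first by rewrite mulg1.
  case/andP=> lt_i /IH->; rewrite stepP // -mulgA vword_size // addbN.
  by congr (_ * (_ * _))%g; rewrite addbN.
move=> wA wv; have := walkP w v wA; rewrite wv /e' addbK => h.
by apply: (mulgI (volt tauL (e (+) odd (size (vword v))) (vword v))); rewrite mulg1 -h.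
Qed.

End L2Voltages.

Local Close Scope ring_scope.

(** * Flags of [Q] on a facet and at a vertex, in coordinates *)

Section TorusFlags.
Variables (Q : polytope 4) (m : nat) (F : Q).
Hypotheses (m_ge2 : 2 <= m) (facetF : is_facet F).
Hypothesis isoF : poset_iso (facet F) (torus_map m 0).

Lemma tface_sameu b c u v k : sameu k u v -> tface b c u k = tface b c v k.
Proof.
have [k_mid|k_out] := boolP (0 < k < 4); first by move=> /(_ k_mid) e; rewrite !tface_mid // e.
by case: k k_out => [|[|[|[|k]]]].
Qed.

Lemma tface_lt b c u k : k < 4 -> (tface b c u k < tface b c u k.+1)%O.
Proof.
move=> ltk; rewrite lt_leAnge; apply/andP; split.
  apply/tface_leP; [lia | lia |]; split; first lia.
  exists u, (0, 0)%R; split=> //; first exact: lattice0.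
  by case: u => *; rewrite /= !addr0.
by apply/negP => /tface_leP h; have [] := h; lia.
Qed.

(** Here [m >= 2] enters: a unit step is not in the lattice, so adjacent plane flags stay distinct
    on the torus. *)
Lemma mul_neq_sg (j : int) (e : bool) : (j * m%:Z <> sg e)%R.
Proof.
move/(congr1 absz); rewrite abszM; have -> : absz (sg e) = 1 by case: e.
by move/eqP; rewrite muln_eq1 => /andP[_ /eqP /= em]; move: m_ge2; rewrite em.
Qed.

Lemma tface_uadj_neq i u : i < 3 -> tface m 0 (uadj i u) i.+1 <> tface m 0 u i.+1.
Proof.
move=> lt_i3; rewrite !tface_mid //; try lia.
move=> [] /pi_cellP[t /lattice_squareP[k [l ->]]].
have small := mul_neq_sg.
case: i lt_i3 => [|[|[|//]]] _; case: u => [x y [] sx sy]; rewrite /translate /= => -[].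
- by move=> _ e; apply: (small (- l)%R sy); lia.
- by move=> e _; apply: (small (- k)%R sx); lia.
- by [].
- by [].
- by move=> e _; apply: (small (- k)%R (~~ sx)); case: sx e => /=; rewrite /sg; lia.
- by move=> _ e; apply: (small (- l)%R (~~ sy)); case: sy e => /=; rewrite /sg; lia.
Qed.

Lemma tface_ker u v : (forall k, 0 < k < 4 -> tface m 0 u k = tface m 0 v k) ->
  exists2 t, in_lattice m 0 t & u = utr t v.
Proof.
move=> eq_t.
have ex k : 0 < k < 4 -> exists2 t, in_lattice m 0 t & ucell u k = translate t (ucell v k).
  by move=> lk; have := esym (eq_t k lk); rewrite !tface_mid // => -[] /pi_cellP.
have [t1 /lattice_squareP[a1 [b1 ->]] e1] := ex 1 isT.
have [t2 /lattice_squareP[a2 [b2 ->]] e2] := ex 2 isT.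
have [t3 /lattice_squareP[a3 [b3 ->]] e3] := ex 3 isT.
exists (a1 * m%:Z, b1 * m%:Z)%R; first by apply/lattice_squareP; exists a1, b1.
have small (j : int) (e e' : bool) : (j * m%:Z = e%:Z - e'%:Z -> e = e')%R.
  by case: e; case: e' => //= ej; [case: (mul_neq_sg (e := false) ej) | case: (mul_neq_sg (e := true) ej)].
case: u v e1 e2 e3 {eq_t ex} => [x y e sx sy] [x' y' e' sx' sy'].
rewrite /translate /= => -[ex ey] e2 [fx fy].
have esx : sx = sx' by apply: (small (a1 - a3)%R); lia.
have esy : sy = sy' by apply: (small (b1 - b3)%R); lia.
have ee : e = e' by case: e e' e2 => [] [].
by subst; congr UFlag.
Qed.

Lemma torus_embedding : exists emb : uflag -> flagT Q,
  [/\ forall i u, i < 3 -> emb (uadj i u) = qadj i (emb u),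
      forall u, at_lev (emb u) 4 = F &
      forall u v, emb u = emb v <-> exists2 t, in_lattice m 0 t & u = utr t v].
Proof.
have [f [[g fK gK] f_mono]] := isoF.
have g_le p q : (g p <= g q)%O = (p <= q)%O by rewrite -f_mono !gK.
have g_lt p q : (val (g p) < val (g q))%O = (p < q)%O.
  by rewrite !lt_leAnge !Order.le_val !g_le.
have g_inj : injective g := can_inj gK.
have levF : lev F = 4 by move: facetF; rewrite /is_facet rank_lev; lia.
pose G u k : Q := if k < 5 then val (g (tface m 0 u k)) else \top%O.
have G4 u : G u 4 = F.
  apply: le_anti; rewrite /G /=; have /andP[_ ->] /= := valP (g (tface m 0 u 4)).
  have : ((\top : facet F) <= g (tface m 0 u 4))%O.
    by rewrite -[X in (X <= _)%O]fK g_le; case: (f _) => [[]|].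
  by rewrite -Order.le_val.
have /choice[emb embP] u : exists a : flagT Q, forall k, k < 6 -> at_lev a k = G u k.
  apply: flag_of_seq => k ltk; have [lt4|] := ltnP k 4.
    rewrite /G (ltn_trans lt4) // ltnS lt4.
    by rewrite g_lt; apply: tface_lt.
  move=> ge4; have -> : k = 4 by lia.
  rewrite G4 /G /= lt_neqAle lex1 andbT; apply/eqP => eF.
  have a0 : exists a : flagT Q, True.
    have ch0 : chain (set0 : {set Q}) by apply/forall_inP => q; rewrite inE.
    by have [A fA _] := chain_ext ch0; exists (exist _ A fA).
  have [a _] := a0; have := levF; rewrite eF -(at_levn a) lev_at //.
exists emb; split=> [i u lt_i3 | u | u v].
- apply: qadj_uniq; first lia.
    have ltS : i.+1 < 6 by lia.
    move/(congr1 (fun a => at_lev a i.+1)); rewrite !embP // /G (_ : i.+1 < 5); last lia.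
    by move/val_inj/g_inj; apply: tface_uadj_neq.
  move=> k ltk nk; rewrite !embP // /G; case: ifP => // _; congr (val (g _)).
  by apply: tface_sameu; apply: sameu_sym; apply: uadj_sameu.
- by rewrite embP.
split=> [e|[t tL ->]].
  apply: tface_ker => k lk; apply: g_inj; apply: val_inj.
  have ltk : k < 6 by lia.
  have := congr1 (fun a => at_lev a k) e; rewrite !embP // /G (_ : k < 5) //; lia.
by apply: flagT_ext => k ltk; rewrite !embP // /G; case: ifP => // _; rewrite tface_utr.
Qed.

End TorusFlags.

Section CubeFlags.
Variables (Q : polytope 4) (x : Q).
Hypothesis vertexx : is_vertex x.
Hypothesis isox : poset_iso (vertex_figure x) cube_faces.

Definition cubef (g0 g1 g2 : option bool) : cube_faces :=
  Some [ffun j : 'I_3 => if val j == 0 then g0 else if val j == 1 then g1 else g2].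

Lemma cubef_le g0 g1 g2 h0 h1 h2 : (cubef g0 g1 g2 <= cubef h0 h1 h2)%O =
  [&& (h0 == None) || (h0 == g0), (h1 == None) || (h1 == g1) & (h2 == None) || (h2 == g2)].
Proof.
apply/forallP/and3P => [h | [c0 c1 c2] [[|[|[|//]]] ?]]; rewrite ?ffunE //=.
have := h (@Ordinal 3 0 isT); have := h (@Ordinal 3 1 isT); have := h (@Ordinal 3 2 isT).
by rewrite !ffunE.
Qed.

Lemma cubef_inj g0 g1 g2 h0 h1 h2 : cubef g0 g1 g2 = cubef h0 h1 h2 ->
  [/\ g0 = h0, g1 = h1 & g2 = h2].
Proof.
move=> [] /ffunP e; have := e (@Ordinal 3 0 isT); have := e (@Ordinal 3 1 isT).
by have := e (@Ordinal 3 2 isT); rewrite !ffunE /= => -> -> ->.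
Qed.

(** The place of axis [j] in the order [o]: a face in [vface] extends along the axes whose places
    come before its dimension. *)
Definition pos (o : ord3) (j : nat) : nat :=
  match o, j with
  | O012, 0 | O021, 0 | O102, 1 | O120, 1 | O201, 2 | O210, 2 => 0
  | O012, 1 | O021, 2 | O102, 0 | O120, 2 | O201, 0 | O210, 1 => 1
  | _, _ => 2
  end.

(* Level [k] in the 4-polytope is level [k - 1] in the vertex-figure. *)
Definition vface (v : vflag) (k : nat) : cube_faces :=
  let: VFlag b0 b1 b2 o := v in
  if k < 2 then None else
  cubef (if pos o 0 < k - 2 then None else Some b0) (if pos o 1 < k - 2 then None else Some b1)
        (if pos o 2 < k - 2 then None else Some b2).

Lemma vface_lt v k : 0 < k < 5 -> (vface v k < vface v k.+1)%O.
Proof.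
rewrite lt_leAnge; case: k => [|[|[|[|[|//]]]]] // _; case: v => [b0 b1 b2 o] //=;
  by rewrite !cubef_le; case: o b0 b1 b2 => [] [] [] [].
Qed.

Lemma vface_vadj i v k : 0 < i < 4 -> 0 < k < 6 -> k != i.+1 -> vface (vadj i v) k = vface v k.
Proof.
case: i => [|[|[|[|//]]]] // _; case: k => [|[|[|[|[|[|//]]]]]] // _ _; by case: v => [b0 b1 b2 []].
Qed.

Lemma vface_vadj_neq i v : 0 < i < 4 -> vface (vadj i v) i.+1 <> vface v i.+1.
Proof.
case: i => [|[|[|[|//]]]] // _; case: v => [b0 b1 b2 []] /= /cubef_inj[] //;
  by case: b0; case: b1; case: b2.
Qed.

Lemma vface_inj u v : (forall k, 0 < k < 6 -> vface u k = vface v k) -> u = v.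
Proof.
move=> e; have := e 2 isT; have := e 3 isT; have := e 4 isT; move: u v {e}.
move=> [b0 b1 b2 o] [c0 c1 c2 o'] /= /cubef_inj[+ + +] /cubef_inj[+ + +] /cubef_inj[].
by case: o; case: o' => //= ? ? ? ? ? ? [->] [->] [->].
Qed.

Lemma cube_embedding : exists emb : vflag -> flagT Q,
  [/\ forall i v, 0 < i < 4 -> emb (vadj i v) = qadj i (emb v),
      forall v, at_lev (emb v) 1 = x & injective emb].
Proof.
have [f [[g fK gK] f_mono]] := isox.
have g_le p q : (g p <= g q)%O = (p <= q)%O by rewrite -f_mono !gK.
have g_lt p q : (val (g p) < val (g q))%O = (p < q)%O.
  by rewrite !lt_leAnge !Order.le_val !g_le.
have g_inj : injective g := can_inj gK.
have levx : lev x = 1 by move: vertexx; rewrite /is_vertex rank_lev; lia.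
pose G v k : Q := if k == 0 then \bot%O else val (g (vface v k)).
have G1 v : G v 1 = x.
  apply: le_anti; rewrite /G /=; have /andP[-> _] := valP (g (vface v 1)); rewrite andbT.
  have : (g (vface v 1) <= (\bot : vertex_figure x))%O.
    by rewrite -[X in (_ <= X)%O]fK g_le; case: v => b0 b1 b2 o /=; case: (f _).
  by rewrite -Order.le_val.
have /choice[emb embP] v : exists a : flagT Q, forall k, k < 6 -> at_lev a k = G v k.
  apply: flag_of_seq => -[_|k ltk].
    rewrite G1 /G /= lt_neqAle le0x andbT; apply/eqP => ex.
    have a0 : exists a : flagT Q, True.
      have ch0 : chain (set0 : {set Q}) by apply/forall_inP => q; rewrite inE.
      by have [A fA _] := chain_ext ch0; exists (exist _ A fA).
    by have [a _] := a0; have := levx; rewrite -ex -(at_lev0 a) lev_at.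
  by rewrite /G /= g_lt; apply: vface_lt.
exists emb; split=> [i v lt_i | v | u v e].
- apply: qadj_uniq; first by case/andP: lt_i.
    have ltS : i.+1 < 6 by lia.
    move/(congr1 (fun a => at_lev a i.+1)); rewrite !embP // /G /=.
    by move/val_inj/g_inj; apply: vface_vadj_neq.
  move=> k ltk nk; rewrite !embP // /G; case: eqP => // /eqP k0; congr (val (g _)).
  by apply: vface_vadj => //; lia.
- by rewrite embP.
apply: vface_inj => k lk; apply: g_inj; apply: val_inj.
have ltk : k < 6 by lia.
have := congr1 (fun a => at_lev a k) e; rewrite !embP // /G.
by case: eqP => // k0; move: lk; rewrite k0.
Qed.

End CubeFlags.

Lemma poset_iso_trans d1 d2 d3 (P1 : porderType d1) (P2 : porderType d2) (P3 : porderType d3) :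
  poset_iso P1 P2 -> poset_iso P2 P3 -> poset_iso P1 P3.
Proof.
move=> [f [fb fm]] [g [gb gm]]; exists (g \o f); split; first exact: bij_comp.
by move=> x y; rewrite /= gm fm.
Qed.

(** * The cover of [Q] with voltages in $PSL_2$ *)

Section Assembly.
Variables (Q : polytope 4) (a0 : flagT Q) (F : finFieldType) (z : F) (b c m : nat).
Hypothesis z4 : (z ^+ 4 = -1)%R.
Hypothesis two_neq0 : (2%:R != 0 :> F)%R.
Hypothesis primeF : forall x : F, exists k : nat, (x = k%:R)%R.
Hypothesis latP : forall t,
  in_lattice b c t <-> (t.1%:~R + z ^+ 2 * t.2%:~R = 0 :> F)%R.
Hypothesis nlat : ~ in_lattice b c (b%:Z, - c%:Z)%R.
Hypothesis m_ge2 : 2 <= m.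
Hypothesis dreg : directly_regular (val a0).
Hypothesis Q_type : of_type Q (torus_map m 0) cube_faces.
Hypothesis ndvd : ~~ (#|L2F F| %| #|Gamma_plus (val a0)|).

Local Notation MQ := (flag_maniplex a0).
Local Notation tau := (tauL z).

Let lt04 : 0 < 4 := isT.

Lemma cube_closed_volt (w : seq nat) (a : MQ) :
    all (fun i => 0 < i < 4) w -> walk w a = a -> volt tau (par a0 a) w = 1%g.
Proof.
move=> wA wa; have vx : is_vertex (at_lev a 1) by rewrite /is_vertex rank_lev lev_at.
have [emb [emb_adj emb1 emb_inj]] := cube_embedding vx (Q_type.2 _ vx).
pose v0 := VFlag false false false O012.
have [v ev] : exists v, a = emb v.
  have : lconn (X := MQ) 1 (emb v0) a by apply/qadj_lconn_at; rewrite // emb1.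
  apply: (conn_inv (R := fun a => exists v, a = emb v)); first by exists v0.
  by move=> i y lt_i i1 [v ->]; exists (vadj i v); rewrite emb_adj //; lia.
have walkE u v' : all (fun i => 0 < i < 4) u -> walk (X := MQ) u (emb v') = emb (vwalk u v').
  by elim: u v' => [//|i u IH] v' /= /andP[lt_i /IH <-]; rewrite emb_adj.
have vw : vwalk w v = v by apply: emb_inj; rewrite -walkE // -ev.
by apply: cube_volt vw.
Qed.

Definition the_cover : cover_data 4 :=
  @CoverData 4 MQ (par a0) _ _ (L2F_group F) (Gamma_plus_group (val a0)) (@flag_act 4 Q) tau isT
    (fun i a lt_i => par_qadj lt04 dreg a lt_i)
    (fun k kK => flag_act_aut (a0 := a0) (subsetP (Gp_sub lt04 dreg) k kK))
    (flag_act1 a0)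
    (fun k h a kK hK => flag_actM a0 a (subsetP (Gp_sub lt04 dreg) k kK) (subsetP (Gp_sub lt04 dreg) h hK))
    (fun k h a kK hK e => flag_act_free a0 (subsetP (Gp_sub lt04 dreg) k kK) (subsetP (Gp_sub lt04 dreg) h hK) e)
    (fun k a kK => par_Gp lt04 dreg a kK)
    (fun a b e => par_trans lt04 dreg e)
    (tauL_in z4) erefl (tauL_gen z4 primeF) (tauL_comm z4)
    (L2F_simple z4 two_neq0 primeF) ndvd cube_closed_volt.

Local Notation C := the_cover.
Local Notation X := (cover_maniplex C).
Local Notation P := (polytope_of X).
Local Notation repP := (cface_represents C).

Lemma rank_cface (x : X) k : k < 6 -> Defs.rank (cface x k : P) = (k%:Z - 1)%R.
Proof. exact: mface_rankE. Qed.

Lemma cover_no_refl (al : X -> X) x : maut al -> par a0 (val (al x)).2 = par a0 (val x).2.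
Proof.
have w3 := tword_all b c.
have w4 : all (fun i => i < 4) (tword b c) by apply: sub_all w3 => i; lia.
apply: (@cover_chiral 4 C _ w4 (tword_even b c)).
  have := hL_walk z4 u0 w3; rewrite uwalk_tword => e; apply: (mulgI (hL z u0)).
  apply: etrans (esym e) (etrans _ (esym (mulg1 _))).
  by apply/(hL_ker z4)/latP; apply: dvec_lattice.
(* An odd flag: from it the same word translates by $(c, b)$, a mirror image of $(b, c)$ outside the
   lattice. *)
pose u1 := UFlag 0 0 true false false.
have := hL_walk z4 u1 w3; rewrite uwalk_tword => e e1.
apply: (@dvec_nlattice b c u1 nlat) => //; apply/latP/(hL_ker z4 _ u1).
apply: etrans e _; apply: etrans (congr1 (mulg (hL z u1)) e1) (mulg1 _).
Qed.

(** A plane flag is sent to its voltage [hL] paired with its image in a facet of [Q], so two plane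
    flags are identified exactly when both lattice conditions hold. *)
Lemma facet_embedding (B D : nat) (x : X) :
    (forall t, in_lattice B D t <->
       in_lattice m 0 t /\ (t.1%:~R + z ^+ 2 * t.2%:~R = 0 :> F)%R) ->
  exists emb : uflag -> X,
    [/\ forall i u, i < 3 -> emb (uadj i u) = adj i (emb u), lconn 4 x (emb u0) &
        forall u v, emb u = emb v <-> exists2 t, in_lattice B D t & u = utr t v].
Proof.
move=> latBD; set FQ := at_lev (val x).2 4.
have facetFQ : is_facet FQ by rewrite /is_facet /FQ rank_lev lev_at.
have [e0 [e0_adj e0_4 e0_ker]] := torus_embedding m_ge2 facetFQ (Q_type.1 _ facetFQ).
have [embQ [eQ_adj eQ_4 eQ_ker eQ_par]] : exists embQ : uflag -> flagT Q,
  [/\ forall i u, i < 3 -> embQ (uadj i u) = qadj i (embQ u),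
      forall u, at_lev (embQ u) 4 = FQ,
      forall u v, embQ u = embQ v <-> exists2 t, in_lattice m 0 t & u = utr t v &
      forall u, par a0 (embQ u) = upar u].
  have e0_par u : par a0 (e0 u) = upar u (+) par a0 (e0 u0).
    have [w wA <-] := uwalk_conn u; elim/last_ind: w wA => [//|w i IH].
    rewrite all_rcons => /andP[lt_i3 /IH e]; rewrite -cats1 uwalk_cat /=.
    by rewrite upar_uadj e0_adj // (par_qadj lt04 dreg) ?e ?addNb //; lia.
  (* The unfolding of the facet may reverse the classes; a reflection of the plane that normalises
     the lattice then corrects it. *)
  case ep : (par a0 (e0 u0)) e0_par => e0_par; last first.
    by exists e0; split=> // u; rewrite e0_par addbF.
  have [fl_adj fl_lat] := usym_flip m true false.
  have flK u : uflip true false (uflip true false u) = u.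
    by case: u => x1 y1 e sx sy; rewrite /= /sg !addbT negbK !addbF; congr UFlag; lia.
  exists (e0 \o uflip true false); split=> [i u lt_i3|u|u v|u] /=.
  - by rewrite fl_adj // e0_adj.
  - exact: e0_4.
  - split=> [/e0_ker[t tL e]|[t tL ->]].
      have [s sL es] := fl_lat t (uflip true false v) tL.
      by exists s => //; rewrite -[LHS]flK e es flK.
    by apply/e0_ker; apply: fl_lat.
  - rewrite e0_par; case: u => x1 y1 e sx sy.
    by rewrite /upar /=; case: e; case: sx; case: sy.
have [y0 y02 cy0] : exists2 y0 : X, (val y0).2 = embQ u0 & lconn 4 x y0.
  apply: (@cover_lift 4 C (fun i => i.+1 != 4) x (embQ u0)).
  by apply/qadj_lconn_at; rewrite // eQ_4.
have lin u : ((val y0).1 * (hL z u0)^-1 * hL z u)%g \in L2F F.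
  by rewrite !groupM ?groupV ?(hL_in z4) //; apply: (valP y0).
pose emb u : X := @mkcover 4 C _ (lin u) (embQ u).
exists emb; split=> [i u lt_i3||u v].
- apply: cover_ext; last exact: eQ_adj.
  apply: etrans (congr1 (mulg _) (hL_adj z4 u lt_i3)) _.
  by rewrite mulgA -(eQ_par u).
- have <- : y0 = emb u0; last exact: cy0.
  by apply: cover_ext => //; rewrite /= mulgKV.
split=> [e|[t /latBD[tm /(hL_ker z4 _ v) tz] ->]].
  have /eQ_ker[t tL eu] := congr1 (fun y : X => (val y).2) e.
  exists t => //; apply/latBD; split=> //; apply/(hL_ker z4 t v).
  have := congr1 (fun y : X => (val y).1) e => /= /mulgI; rewrite eu; exact: id.
apply: cover_ext; first by rewrite /= tz.
by apply/eQ_ker; exists t.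
Qed.

Lemma cover_vertex_figures (v : P) : is_vertex v -> poset_iso (vertex_figure v) cube_faces.
Proof.
have [x [k [ltk ->]]] := rep_surj repP v.
rewrite /is_vertex rank_cface // => ek; have -> : k = 1 by lia.
have vx : is_vertex (at_lev (val x).2 1) by rewrite /is_vertex rank_lev lev_at.
apply: poset_iso_trans (Q_type.2 _ vx).
exact: (@vertex_figure_iso 4 C Q _ (at_lev_represents a0) P _ repP x).
Qed.

Lemma cover_facets (B D : nat) (Fc : P) :
    (forall t, in_lattice B D t <->
       in_lattice m 0 t /\ (t.1%:~R + z ^+ 2 * t.2%:~R = 0 :> F)%R) -> is_facet Fc ->
  [/\ poset_iso (facet Fc) (torus_map B D),
      ~ in_lattice B D (B%:Z, - D%:Z)%R -> chiral (facet Fc) &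
      (forall u v, exists2 h, usym B D h & h u = v) -> regular (facet Fc)].
Proof.
move=> latBD /(facet_top repP rank_cface)[x defF].
have [emb [emb_adj emb_base emb_ker]] := facet_embedding x latBD.
split.
- exact: (facet_torus_iso repP defF emb_adj emb_base emb_ker).
- move=> nl; apply: (facet_chiral repP defF emb_adj emb_base emb_ker (col := fun y => par a0 (val y).2)) => //.
    by move=> i y lt_i; apply: (par_qadj lt04 dreg).
  move=> y y' /(@dact_trans 4 C y y')[g gD eg]; exists (dact g) => //; exact: dact_aut.
- exact: (facet_regular repP defF emb_adj emb_base emb_ker).
Qed.

Lemma the_cover_chiral : chiral P.
Proof. exact: cover_polytope_chiral cover_no_refl. Qed.

Lemma the_cover_isog : (Gamma P \isog setX (L2F F) (Gamma_plus (val a0)))%g.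
Proof. exact: cover_Gamma_isog cover_no_refl. Qed.

End Assembly.

(** * Sums of two squares modulo a prime *)

Section PrimeField.
Variable p : nat.
Hypothesis p_prime : prime p.
Local Open Scope ring_scope.

Lemma Fp_nat0 n : (n%:R == 0 :> 'F_p) = (p %| n)%N.
Proof. by rewrite (dvdn_pcharf (pchar_Fp p_prime)). Qed.

Lemma Fp_int0 (x : int) : (x%:~R == 0 :> 'F_p) = (p %| absz x)%N.
Proof.
case: x => n; first by rewrite -pmulrn Fp_nat0.
by rewrite NegzE rmorphN oppr_eq0 /= -pmulrn Fp_nat0.
Qed.

Lemma Fp_natP (x : 'F_p) : exists k : nat, x = k%:R.
Proof. by exists (val x); rewrite natr_Zp. Qed.

(** Write $p = 8d + 1$. The polynomial $X^{4d} - 1$ has at most $4d$ roots among the $8d$ nonzero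
    elements; for an [x] outside them, $x^d$ is a fourth root of $-1$, and its square is [s] or
    [- s]. *)
Lemma Fp_fourth_root (s : 'F_p) : (p = 1 %[mod 8])%N -> s * s = -1 -> exists z : 'F_p, z ^+ 2 = s.
Proof.
move=> p8 ss; pose d := (p %/ 8)%N.
have pd : p = (8 * d).+1 by rewrite [LHS](divn_eq p 8) p8 addn1 mulnC.
have d_gt0 : (0 < d)%N by rewrite lt0n; apply: contraTneq p_prime => d0; rewrite pd d0.
have [x x0 x4d] : exists2 x : 'F_p, x != 0 & x ^+ (4 * d) != 1.
  pose rs := enum [pred x : 'F_p | x != 0].
  have size_rs : size rs = (8 * d)%N.
    have -> : (8 * d = p.-1)%N by lia.
    rewrite -cardE; transitivity #|predC1 (0 : 'F_p)|; last by rewrite cardC1 card_Fp.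
    by apply: eq_card => x; rewrite !inE.
  have [/allP h|/allPn[x]] := boolP (all (fun x : 'F_p => x ^+ (4 * d) == 1) rs); last first.
    by rewrite mem_enum inE => x0 x4d; exists x.
  have d4 : (0 < 4 * d)%N by lia.
  have sz := size_XnsubC (1 : 'F_p) d4.
  have pn0 : 'X^(4 * d) - 1%:P != 0 :> {poly 'F_p} by rewrite -size_poly_eq0 sz.
  have := max_poly_roots pn0 (rs := rs); rewrite sz size_rs => lt_rs.
  exfalso; suff : (8 * d < (4 * d).+1)%N by lia.
  apply: lt_rs; last exact: enum_uniq.
  by apply/allP => x /h /eqP e; rewrite rootE !hornerE e subrr.
pose z0 := x ^+ d.
have z04 : z0 ^+ 4 = -1.
  have e8 : x ^+ (8 * d) = 1.
    have := finfield.expf_card x; rewrite (card_Fp p_prime) => e.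
    by apply: (mulfI x0); rewrite -exprS -pd e mulr1.
  have : (z0 ^+ 4 - 1) * (z0 ^+ 4 + 1) = 0.
    have -> : (z0 ^+ 4 - 1) * (z0 ^+ 4 + 1) = (z0 ^+ 8) - 1 by ring.
    by rewrite -exprM mulnC e8 subrr.
  move/eqP; rewrite mulf_eq0 subr_eq0 addr_eq0 => /orP[|/eqP //].
  by rewrite -exprM mulnC (negPf x4d).
have : (z0 ^+ 2 - s) * (z0 ^+ 2 + s) = 0.
  have -> : (z0 ^+ 2 - s) * (z0 ^+ 2 + s) = z0 ^+ 4 - s * s by ring.
  by rewrite z04 ss subrr.
move/eqP; rewrite mulf_eq0 subr_eq0 addr_eq0 => /orP[] /eqP e; first by exists z0.
(* If the square is [- s], the cube has square $(-s)^3 = s$. *)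
exists (z0 ^+ 3); rewrite -exprM mulnC exprM e.
have -> : (- s) ^+ 3 = - (s * s) * s by ring.
by rewrite ss opprK mul1r.
Qed.

End PrimeField.

Section SumOfSquares.
Variables (p b c : nat).
Hypotheses (p_prime : prime p) (b_gt0 : 0 < b) (c_gt0 : 0 < c) (p_sum : p = b ^ 2 + c ^ 2).
Local Open Scope ring_scope.

Lemma sum_sq_neq0 : b%:R != 0 :> 'F_p /\ c%:R != 0 :> 'F_p.
Proof.
rewrite !(Fp_nat0 p_prime); split; apply/negP => /dvdn_leq; rewrite p_sum.
  by move/(_ b_gt0); nia.
by move/(_ c_gt0); nia.
Qed.

(** In $\mathbb Z[i]$ the lattice is the ideal of $b + ic$. Membership of $x + iy$ is tested by
    multiplying with $b - ic$: both parts of the product are divisible by the norm $p$, and the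
    quotients are the coefficients. *)
Lemma lattice_FpP (s : 'F_p) : b%:R + s * c%:R = 0 -> s * s = -1 -> forall t,
  in_lattice b c t <-> t.1%:~R + s * t.2%:~R = 0 :> 'F_p.
Proof.
move=> bsc ss t; have eb : b%:R = - (s * c%:R) :> 'F_p by apply/eqP; rewrite -addr_eq0 bsc.
split=> [[k [l ->]] /= | ].
  rewrite !(rmorphD, rmorphB, rmorphN, rmorphM) /= -!pmulrn eb.
  have -> : k%:~R * - (s * c%:R) - l%:~R * c%:R + s * (k%:~R * c%:R + l%:~R * - (s * c%:R)) =
    - l%:~R * c%:R * (1 + s * s) :> 'F_p by ring.
  by rewrite ss subrr mulr0.
case: t => x y /= e.
have d1 : ((b%:Z * x + c%:Z * y)%:~R == 0 :> 'F_p).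
  rewrite !(rmorphD, rmorphM) /= -!pmulrn eb.
  have -> : - (s * c%:R) * x%:~R + c%:R * y%:~R =
    - (s * c%:R) * (x%:~R + s * y%:~R) + c%:R * y%:~R * (1 + s * s) :> 'F_p by ring.
  by rewrite e ss subrr !mulr0 addr0.
have d2 : ((c%:Z * x - b%:Z * y)%:~R == 0 :> 'F_p).
  rewrite !(rmorphB, rmorphM) /= -!pmulrn eb.
  have -> : c%:R * x%:~R - - (s * c%:R) * y%:~R = c%:R * (x%:~R + s * y%:~R) :> 'F_p by ring.
  by rewrite e mulr0.
move: d1 d2; rewrite !(Fp_int0 p_prime) => d1 d2.
have /dvdzP[k ek] : (p%:Z %| b%:Z * x + c%:Z * y)%Z by rewrite dvdzE.
have /dvdzP[l el] : (p%:Z %| c%:Z * x - b%:Z * y)%Z by rewrite dvdzE.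
have p0 : (p%:Z != 0) by have := prime_gt0 p_prime; lia.
have eP : p%:Z = b%:Z * b%:Z + c%:Z * c%:Z by rewrite p_sum; lia.
exists k, (- l); congr pair; apply: (mulIf p0); rewrite {1}eP.
  have -> : x * (b%:Z * b%:Z + c%:Z * c%:Z) =
    b%:Z * (b%:Z * x + c%:Z * y) + c%:Z * (c%:Z * x - b%:Z * y) by ring.
  by rewrite ek el; ring.
have -> : y * (b%:Z * b%:Z + c%:Z * c%:Z) =
  c%:Z * (b%:Z * x + c%:Z * y) - b%:Z * (c%:Z * x - b%:Z * y) by ring.
by rewrite ek el; ring.
Qed.

Lemma lattice_mulP (m : nat) (t : int * int) : in_lattice (m * b) (m * c) t <->
  exists2 s, in_lattice b c s & t = (s.1 * m%:Z, s.2 * m%:Z).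
Proof.
split=> [[k [l ->]] | [s [k [l ->]] ->]].
  exists (k * b%:Z - l * c%:Z, k * c%:Z + l * b%:Z); first by exists k, l.
  by rewrite /= !PoszM; congr pair; ring.
by exists k, l; rewrite /= !PoszM; congr pair; ring.
Qed.

End SumOfSquares.

Theorem theorem7p4 (p b c m : nat) (Q : polytope 4) (Phi : {set Q})
    (p_prime : prime p) (p_mod8 : p = 1 %[mod 8])
    (b_gt0 : 0 < b) (c_gt0 : 0 < c) (p_sum : p = b ^ 2 + c ^ 2)
    (m_ge2 : 2 <= m)
    (Phi_flag : flag Phi) (Q_dreg : directly_regular Phi)
    (Q_type : of_type Q (torus_map m 0) cube_faces)
    (Q_ndvd : ~~ (p * (p ^ 2 - 1) %| #|Gamma Q|)) :
  exists P : polytope 4,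
    [/\ chiral P,
        Gamma P \isog setX (L2 p) (Gamma_plus Phi),
        p %| m ->
          of_type P (torus_map m 0) cube_faces /\
          (forall F : P, is_facet F -> regular (facet F))
      & ~~ (p %| m) ->
          of_type P (torus_map (m * b) (m * c)) cube_faces /\
          (forall F : P, is_facet F -> chiral (facet F))].
Proof.
have [b0 c0] := sum_sq_neq0 p_prime b_gt0 c_gt0 p_sum.
pose s : 'F_p := (- b%:R / c%:R)%R.
have bsc : (b%:R + s * c%:R = 0)%R by rewrite divfK // subrr.
have ss : (s * s = -1)%R.
  have bb : (b%:R * b%:R + c%:R * c%:R = 0 :> 'F_p)%R.
    by apply/eqP; rewrite -!natrM -natrD (Fp_nat0 p_prime) !mulnn -p_sum.
  have eb : (b%:R * b%:R = - (c%:R * c%:R) :> 'F_p)%R by apply/eqP; rewrite -addr_eq0 bb.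
  have -> : (s * s = (b%:R * b%:R) * (c%:R^-1 * c%:R^-1))%R by rewrite /s; ring.
  by rewrite eb mulNr mulrACA divff // mulr1.
have [z z2] := Fp_fourth_root p_prime p_mod8 ss.
have z4 : (z ^+ 4 = -1)%R by rewrite -[4]/(2 * 2) exprM z2 expr2.
have p_gt2 : 2 < p.
  by rewrite ltn_neqAle prime_gt1 // andbT; apply: contra_eq_neq p_mod8 => <-.
have two_neq0 : (2%:R != 0 :> 'F_p)%R.
  by rewrite (Fp_nat0 p_prime); apply/negP => /dvdn_leq; lia.
have latP t : in_lattice b c t <-> (t.1%:~R + z ^+ 2 * t.2%:~R = 0 :> 'F_p)%R.
  by rewrite z2; apply: lattice_FpP.
(* Otherwise $b - sc = 0$ besides $b + sc = 0$, so $2b = 0$ modulo $p$. *)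
have nlat : ~ in_lattice b c (b%:Z, - c%:Z)%R.
  move/latP; rewrite z2 /= rmorphN /= -!pmulrn => e.
  case/negP: (mulf_neq0 two_neq0 b0); apply/eqP.
  have -> : (2%:R * b%:R = (b%:R + s * c%:R) + (b%:R + s * - c%:R) :> 'F_p)%R by ring.
  by rewrite e bsc addr0.
pose a0 : flagT Q := exist (fun A : {set Q} => is_true (flag A)) Phi Phi_flag.
have dreg : directly_regular (val a0) by [].
(* $p(p^2-1)$ divides $2|L|$, and $|\Gamma(\mathcal Q)| = 2|\Gamma^+(\mathcal Q)|$. *)
have ndvd : ~~ (#|L2F 'F_p| %| #|Gamma_plus (val a0)|).
  apply: contraNN Q_ndvd => dv; have := card_L2F 'F_p; rewrite card_Fp // => /dvdn_trans; apply.
  by rewrite (card_Gamma (isT : 0 < 4) dreg) mulnC; apply: dvdn_mul.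
pose C := the_cover z4 two_neq0 (@Fp_natP p) m_ge2 dreg Q_type ndvd.
have facets := @cover_facets Q a0 _ z m z4 two_neq0 (@Fp_natP p) m_ge2 dreg Q_type ndvd.
have verts := @cover_vertex_figures Q a0 _ z m z4 two_neq0 (@Fp_natP p) m_ge2 dreg Q_type ndvd.
exists (polytope_of (cover_maniplex C)); split.
- exact: (the_cover_chiral z4 two_neq0 (@Fp_natP p) latP nlat m_ge2 dreg Q_type ndvd).
- exact: (the_cover_isog z4 two_neq0 (@Fp_natP p) latP nlat m_ge2 dreg Q_type ndvd).
(* As $m$ vanishes modulo $p$, the translations by multiples of $m$ have trivial voltage, and the
   lattice of [Q] is unchanged. *)
- move=> pm; have latE t : in_lattice m 0 t <->
      in_lattice m 0 t /\ (t.1%:~R + z ^+ 2 * t.2%:~R = 0 :> 'F_p)%R.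
    split=> [tL|[]//]; split=> //; have [k [l ->]] := iffLR (lattice_squareP m t) tL.
    have m0 : (m%:R = 0 :> 'F_p)%R by apply/eqP; rewrite (Fp_nat0 p_prime).
    by rewrite /= !rmorphM /= -!pmulrn m0 !mulr0 addr0.
  split; first by split=> [Fc Ff|v]; [have [] := facets _ _ Fc latE Ff | apply: verts].
  by move=> Fc Ff; have [_ _] := facets _ _ Fc latE Ff; apply; apply: usym_trans.
(* As $m$ is invertible modulo $p$, the condition on $m(x, y)$ is one on $(x, y)$, that is
   membership in the lattice of $(b, c)$. *)
- move=> npm; have latE t : in_lattice (m * b) (m * c) t <->
      in_lattice m 0 t /\ (t.1%:~R + z ^+ 2 * t.2%:~R = 0 :> 'F_p)%R.
    rewrite lattice_mulP; split=> [[[x y] xyL ->] | [/lattice_squareP[x [y ->]] e]].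
      split; first by apply/lattice_squareP; exists x, y.
      move/latP: xyL => /= e; rewrite !rmorphM /= mulrA -mulrDl e; exact: mul0r.
    exists (x, y) => //; apply/latP => /=; move: e; rewrite /= !rmorphM /= mulrA -mulrDl.
    move/eqP; rewrite mulf_eq0 => /orP[/eqP // | ].
    by rewrite -pmulrn (Fp_nat0 p_prime) (negPf npm).
  have nl : ~ in_lattice (m * b) (m * c) ((m * b)%:Z, - (m * c)%:Z)%R.
    move/lattice_mulP => [[x y] xyL []] /= ex ey; apply: nlat.
    have m0 : (m%:Z != 0)%R by lia.
    have -> : (b%:Z = x)%R by apply: (mulIf m0); rewrite -ex PoszM mulrC.
    have -> : (- c%:Z = y)%R by apply: (mulIf m0); rewrite -ey PoszM mulNr mulrC.
    exact: xyL.
  split; first by split=> [Fc Ff|v]; [have [] := facets _ _ Fc latE Ff | apply: verts].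
  by move=> Fc Ff; have [_ h _] := facets _ _ Fc latE Ff; apply: h.
Qed.
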